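(* Let $X$ be an infinite Stein manifold (i.e. $X$ is not a finite set of points) such that the group $\mathrm{Aut}(X)$ of holomorphic automorphisms of $X$ is a Lie group. Then there exist an $N\in\mathbb{N}$ and an embedding $j:X\to\mathbb{C}^N$ such that no non-trivial automorphism of $X$ extends to $\mathbb{C}^N$; that is, for no $g\in\mathrm{Aut}(X)\setminus\{\mathrm{id}\}$ is there a holomorphic automorphism $\Phi$ of $\mathbb{C}^N$ with $\Phi\circ j=j\circ g$.
   Context: Embedding means proper holomorphic embedding: a proper holomorphic map which is injective and immersive. Lie groups are real Lie groups, by convention locally compact with countable topology (second countable). ''$\mathrm{Aut}(X)$ is a Lie group'' refers to $\mathrm{Aut}(X)$ with the compact-open topology, acting on $X$ in the natural way. *)

(* Defs.v *)
From HB Require Import structures.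
From mathcomp Require Import all_boot all_order all_algebra.
From mathcomp Require Import all_classical all_reals all_analysis.
From mathcomp Require Import complex.

Set Implicit Arguments.
Unset Strict Implicit.
Unset Printing Implicit Defensive.

Import Order.TTheory GRing.Theory Num.Theory.
Import numFieldNormedType.Exports.

Local Open Scope classical_set_scope.
Local Open Scope ring_scope.

(* All maps are total; [cmap] and [cinv] are only meaningful on [cdom] and on
   its image, respectively. *)
Record chart (K : numFieldType) (X : topologicalType) (n : nat) := Chart {
  cdom : set X;
  cmap : X -> 'rV[K]_n;
  cinv : 'rV[K]_n -> X;
  cdom_open : open cdom;
  cimg_open : open (cmap @` cdom);
  cmapK : forall x, cdom x -> cinv (cmap x) = x;
  cmap_continuous : forall x, cdom x -> {for x, continuous cmap};
  cinv_continuous : forall x, cdom x -> {for cmap x, continuous cinv}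
}.

(* A class of regular maps on open subsets of normed spaces: complex
   differentiable maps for K = R[i], smooth maps for K = R. *)
Definition regularity (K : numFieldType) : Type :=
  forall V W : normedModType K, set V -> (V -> W) -> Prop.

Definition diff_on (K : numFieldType) : regularity K :=
  fun V W U f => forall x, U x -> differentiable f x.

(* On a finite-dimensional V, the differential of f is C^k if and only if
   ['d f x v] is C^k in x for every v. *)
Fixpoint Ck_on (K : numFieldType) (k : nat) (V W : normedModType K) (U : set V)
    (f : V -> W) {struct k} : Prop :=
  match k with
  | 0%N => forall x, U x -> {for x, continuous f}
  | k'.+1 => diff_on U f /\ forall v, Ck_on k' U (fun x => 'd f x v)
  end.

Definition smooth_on (K : numFieldType) : regularity K :=
  fun V W U f => forall k, Ck_on k U f.

Definition compatible (K : numFieldType) (reg : regularity K)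
    (X : topologicalType) (n : nat) (c c' : chart K X n) : Prop :=
  reg _ _ (cmap c @` (cdom c `&` cdom c')) (cmap c' \o cinv c).

Definition is_manifold (K : numFieldType) (reg : regularity K)
    (X : topologicalType) (n : nat) (A : set (chart K X n)) : Prop :=
  [/\ hausdorff_space X,
      @second_countable X,
      forall x, exists2 c, A c & cdom c x &
      forall c c', A c -> A c' -> compatible reg c c'].

Definition manifold_map (K : numFieldType) (reg : regularity K)
    (X Y : topologicalType) (m n : nat) (A : set (chart K X m))
    (B : set (chart K Y n)) (f : X -> Y) : Prop :=
  continuous f /\
  forall c c', A c -> B c' ->
    reg _ _ (cmap c @` (cdom c `&` f @^-1` cdom c')) (cmap c' \o f \o cinv c).

Definition Cspace (R : realType) (N : nat) : normedModType R[i] := 'rV[R[i]]_N.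

Record complex_manifold (R : realType) (n : nat) := ComplexManifold {
  carrier :> topologicalType;
  atlas : set (chart R[i] carrier n);
  atlasP : is_manifold (@diff_on R[i]) atlas
}.

Definition holomorphic_self_map (R : realType) (n : nat)
    (X : complex_manifold R n) (f : X -> X) : Prop :=
  manifold_map (@diff_on R[i]) (@atlas _ _ X) (@atlas _ _ X) f.

Definition holomorphic (R : realType) (n : nat) (X : complex_manifold R n)
    (W : normedModType R[i]) (f : X -> W) : Prop :=
  forall c, atlas c -> diff_on (cmap c @` cdom c) (f \o cinv c).

Definition holomorphic_hull (R : realType) (n : nat) (X : complex_manifold R n)
    (K : set X) : set X :=
  [set x | forall f : X -> (R[i])^o, holomorphic f ->
     ComplexField.Normc.normc (f x)
       <= sup [set ComplexField.Normc.normc (f y) | y in K]].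

(* The last condition asks for n global functions forming a coordinate system
   at x, i.e. a chart of the maximal atlas that is the restriction of a global
   holomorphic map to C^n. *)
Definition stein (R : realType) (n : nat) (X : complex_manifold R n) : Prop :=
  [/\ forall K : set X, compact K -> compact (holomorphic_hull K),
      forall x y : X, x <> y ->
        exists2 f : X -> (R[i])^o, holomorphic f & f x <> f y &
      forall x : X, exists (f : X -> Cspace R n) (c : chart R[i] X n),
        [/\ holomorphic f,
            forall c', atlas c' -> compatible (@diff_on R[i]) c c' /\
                                   compatible (@diff_on R[i]) c' c,
            cdom c x &
            forall y, cdom c y -> cmap c y = f y]].

Definition automorphism (R : realType) (n : nat) (X : complex_manifold R n) :
    set {compact-open, X -> X} :=
  [set f : {compact-open, X -> X} | holomorphic_self_map f /\
     exists g : X -> X,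
       [/\ holomorphic_self_map g, cancel f g & cancel g f]].
Arguments automorphism {R n} X _.

(* As a type, a set carries the subspace topology, so this is Aut(X) with the
   compact-open topology. *)
Definition Aut (R : realType) (n : nat) (X : complex_manifold R n) :
    topologicalType := automorphism X.

Definition aut_fun (R : realType) (n : nat) (X : complex_manifold R n)
    (g : Aut X) : X -> X := set_val g.

Lemma near_eq_differentiable (K : numFieldType) (V W : normedModType K)
    (f g : V -> W) (x : V) :
  {near x, f =1 g} -> differentiable f x -> differentiable g x.
Proof.
move=> fg df.
have fgx : f x = g x := nbhs_singleton fg.
have fg0 : \forall h \near (0 : V), f (h + x) = g (h + x).
  by rewrite (near_shift x) sub0r; near=> y => /=; rewrite subrK; near: y.
have dg : g \o shift x = cst (g x) + 'd f x +o_ 0 id.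
  apply/eqaddoP => e e0.
  have /eqaddoP/(_ e e0) := diff_locally df.
  by apply: filterS2 fg0 => h /= fgh; rewrite !fctE /= -fgh fgx.
have dd : 'd g x = 'd f x :> (V -> W).
  by apply: diff_unique dg; exact: diff_continuous.
apply/diff_locallyP; rewrite dd; split => //; exact: diff_continuous.
Unshelve. all: by end_near. Qed.

Lemma holomorphic_self_map_comp (R : realType) (n : nat)
    (X : complex_manifold R n) (g f : X -> X) :
  holomorphic_self_map g -> holomorphic_self_map f ->
  holomorphic_self_map (g \o f).
Proof.
move=> [cg hg] [cf hf]; split.
  by move=> x; apply: continuous_comp; [exact: cf|exact: cg].
move=> c c' Ac Ac' _ [x [cx c'x] <-].
have [_ _ cover _] := atlasP X.
have [c1 Ac1 c1x] := cover (f x).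
have ix : {for cmap c x, continuous (f \o cinv c)}.
  apply: continuous_comp; first exact: cinv_continuous.
  exact: cf.
have nx : \forall v \near cmap c x, cdom c1 (f (cinv c v)).
  apply: ix; rewrite /= cmapK//.
  by apply: open_nbhs_nbhs; split => //; exact: cdom_open.
apply: (@near_eq_differentiable _ _ _
    ((cmap c' \o g \o cinv c1) \o (cmap c1 \o f \o cinv c))).
  by near=> v => /=; rewrite cmapK//; near: v.
apply: differentiable_comp; first by apply: hf => //; exists x.
by apply: hg => //; exists (f x); rewrite //= cmapK.
Unshelve. all: by end_near. Qed.

Lemma automorphism_comp (R : realType) (n : nat) (X : complex_manifold R n)
    (g f : {compact-open, X -> X}) :
  automorphism X g -> automorphism X f -> automorphism X (g \o f).
Proof.
move=> [hg [g' [hg' gK g'K]]] [hf [f' [hf' fK f'K]]]; split.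
  exact: holomorphic_self_map_comp.
exists (f' \o g'); split; first exact: holomorphic_self_map_comp.
- exact: can_comp.
- exact: can_comp.
Qed.

Definition aut_mul (R : realType) (n : nat) (X : complex_manifold R n)
    (g f : Aut X) : Aut X :=
  exist _ (aut_fun g \o aut_fun f)
    (mem_set (automorphism_comp (set_valP g) (set_valP f))).

Definition is_group (G : Type) (mul : G -> G -> G) (one : G) (inv : G -> G) :
    Prop :=
  [/\ associative mul, left_id one mul, right_id one mul,
      left_inverse one inv mul & right_inverse one inv mul].

(* Smoothness of [mul] is expressed in the charts of the product G x G given by
   pairs of charts of G. *)
Definition is_lie_group (R : realType) (G : topologicalType)
    (mul : G -> G -> G) : Prop :=
  exists (one : G) (inv : G -> G) (d : nat) (B : set (chart R G d)),
    [/\ is_group mul one inv,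
        is_manifold (@smooth_on R) B,
        manifold_map (@smooth_on R) B B inv,
        continuous (fun p : G * G => mul p.1 p.2) &
        forall c1 c2 c3, B c1 -> B c2 -> B c3 ->
          smooth_on
            [set p : 'rV[R]_d * 'rV[R]_d |
               [/\ (cmap c1 @` cdom c1) p.1, (cmap c2 @` cdom c2) p.2 &
                   cdom c3 (mul (cinv c1 p.1) (cinv c2 p.2))]]
            (fun p => cmap c3 (mul (cinv c1 p.1) (cinv c2 p.2)))].

Definition immersive (R : realType) (n : nat) (X : complex_manifold R n)
    (W : normedModType R[i]) (j : X -> W) : Prop :=
  forall c x, atlas c -> cdom c x -> injective ('d (j \o cinv c) (cmap c x)).

Definition embedding (R : realType) (n : nat) (X : complex_manifold R n)
    (N : nat) (j : X -> Cspace R N) : Prop :=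
  [/\ holomorphic j,
      injective j,
      immersive j &
      forall K : set (Cspace R N), compact K -> compact (j @^-1` K)].

Definition CN_automorphism (R : realType) (N : nat)
    (Phi : Cspace R N -> Cspace R N) : Prop :=
  diff_on setT Phi /\
  exists Psi : Cspace R N -> Cspace R N,
    [/\ diff_on setT Psi, cancel Phi Psi & cancel Psi Phi].

(* Main.v *)
Require Import Defs.
From HB Require Import structures.
From mathcomp Require Import all_boot all_order all_algebra.
From mathcomp Require Import all_classical all_reals all_analysis.
From mathcomp Require Import complex.
From mathcomp Require Import perm ring lra zify.
Set Implicit Arguments.
Unset Strict Implicit.
Unset Printing Implicit Defensive.
Import Order.TTheory GRing.Theory Num.Theory.
Import numFieldNormedType.Exports.
Local Open Scope classical_set_scope.
Local Open Scope ring_scope.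

(* Of the Lie group structure of Aut(X) only local compactness, second
   countability and the continuity of inversion matter. The embedding
   j : X -> C^(2m), m = 4n+1, is a limit of holomorphic maps whose two blocks of m
   coordinates are made large on consecutive shells of an exhaustion of X, while
   the values at a discrete set of points are prescribed up to small errors.
   Covering a compact set by O(q^(2n)) cells on which the given functions vary by
   O(1/q) and counting shows that a generic combination of large functions is
   large everywhere as soon as m > 4n; the same count, on
   pairs of points and on the unit tangent bundle, gives injectivity and
   immersivity.
   For each level s the points of a family E_s are mapped close to a finite net D_s
   of the shell 8s+4 <= |w| <= 8s+5, and a further point p to norm 8s. They are so
   far out that any given g in Aut(X) moves all E_s with s large to points where
   |j| >= 8s+3, and, if g is not the identity, moves one of the points p, at
   arbitrarily high levels s, to a point where |j| > 8s+5.
   Rosay and Rudin: if D_s is fine enough, an automorphism F of C^N that is bounded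
   by 8s+13 on a ball, has Jacobian determinant bounded below at one point and
   misses (a perturbation of) D_s, is bounded by 8s+5 on a slightly smaller ball.
   If F o j = j o g, then F misses the nets on the relevant balls, and descending
   from a huge s to a fixed s0 yields |F| <= 8 s0 + 5 on the ball of radius
   8 s0 + 1, contradicting the choice of p. If n = 0, then Aut(X) is the group of all
   permutations of an infinite discrete space, which is not locally compact. *)

(** The bound 4n arises twice. Pairs of points and unit tangent vectors are covered by O(q^(4n))
    cells. For largeness the cells are only those of X, but the summands are P-th powers, which vary
    little compared with their size only on cells of diameter about 1/P^2; these number about P^(4n)
    and compete with a grid of P coefficient values in each of the m rows. Two blocks are used
    because functions can be enlarged freely only off a holomorphic hull. Passing from a compact set
    to one that contains its hull leaves a layer without control; the shells of the second block are
    shifted by one step and cover it. The complex analysis rests on the maximum principle applied to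
    difference quotients. The Taylor inequality obtained in this way involves only values of the
    function and therefore passes to pointwise limits of bounded sequences. The fineness required of
    a net depends on bounds for F and not on F itself: the nets are fixed before j, hence before any
    automorphism of C^N is considered. *)

Notation cn := ComplexField.Normc.normc.

(** * The real-valued modulus of complex numbers *)

Section ComplexNorm.
Variable R : realType.
Local Notation C := R[i].
Implicit Types (z w : C) (r : R).

Lemma normrcE z : `|z| = (cn z)%:C%C.
Proof. by rewrite normc_def; case: z. Qed.

Lemma cn_ge0 z : 0 <= cn z.
Proof. by case: z => a b; exact: sqrtr_ge0. Qed.

Lemma cn0 : cn (0 : C) = 0. Proof. exact: ComplexField.Normc.normc0. Qed.
Lemma cn1 : cn (1 : C) = 1. Proof. exact: ComplexField.Normc.normc1. Qed.

Lemma cnD z w : cn (z + w) <= cn z + cn w.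
Proof. exact: le_normcD. Qed.

Lemma cnM z w : cn (z * w) = cn z * cn w.
Proof. exact: ComplexField.Normc.normcM. Qed.

Lemma cnN z : cn (- z) = cn z.
Proof. exact: normcN. Qed.

Lemma cn_eq0 z : (cn z == 0) = (z == 0).
Proof.
by apply/eqP/eqP => [/ComplexField.Normc.eq0_normc //|->]; exact: cn0.
Qed.

Lemma cn_gt0 z : (0 < cn z) = (z != 0).
Proof. by rewrite lt_neqAle cn_ge0 andbT eq_sym cn_eq0. Qed.

Lemma cnB z w : cn (z - w) <= cn z + cn w.
Proof. by rewrite -[cn w]cnN cnD. Qed.

Lemma cnC z w : cn (z - w) = cn (w - z).
Proof. by rewrite -cnN opprB. Qed.

Lemma cnBr z w : cn z - cn w <= cn (z - w).
Proof. by have := cnD (z - w) w; rewrite subrK; lra. Qed.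

Lemma cnX z n : cn (z ^+ n) = cn z ^+ n.
Proof. by elim: n => [|n ih]; rewrite ?expr0 ?cn1// !exprS cnM ih. Qed.

Lemma cnV z : cn z^-1 = (cn z)^-1.
Proof. exact: ComplexField.Normc.normcV. Qed.

Lemma cn_real r : cn (r%:C%C) = `|r|.
Proof. by rewrite /= expr0n addr0 sqrtr_sqr. Qed.

Lemma cn_i : cn ('i%C : C) = 1.
Proof. by rewrite /= expr0n add0r expr1n sqrtr1. Qed.

Lemma ler_Re_cn z : `|complex.Re z| <= cn z.
Proof.
by case: z => a b /=; rewrite -sqrtr_sqr ler_wsqrtr// lerDl sqr_ge0.
Qed.

Lemma ler_Im_cn z : `|complex.Im z| <= cn z.
Proof.
by case: z => a b /=; rewrite -sqrtr_sqr ler_wsqrtr// lerDr sqr_ge0.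
Qed.

Lemma ler_cn_ReIm z : cn z <= `|complex.Re z| + `|complex.Im z|.
Proof.
rewrite [z in cn z]complexE (le_trans (cnD _ _))//.
by rewrite cnM cn_i mul1r !cn_real.
Qed.

Lemma ReD z w : complex.Re (z + w) = complex.Re z + complex.Re w.
Proof. by case: z w => [? ?] []. Qed.
Lemma ImD z w : complex.Im (z + w) = complex.Im z + complex.Im w.
Proof. by case: z w => [? ?] []. Qed.
Lemma ReN z : complex.Re (- z) = - complex.Re z.
Proof. by case: z. Qed.
Lemma ImN z : complex.Im (- z) = - complex.Im z.
Proof. by case: z. Qed.
Lemma ReMr r z : complex.Re (r%:C%C * z) = r * complex.Re z.
Proof. by case: z => a b /=; rewrite mul0r subr0. Qed.

(** Turns estimates of a modulus into estimates of a real part, where the mean value and extreme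
    value theorems apply. *)
Lemma cn_rotate z : exists2 w : C, cn w = 1 & w * z = (cn z)%:C%C.
Proof.
have [->|z0] := eqVneq z 0; first by exists 1; rewrite ?cn1// cn0 mulr0.
exists ((cn z)%:C%C / z).
  by rewrite cnM cnV cn_real ger0_norm ?cn_ge0// divff// cn_eq0.
by rewrite divfK.
Qed.

Lemma realCD r1 r2 : (r1 + r2)%:C%C = r1%:C%C + r2%:C%C :> C.
Proof. by rewrite rmorphD. Qed.
Lemma realCM r1 r2 : (r1 * r2)%:C%C = r1%:C%C * r2%:C%C :> C.
Proof. by rewrite rmorphM. Qed.

Lemma nbhsC_P z (A : set C) :
  nbhs (z : C^o) A <-> exists2 d : R, 0 < d & forall w, cn (w - z) < d -> A w.
Proof.
split.
  move=> /nbhs_ballP[e /= e0 eA].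
  have eE : e = (complex.Re e)%:C%C by rewrite RRe_real// gtr0_real.
  exists (complex.Re e); first by move: e0; rewrite eE ltcR.
  by move=> w wz; apply: eA; rewrite -ball_normE/= distrC normrcE eE ltcR.
move=> [d d0 dA]; apply/nbhs_ballP; exists d%:C%C; first by rewrite /= ltcR.
by move=> w; rewrite -ball_normE/= distrC normrcE ltcR; exact: dA.
Qed.

End ComplexNorm.

(** * Complex differentiability in one variable *)
Section OneVariable.
Variable R : realType.
Local Notation C := R[i].
Implicit Types (f g : C -> C) (z l : C).

(** The increment form needs no exception at [h = 0] and its bounds are real numbers; [cderivP]
    imports the algebraic rules from [is_derive]. *)
Definition cderiv f z l :=
  forall e : R, 0 < e -> exists2 d : R, 0 < d &
    forall h : C, cn h < d -> cn (f (z + h) - f z - l * h) <= e * cn h.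

Definition rderiv (f : R -> C) (t : R) l :=
  forall e : R, 0 < e -> exists2 d : R, 0 < d &
    forall h : R, `|h| < d -> cn (f (t + h) - f t - l * h%:C%C) <= e * `|h|.

Lemma cderivP f z l : cderiv f z l <-> is_derive (z : C^o) (1 : C^o) (f : C^o -> C^o) l.
Proof.
split=> [H|H].
  have Hl : (fun h : C^o => h^-1 *:
      (((f : C^o -> C^o) \o shift (z : C^o)) (h *: (1 : C^o)) - (f z : C^o)) : C^o) @ (0 : C^o)^' --> (l : C^o).
    apply/cvgrPdist_le => e e0; near_simpl.
    have eE : e = (complex.Re e)%:C%C by rewrite RRe_real// gtr0_real.
    have [d d0 dH] := H (complex.Re e) ltac:(by move: e0; rewrite eE ltcR).
    apply/nbhsC_P; exists d => // h; rewrite subr0 => hd h0.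
    rewrite normrcE eE lecR /= /shift /= -(ler_pM2r (x := cn h)) ?cn_gt0//.
    rewrite -cnM mulrBl mulrAC mulVf// mul1r [h *: 1]mulr1 cnC [h + z]addrC.
    exact: dH.
  apply: DeriveDef; last exact/cvg_lim.
  by apply/cvg_ex; exists l.
have [Hd He] := H.
have Hl : (fun h : C^o => h^-1 *:
      (((f : C^o -> C^o) \o shift (z : C^o)) (h *: (1 : C^o)) - (f z : C^o)) : C^o) @ (0 : C^o)^' --> (l : C^o).
  by rewrite -He; exact: Hd.
move=> e e0; move/cvgrPdist_le : Hl => /(_ e%:C%C).
rewrite ltcR => /(_ e0); near_simpl => /nbhsC_P[d d0 dH].
exists d => // h hd; have [->|h0] := eqVneq h 0.
  by rewrite addr0 mulr0 subr0 subrr cn0 mulr0.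
have := dH h; rewrite subr0 => /(_ hd h0).
rewrite normrcE lecR /= /shift /= -(ler_pM2r (x := cn h)) ?cn_gt0//.
by rewrite -cnM mulrBl mulrAC mulVf// mul1r [h *: 1]mulr1 cnC [h + z]addrC.
Unshelve. all: by end_near. Qed.

Lemma is_deriveR_P (g : R -> R) (t l : R) : is_derive t 1 g l <->
  forall e : R, 0 < e -> exists2 d : R, 0 < d &
    forall h : R, `|h| < d -> `|g (t + h) - g t - l * h| <= e * `|h|.
Proof.
split=> [[Hd He] e e0|H].
  have Hl : (fun h : R => h^-1 *: ((g \o shift t) (h *: 1) - g t)) @ 0^' --> l.
    by rewrite -He; exact: Hd.
  move/cvgrPdist_le : Hl => /(_ e e0); near_simpl => /nbhs_ballP[d /= d0 dH].
  exists d => // h hd; have [->|h0] := eqVneq h 0.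
    by rewrite addr0 mulr0 subr0 subrr normr0 mulr0.
  have := dH h; rewrite -ball_normE/= sub0r normrN => /(_ hd h0).
  rewrite /shift /= -(ler_pM2r (x := `|h|)) ?normr_gt0//.
  by rewrite -normrM mulrBl mulrAC mulVf// mul1r [h *: 1]mulr1 distrC [h + t]addrC.
have Hl : (fun h : R => h^-1 *: ((g \o shift t) (h *: 1) - g t)) @ 0^' --> l.
  apply/cvgrPdist_le => e e0; near_simpl.
  have [d d0 dH] := H e e0.
  apply/nbhs_ballP; exists d => // h; rewrite -ball_normE/= sub0r normrN => hd h0.
  rewrite /shift /= -(ler_pM2r (x := `|h|)) ?normr_gt0//.
  rewrite -normrM mulrBl mulrAC mulVf// mul1r [h *: 1]mulr1 distrC [h + t]addrC.
  exact: dH.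
apply: DeriveDef; last exact/cvg_lim.
by apply/cvg_ex; exists l.
Unshelve. all: by end_near. Qed.

Lemma cderiv_id z : cderiv id z 1.
Proof. by apply/cderivP; exact: is_derive_id. Qed.

Lemma cderiv_cst (a z : C) : cderiv (fun=> a) z 0.
Proof. by apply/cderivP; exact: is_derive_cst. Qed.

Lemma cderivD f g z l m : cderiv f z l -> cderiv g z m ->
  cderiv (fun w => f w + g w) z (l + m).
Proof. by move=> /cderivP fl /cderivP gm; apply/cderivP; exact: is_deriveD. Qed.

Lemma cderivN f z l : cderiv f z l -> cderiv (fun w => - f w) z (- l).
Proof. by move=> /cderivP fl; apply/cderivP; exact: is_deriveN. Qed.

Lemma cderivB f g z l m : cderiv f z l -> cderiv g z m ->
  cderiv (fun w => f w - g w) z (l - m).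
Proof. by move=> fl gm; apply: cderivD => //; exact: cderivN. Qed.

Lemma cderivM f g z l m : cderiv f z l -> cderiv g z m ->
  cderiv (fun w => f w * g w) z (f z * m + g z * l).
Proof. by move=> /cderivP fl /cderivP gm; apply/cderivP; exact: is_deriveM. Qed.

Lemma cderivZ (a : C) f z l : cderiv f z l -> cderiv (fun w => a * f w) z (a * l).
Proof.
move=> fl; have := cderivM (cderiv_cst a z) fl.
by rewrite mulr0 addr0.
Qed.

Lemma cderiv_shift f z (a : C) l : cderiv f (z + a) l -> cderiv (fun w => f (w + a)) z l.
Proof.
move=> H e e0; have [d d0 dH] := H e e0; exists d => // h hd.
by have := dH h hd; rewrite [z + a + h]addrAC.
Qed.

Lemma cderivV f z l : f z != 0 -> cderiv f z l ->
  cderiv (fun w => (f w)^-1) z (- (f z ^- 2 * l)).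
Proof.
move=> fz0 /cderivP[fl fE]; apply/cderivP; apply: DeriveDef.
  exact: (@derivableV R[i] (R[i]^o) f z 1).
by rewrite (@deriveV R[i] (R[i]^o) f z 1)// fE scaleNr.
Qed.

Lemma cderiv_continuous f z l : cderiv f z l ->
  forall e : R, 0 < e -> exists2 d : R, 0 < d & forall h, cn h < d -> cn (f (z + h) - f z) < e.
Proof.
move=> H e e0; have [d d0 dH] := H 1 ltr01.
have b0 : 0 < cn l + 1 by have := cn_ge0 l; lra.
exists (Num.min d (e / (cn l + 1))); first by rewrite lt_min d0 divr_gt0.
move=> h; rewrite lt_min ltr_pdivlMr// => /andP[/dH H1].
apply: le_lt_trans.
rewrite -[_ - f z](subrK (l * h)) (le_trans (cnD _ _))// cnM.
by rewrite mulrDr mulr1 addrC mulrC lerD2l (le_trans H1)// mul1r.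
Qed.

Lemma cderiv_rderiv f (z u : C) (t : R) l :
  cderiv f (z + t%:C%C * u) l -> rderiv (fun s => f (z + s%:C%C * u)) t (u * l).
Proof.
move=> H e e0; pose b := cn u + 1.
have b0 : 0 < b by rewrite /b; have := cn_ge0 u; lra.
have [d d0 dH] := H (e / b) (divr_gt0 e0 b0); exists (d / b); first exact: divr_gt0.
move=> h; rewrite ltr_pdivlMr// => hd.
have uh : cn (h%:C%C * u) <= `|h| * b.
  by rewrite cnM cn_real ler_wpM2l// /b; lra.
have := dH _ (le_lt_trans uh hd).
rewrite realCD mulrDl addrA (_ : l * (h%:C%C * u) = u * l * h%:C%C); last by ring.
move=> /le_trans; apply; rewrite -mulrA ler_wpM2l ?(ltW e0)// mulrC ler_pdivrMr//.
Qed.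
Lemma rderiv_Re (phi : R -> C) (w : C) (t : R) l : rderiv phi t l ->
  is_derive t 1 (fun s => complex.Re (w * phi s)) (complex.Re (w * l)).
Proof.
move=> H; apply/is_deriveR_P => e e0.
pose b := cn w + 1.
have b0 : 0 < b by rewrite /b; have := cn_ge0 w; lra.
have [d d0 dH] := H (e / b) (divr_gt0 e0 b0); exists d => // h /dH hd.
rewrite -ReN -ReD [_ * h]mulrC -ReMr -ReN -ReD (le_trans (ler_Re_cn _))//.
rewrite (_ : _ + _ = w * (phi (t + h) - phi t - l * h%:C%C)); last by ring.
rewrite cnM; apply: (@le_trans _ _ (b * (e / b * `|h|))).
  by rewrite ler_pM// ?cn_ge0// /b; lra.
by rewrite mulrA mulrCA divff ?gt_eqF// mulr1.
Qed.

(** Rotating [phi b - phi a] onto the positive real axis reduces the inequality to the real mean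
    value theorem for [Re (w * phi)]. *)
Lemma rderiv_mean (phi : R -> C) (l : R -> C) (a b K : R) : a <= b ->
  (forall t, a <= t <= b -> rderiv phi t (l t)) ->
  (forall t, a <= t <= b -> cn (l t) <= K) ->
  cn (phi b - phi a) <= K * (b - a).
Proof.
rewrite le_eqVlt => /predU1P[-> _ _|ab dphi lK]; first by rewrite !subrr cn0 mulr0.
have [w w1 wE] := cn_rotate (phi b - phi a).
pose g s := complex.Re (w * phi s).
have dg t : a <= t <= b -> is_derive t 1 g (complex.Re (w * l t)).
  by move=> /dphi; exact: rderiv_Re.
have [c cab gE] : exists2 c, c \in `]a, b[ & g b - g a = complex.Re (w * l c) * (b - a).
  apply: MVT => //.
    by move=> x; rewrite in_itv/= => /andP[ax xb]; apply: dg; rewrite !ltW.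
  apply: derivable_within_continuous => x; rewrite in_itv/= => /dg[].
  by [].
have -> : cn (phi b - phi a) = g b - g a.
  by rewrite /g -ReN -ReD -mulrBr wE.
rewrite gE ler_wpM2r ?subr_ge0 ?(ltW ab)//.
rewrite (le_trans (ler_norm _))// (le_trans (ler_Re_cn _))// cnM w1 mul1r lK//.
by move: cab; rewrite in_itv/= => /andP[? ?]; rewrite !ltW.
Qed.

Definition rcont (g : R -> C) := forall t (e : R), 0 < e ->
  exists2 d : R, 0 < d & forall s, `|s - t| < d -> cn (g s - g t) < e.

Lemma antiderivative (g : R -> R) (a b : R) : continuous g ->
  exists F : R -> R, forall x, a < x < b -> is_derive x 1 F (g x).
Proof.
move=> cg; exists (fun x => (\int[lebesgue_measure]_(t in [set` `[a, x]]) (g t))).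
move=> x /andP[ax xb].
have [|dF F'] := @continuous_FTC1_closed _ g a x b xb _ ax (cg x).
  apply: continuous_compact_integrable; first exact: segment_compact.
  exact: continuous_subspaceT.
by apply: DeriveDef; [exact: dF|rewrite -derive1E; exact: F'].
Qed.

Lemma antiderivativeC (g : R -> C) (s : R) : rcont g ->
  exists A : R -> C, forall x, `|x| <= s -> rderiv A x (g x).
Proof.
move=> cg.
have cP (p : C -> R) : (forall z w, `|p z - p w| <= cn (z - w)) -> continuous (p \o g).
  move=> pP t; apply/cvgrPdist_lt => e e0; near_simpl.
  have [d d0 dH] := cg t e e0.
  apply/nbhs_ballP; exists d => // u; rewrite -ball_normE/= distrC => /dH.
  by apply: le_lt_trans; rewrite distrC; exact: pP.
(* The margin 1 makes the derivative two-sided at the end points of [[- s, s]]. *)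
have [|F HF] := @antiderivative (@complex.Re R \o g) (- s - 1) (s + 1).
  by apply: cP => z w; rewrite -ReN -ReD ler_Re_cn.
have [|G HG] := @antiderivative (@complex.Im R \o g) (- s - 1) (s + 1).
  by apply: cP => z w; rewrite -ImN -ImD ler_Im_cn.
exists (fun x => F x +i* G x)%C => x; rewrite ler_norml => xs e e0.
have xs' : - s - 1 < x < s + 1 by move: xs => /andP[? ?]; apply/andP; split; lra.
have e20 : 0 < e / 2 by rewrite divr_gt0.
have [d1 d10 H1] := (proj1 (is_deriveR_P _ _ _) (HF x xs')) _ e20.
have [d2 d20 H2] := (proj1 (is_deriveR_P _ _ _) (HG x xs')) _ e20.
exists (Num.min d1 d2); first by rewrite lt_min d10.
move=> h; rewrite lt_min => /andP[/H1 {}H1 /H2 {}H2].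
rewrite (le_trans (ler_cn_ReIm _))// (splitr e) mulrDl lerD//.
  apply: le_trans H1; rewrite le_eqVlt; apply/orP; left; apply/eqP; congr (`|_|).
  by rewrite /=; case: (g x) => u v /=; rewrite mulr0 subr0.
apply: le_trans H2; rewrite le_eqVlt; apply/orP; left; apply/eqP; congr (`|_|).
by rewrite /=; case: (g x) => u v /=; rewrite mulr0 add0r.
Unshelve. all: by end_near. Qed.
Lemma rderivB (p q : R -> C) (t : R) l m : rderiv p t l -> rderiv q t m ->
  rderiv (fun s => p s - q s) t (l - m).
Proof.
move=> pl qm e e0; have e20 : 0 < e / 2 by rewrite divr_gt0.
have [d d0 dH] := pl _ e20; have [d' d'0 d'H] := qm _ e20.
exists (Num.min d d'); first by rewrite lt_min d0.
move=> h; rewrite lt_min => /andP[/dH {}dH /d'H {}d'H].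
rewrite (_ : _ - _ - _ = (p (t + h) - p t - l * h%:C%C) - (q (t + h) - q t - m * h%:C%C)).
  by rewrite (le_trans (cnB _ _))// (splitr e) mulrDl lerD.
by ring.
Qed.

Lemma rderivZ (p : R -> C) (t : R) (a : C) l : rderiv p t l ->
  rderiv (fun s => a * p s) t (a * l).
Proof.
move=> H e e0; pose b := cn a + 1.
have b0 : 0 < b by rewrite /b; have := cn_ge0 a; lra.
have [d d0 dH] := H (e / b) (divr_gt0 e0 b0); exists d => // h /dH hd.
rewrite (_ : _ - _ - _ = a * (p (t + h) - p t - l * h%:C%C)); last by ring.
rewrite cnM; apply: (@le_trans _ _ (b * (e / b * `|h|))).
  by rewrite ler_pM// ?cn_ge0// /b; lra.
by rewrite mulrA mulrCA divff ?gt_eqF// mulr1.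
Qed.

Lemma cderiv_horiz f (x y : R) l : cderiv f (x +i* y)%C l ->
  rderiv (fun s => f (s +i* y)%C) x l.
Proof.
have E s : (s +i* y)%C = (0 +i* y)%C + s%:C%C * 1 :> C.
  by apply/eqP; rewrite mulr1 eq_complex /=; apply/andP; split; apply/eqP; ring.
rewrite E => /cderiv_rderiv; rewrite mul1r => H.
by under [X in rderiv X]eq_fun do rewrite E.
Qed.

Lemma cderiv_vert f (x y : R) l : cderiv f (x +i* y)%C l ->
  rderiv (fun s => f (x +i* s)%C) y ('i%C * l).
Proof.
have E s : (x +i* s)%C = x%:C%C + s%:C%C * 'i%C :> C.
  by apply/eqP; rewrite eq_complex /=; apply/andP; split; apply/eqP; ring.
rewrite E => /cderiv_rderiv H.
by under [X in rderiv X]eq_fun do rewrite E.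
Qed.

Lemma nested_intervals (x w : nat -> R) :
  (forall k, [/\ x k <= x k.+1, x k.+1 + w k.+1 <= x k + w k & 0 <= w k]) ->
  exists s, forall k, x k <= s <= x k + w k.
Proof.
move=> H.
have up k j : (k <= j)%N -> x k <= x j.
  move=> /subnK <-; elim: (j - k)%N => // i ih.
  by rewrite (le_trans ih)//; have [] := H (i + k)%N.
have dn k j : (k <= j)%N -> x j + w j <= x k + w k.
  move=> /subnK <-; elim: (j - k)%N => // i; apply: le_trans.
  by have [] := H (i + k)%N.
have ub k : ubound (range x) (x k + w k).
  move=> _ [j _ <-]; have [kj|jk] := leqP k j.
    by rewrite (le_trans _ (dn _ _ kj))// lerDl; have [] := H j.
  by rewrite (le_trans (up _ _ (ltnW jk)))// lerDl; have [] := H k.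
have hs : has_sup (range x) by split; [exists (x 0%N), 0%N | exists (x 0%N + w 0%N)].
exists (sup (range x)) => k; apply/andP; split.
  by apply: sup_upper_bound => //; exists k.
by apply: sup_le_ub => //; exists (x 0%N), 0%N.
Qed.

Lemma pow2_large (L d : R) : 0 < d -> exists k, L < d * 2 ^+ k.
Proof.
move=> d0; pose n := Num.Def.archi_bound (`|L| / d).
exists n; rewrite -ltr_pdivrMl// mulrC.
apply: (@le_lt_trans _ _ (`|L| / d)); first by rewrite ler_pM2r ?invr_gt0// ler_norm.
have := archi_boundP (divr_ge0 (normr_ge0 L) (ltW d0)) => /lt_le_trans; apply.
by rewrite -natrX ler_nat -/n ltnW// ltn_expl.
Qed.

(** * Goursat's theorem on rectangles *)

Section Goursat.
Variables (f : C -> C) (A B : R -> R -> C) (a0 c0 w0 h0 : R).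
Hypotheses (w00 : 0 <= w0) (h00 : 0 <= h0).
Let inr x y := a0 <= x <= a0 + w0 /\ c0 <= y <= c0 + h0.
Hypothesis HA : forall x y, inr x y -> rderiv (A y) x (f (x +i* y)%C).
Hypothesis HB : forall x y, inr x y -> rderiv (B x) y (f (x +i* y)%C).
Hypothesis Hf : forall x y, inr x y -> exists l, cderiv f (x +i* y)%C l.

(** The integral of [f] along the boundary of the rectangle with lower left corner [(a, c)],
    expressed through antiderivatives on horizontal lines ([A]) and vertical lines ([B]). *)
Let T a c w h := (A c (a + w) - A c a) + 'i%C * (B (a + w) (c + h) - B (a + w) c)
   - (A (c + h) (a + w) - A (c + h) a) - 'i%C * (B a (c + h) - B a c).

(** [P] is a primitive of the affine approximation of [f] at [zs]. Its increments cancel around the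
    rectangle, and the mean value inequality bounds what remains on each side. *)
Let T_small (a c w h K : R) (zs l : C) : 0 <= w -> 0 <= h ->
  a0 <= a -> a + w <= a0 + w0 -> c0 <= c -> c + h <= c0 + h0 ->
  (forall x y, a <= x <= a + w -> c <= y <= c + h ->
     cn (f (x +i* y)%C - f zs - l * ((x +i* y)%C - zs)) <= K) ->
  cn (T a c w h) <= K * (2 * (w + h)).
Proof.
move=> wp hp a0a aw c0c ch HK.
pose P z := f zs * (z - zs) + l / 2 * ((z - zs) * (z - zs)).
have dP z : cderiv P z (f zs + l * (z - zs)).
  have d1 : cderiv (fun z => z - zs) z 1.
    by rewrite -[1]subr0; apply: cderivB; [exact: cderiv_id|exact: cderiv_cst].
  have := cderivD (cderivZ (f zs) d1) (cderivZ (l / 2) (cderivM d1 d1)).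
  rewrite (_ : f zs * 1 + _ = f zs + l * (z - zs)) //; by field.
have hor y : c <= y <= c + h ->
    cn ((A y (a + w) - P ((a + w) +i* y)%C) - (A y a - P (a +i* y)%C)) <= K * w.
  move=> yc.
  rewrite (_ : K * w = K * (a + w - a)); last by ring.
  apply: (rderiv_mean (phi := fun x => A y x - P (x +i* y)%C)
    (l := fun x => f (x +i* y)%C - (f zs + l * ((x +i* y)%C - zs)))).
  - by rewrite lerDl.
  - move=> x xa; apply: rderivB; last exact/cderiv_horiz/dP.
    by apply: HA; split; lra.
  - by move=> x xa; rewrite opprD addrA; exact: HK.
have ver x : a <= x <= a + w ->
    cn (('i%C * B x (c + h) - P (x +i* (c + h))%C) - ('i%C * B x c - P (x +i* c)%C)) <= K * h.
  move=> xa.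
  rewrite (_ : K * h = K * (c + h - c)); last by ring.
  apply: (rderiv_mean (phi := fun y => 'i%C * B x y - P (x +i* y)%C)
    (l := fun y => 'i%C * f (x +i* y)%C - 'i%C * (f zs + l * ((x +i* y)%C - zs)))).
  - by rewrite lerDl.
  - move=> y yc; apply: rderivB; last exact/cderiv_vert/dP.
    by apply: rderivZ; apply: HB; split; lra.
  - by move=> y yc; rewrite -mulrBr opprD addrA cnM cn_i mul1r; exact: HK.
have := hor c ltac:(lra); have := hor (c + h) ltac:(lra).
have := ver a ltac:(lra); have := ver (a + w) ltac:(lra).
set v1 := (X in cn X <= _) => V1; set v2 := (X in cn X <= _) => V2.
set u1 := (X in cn X <= _) => U1; set u2 := (X in cn X <= _) => U2.
have -> : T a c w h = u2 + v1 - (u1 + v2) by rewrite /T /u1 /u2 /v1 /v2; ring.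
apply: (le_trans (cnB _ _)).
have := cnD u2 v1; have := cnD u1 v2; lra.
Qed.

Let quarter (a c w h : R) : exists b : bool * bool,
  cn (T a c w h) <= 4 * cn (T (a + b.1%:R * (w / 2)) (c + b.2%:R * (h / 2)) (w / 2) (h / 2)).
Proof.
pose S (b : bool * bool) := T (a + b.1%:R * (w / 2)) (c + b.2%:R * (h / 2)) (w / 2) (h / 2).
have E : T a c w h = S (false, false) + S (true, false) + (S (false, true) + S (true, true)).
  rewrite /S /T /= !mul0r !mul1r !addr0 -!addrA -!splitr; ring.
have [//|N] := pselect (exists b, cn (T a c w h) <= 4 * cn (S b)).
have N' b : 4 * cn (S b) < cn (T a c w h).
  by rewrite ltNge; apply/negP => H; apply: N; exists b.
have := N' (false, false); have := N' (true, false).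
have := N' (false, true); have := N' (true, true).
have := cnD (S (false, false)) (S (true, false)).
have := cnD (S (false, true)) (S (true, true)).
have := cnD (S (false, false) + S (true, false)) (S (false, true) + S (true, true)).
rewrite -E; lra.
Qed.

Lemma goursat : T a0 c0 w0 h0 = 0.
Proof.
apply/eqP; rewrite -cn_eq0; apply/negP => /negP T0.
have e0 : 0 < cn (T a0 c0 w0 h0) by rewrite lt_neqAle eq_sym T0 cn_ge0.
set e := cn _ in e0.
have [b bP] : {b : nat -> R -> R -> bool * bool | forall k a c,
    cn (T a c (w0 / 2 ^+ k) (h0 / 2 ^+ k)) <= 4 * cn (T (a + (b k a c).1%:R * (w0 / 2 ^+ k / 2))
       (c + (b k a c).2%:R * (h0 / 2 ^+ k / 2)) (w0 / 2 ^+ k / 2) (h0 / 2 ^+ k / 2))}.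
  have Q k a c := cid (quarter a c (w0 / 2 ^+ k) (h0 / 2 ^+ k)).
  by exists (fun k a c => projT1 (Q k a c)) => k a c; exact: (projT2 (Q k a c)).
pose st := fix st k := if k is k'.+1 then
   let p := st k' in (p.1 + (b k' p.1 p.2).1%:R * (w0 / 2 ^+ k' / 2),
     p.2 + (b k' p.1 p.2).2%:R * (h0 / 2 ^+ k' / 2)) else (a0, c0).
have half (u : R) k : u / 2 ^+ k.+1 = u / 2 ^+ k / 2 by rewrite exprSr invfM mulrA.
have p2 k : (0 : R) < 2 ^+ k by rewrite exprn_gt0.
have ge0 u k : 0 <= u -> (0 : R) <= u / 2 ^+ k.
  by move=> u0; rewrite divr_ge0// ltW.
have stT k : e <= 4 ^+ k * cn (T (st k).1 (st k).2 (w0 / 2 ^+ k) (h0 / 2 ^+ k)).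
  elim: k => [|k ih]; first by rewrite expr0 mul1r !divr1.
  rewrite (le_trans ih)// exprSr -mulrA ler_wpM2l ?exprn_ge0// !half; exact: bP.
have step (bb : bool) (u : R) : 0 <= u -> 0 <= bb%:R * u <= u.
  by case: bb => u0; rewrite /= ?mul0r ?mul1r u0 lexx.
have [xs xsP] : exists s, forall k, (st k).1 <= s <= (st k).1 + w0 / 2 ^+ k.
  apply: (nested_intervals (x := fun k => (st k).1)) => k; rewrite half /=.
  have := ge0 _ k w00; set u := w0 / _ => u0.
  have := @step (b k (st k).1 (st k).2).1 (u / 2) ltac:(lra).
  by move=> /andP[? ?]; split=> //; lra.
have [ys ysP] : exists s, forall k, (st k).2 <= s <= (st k).2 + h0 / 2 ^+ k.
  apply: (nested_intervals (x := fun k => (st k).2)) => k; rewrite half /=.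
  have := ge0 _ k h00; set u := h0 / _ => u0.
  have := @step (b k (st k).1 (st k).2).2 (u / 2) ltac:(lra).
  by move=> /andP[? ?]; split=> //; lra.
have stb k : [/\ a0 <= (st k).1, (st k).1 + w0 / 2 ^+ k <= a0 + w0,
    c0 <= (st k).2 & (st k).2 + h0 / 2 ^+ k <= c0 + h0].
  elim: k => [|k [i1 i2 i3 i4]]; first by rewrite /= !divr1.
  rewrite !half /=.
  have := ge0 _ k w00; set u := w0 / _ in i2 *; move=> u0.
  have := ge0 _ k h00; set v := h0 / _ in i4 *; move=> v0.
  have := @step (b k (st k).1 (st k).2).2 (v / 2) ltac:(lra).
  have := @step (b k (st k).1 (st k).2).1 (u / 2) ltac:(lra).
  by move=> /andP[? ?] /andP[? ?]; split; lra.
have [l lP] : exists l, cderiv f (xs +i* ys)%C l.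
  apply: Hf; have := xsP 0%N; have := ysP 0%N; rewrite /= !divr1; split; lra.
(* After [k] bisections the upper bound for the integral is [2 * eta * L ^+ 2 / 4 ^+ k], the lower
   bound [e / 4 ^+ k]. The summand 2 keeps the denominator positive when [L = 0]. *)
pose L := w0 + h0; pose eta := e / (2 * L ^+ 2 + 2).
have L20 : 0 <= L ^+ 2 by exact: sqr_ge0.
have eta0 : 0 < eta by rewrite divr_gt0//; lra.
have [d d0 dP] := lP _ eta0.
have [k kP] := pow2_large L d0.
have Lk : L / 2 ^+ k < d by rewrite ltr_pdivrMr.
have Lk0 : 0 <= L / 2 ^+ k by apply: ge0; rewrite addr_ge0.
have [i1 i2 i3 i4] := stb k.
have := @T_small (st k).1 (st k).2 (w0 / 2 ^+ k) (h0 / 2 ^+ k)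
   (eta * (L / 2 ^+ k)) (xs +i* ys)%C l (ge0 _ _ w00) (ge0 _ _ h00) i1 i2 i3 i4.
have -> : w0 / 2 ^+ k + h0 / 2 ^+ k = L / 2 ^+ k by rewrite -mulrDl.
move=> /(_ _)/[dup] H0 H1.
have {H0 H1}H : cn (T (st k).1 (st k).2 (w0 / 2 ^+ k) (h0 / 2 ^+ k)) <=
    eta * (L / 2 ^+ k) * (2 * (L / 2 ^+ k)).
  apply: H1 => x y xa ya.
  have dist : cn ((x +i* y)%C - (xs +i* ys)%C) <= L / 2 ^+ k.
    rewrite (le_trans (ler_cn_ReIm _))//= /L mulrDl lerD//.
      by have := xsP k; rewrite ler_norml; lra.
    by have := ysP k; rewrite ler_norml; lra.
  have := dP _ (le_lt_trans dist Lk).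
  rewrite [(xs +i* ys)%C + _]addrC subrK => /le_trans; apply.
  by rewrite ler_wpM2l// ltW.
have := stT k; apply/negP; rewrite -ltNge.
apply: (@le_lt_trans _ _ (4 ^+ k * (eta * (L / 2 ^+ k) * (2 * (L / 2 ^+ k))))).
  by rewrite ler_wpM2l// exprn_ge0.
have -> : 4 ^+ k * (eta * (L / 2 ^+ k) * (2 * (L / 2 ^+ k))) = eta * (2 * L ^+ 2).
  have -> : (4 : R) = 2 * 2 by rewrite -natrM.
  rewrite exprMn; have := p2 k; set q := 2 ^+ k => q0; field; exact: lt0r_neq0.
rewrite /eta mulrAC ltr_pdivrMr ?ltr_pM2l//; lra.
Qed.

End Goursat.

End OneVariable.

(** * Local primitives of holomorphic functions *)

Section Primitive.
Variable R : realType.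
Local Notation C := R[i].
Implicit Types (f g : C -> C) (z l : C).

Lemma rderiv_mean_abs (phi : R -> C) (l : R -> C) (a b K : R) :
  (forall t, `|t - a| <= `|b - a| -> rderiv phi t (l t)) ->
  (forall t, `|t - a| <= `|b - a| -> cn (l t) <= K) ->
  cn (phi b - phi a) <= K * `|b - a|.
Proof.
have [ab|/ltW ba] := leP a b => dphi lK.
  have H t : a <= t <= b -> `|t - a| <= `|b - a|.
    by move=> /andP[? ?]; rewrite !ger0_norm ?subr_ge0 ?lerD2r.
  rewrite ger0_norm ?subr_ge0//; apply: (rderiv_mean (l := l)) => // t /H.
    exact: dphi.
  exact: lK.
have H t : b <= t <= a -> `|t - a| <= `|b - a|.
  by move=> /andP[? ?]; rewrite !ler0_norm ?subr_le0// lerN2 lerD2r.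
rewrite cnC distrC ger0_norm ?subr_ge0//; apply: (rderiv_mean (l := l)) => // t /H.
  exact: dphi.
exact: lK.
Qed.

Lemma rderivM_cst (c : C) (t : R) : rderiv (fun s => c * s%:C%C) t c.
Proof.
move=> e e0; exists 1 => // h _.
by rewrite realCD (_ : _ - _ - _ = 0) ?cn0 ?mulr_ge0 ?(ltW e0)//; ring.
Qed.

Lemma primitive0 f (s : R) : 0 < s ->
  (forall z, cn z <= 2 * s -> exists l, cderiv f z l) ->
  exists F, forall z, cn z < s -> cderiv F z (f z).
Proof.
move=> s0 df.
(* Clamping both coordinates extends [f] from the square to a continuous function on the plane,
   since [antiderivativeC] asks for continuity on the whole line. *)
pose c (x : R) := Num.max (- s) (Num.min x s).
have cs x : `|c x| <= s.
  by rewrite ler_norml /c le_max lexx /= ge_max ge_min lexx orbT andbT; lra.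
have cE x : `|x| <= s -> c x = x.
  rewrite ler_norml => /andP[h1 h2]; rewrite /c (min_idPl h2).
  exact/max_idPr.
have c_lip x y : `|c x - c y| <= `|x - y|.
  rewrite /c; case: (leP x s) => ?; case: (leP y s) => ?;
  case: (leP (- s) x) => ?; case: (leP (- s) y) => ?; case: (leP (- s) s) => ?;
  rewrite ler_norml; case: (ger0P (x - y)) => ?; lra.
pose ft x y := f (c x +i* c y)%C.
have sq x y : `|x| <= s -> `|y| <= s -> cn (x +i* y)%C <= 2 * s.
  by move=> xs ys; rewrite (le_trans (ler_cn_ReIm _))//=; lra.
have ft_cont x y (e : R) : 0 < e -> exists2 d : R, 0 < d &
    forall x' y', `|x' - x| + `|y' - y| < d -> cn (ft x' y' - ft x y) < e.
  move=> e0; have [l dl] := df _ (sq _ _ (cs x) (cs y)).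
  have [d d0 dP] := cderiv_continuous dl e0; exists d => // x' y' H.
  have := dP ((c x' +i* c y') - (c x +i* c y))%C.
  rewrite [(c x +i* c y)%C + _]addrC subrK; apply.
  rewrite (le_lt_trans (ler_cn_ReIm _))//= (le_lt_trans _ H)// lerD//; exact: c_lip.
have [A AP] : {A : R -> R -> C | forall y x, `|x| <= s -> rderiv (A y) x (ft x y)}.
  have H y : exists A : R -> C, forall x, `|x| <= s -> rderiv A x (ft x y).
    apply: (antiderivativeC (g := fun x => ft x y)) => t e e0.
    have [d d0 dP] := ft_cont t y e e0; exists d => // u ut.
    by apply: dP; rewrite subrr normr0 addr0.
  by exists (fun y => projT1 (cid (H y))) => y; exact: (projT2 (cid (H y))).
have [B BP] : {B : R -> R -> C | forall x y, `|y| <= s -> rderiv (B x) y (ft x y)}.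
  have H x : exists B : R -> C, forall y, `|y| <= s -> rderiv B y (ft x y).
    apply: (antiderivativeC (g := fun y => ft x y)) => t e e0.
    have [d d0 dP] := ft_cont x t e e0; exists d => // u ut.
    by apply: dP; rewrite subrr normr0 add0r.
  by exists (fun y => projT1 (cid (H y))) => y; exact: (projT2 (cid (H y))).
(* Integrals of [f] from the lower left corner along the two edge paths, equal by Goursat. [F1]
   exhibits the vertical derivative, [F2] the horizontal one. *)
pose F1 x y := A (- s) x - A (- s) (- s) + 'i%C * (B x y - B x (- s)).
pose F2 x y := 'i%C * (B (- s) y - B (- s) (- s)) + (A y x - A y (- s)).
have F12 x y : `|x| <= s -> `|y| <= s -> F1 x y = F2 x y.
  move=> xs ys.
  have := @goursat R f A B (- s) (- s) (x + s) (y + s).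
  rewrite ![- s + _]addrC !addrK => H; apply/eqP; rewrite -subr_eq0; apply/eqP.
  rewrite /F1 /F2; transitivity (A (- s) x - A (- s) (- s) + 'i%C * (B x y - B x (- s)) -
     (A y x - A y (- s)) - 'i%C * (B (- s) y - B (- s) (- s))); first by ring.
  have bnd u v : - s <= u <= x -> - s <= v <= y -> `|u| <= s /\ `|v| <= s.
    by move: xs ys; rewrite !ler_norml; lra.
  apply: H.
  - by move: xs; rewrite ler_norml; lra.
  - by move: ys; rewrite ler_norml; lra.
  - by move=> u v [h1 h2]; have [? ?] := bnd u v h1 h2; have := AP v u; rewrite /ft !cE//; apply.
  - by move=> u v [h1 h2]; have [? ?] := bnd u v h1 h2; have := BP u v; rewrite /ft !cE//; apply.
  - by move=> u v [h1 h2]; have [? ?] := bnd u v h1 h2; apply: df; exact: sq.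
exists (fun z => F1 (complex.Re z) (complex.Im z)) => -[x y] zs e e0.
have xs : `|x| < s by exact: le_lt_trans (ler_Re_cn (x +i* y)%C) zs.
have ys : `|y| < s by exact: le_lt_trans (ler_Im_cn (x +i* y)%C) zs.
have e20 : 0 < e / 2 by rewrite divr_gt0.
have [d d0 dP] := ft_cont x y _ e20.
pose d' := Num.min (d / 2) (s - cn (x +i* y)%C).
have d'0 : 0 < d' by rewrite lt_min divr_gt0//= subr_gt0.
exists d' => // -[h k]; rewrite lt_min => /andP[hd hs].
have hh : `|h| <= cn (h +i* k)%C := ler_Re_cn (h +i* k)%C.
have kk : `|k| <= cn (h +i* k)%C := ler_Im_cn (h +i* k)%C.
have xx : `|x| <= cn (x +i* y)%C := ler_Re_cn (x +i* y)%C.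
have yy : `|y| <= cn (x +i* y)%C := ler_Im_cn (x +i* y)%C.
have zw := cnD (x +i* y)%C (h +i* k)%C.
have xhs : `|x + h| <= s.
  have H : `|x + h| <= cn ((x +i* y) + (h +i* k))%C := ler_Re_cn ((x +i* y) + (h +i* k))%C.
  lra.
have yks : `|y + k| <= s.
  have H : `|y + k| <= cn ((x +i* y) + (h +i* k))%C := ler_Im_cn ((x +i* y) + (h +i* k))%C.
  lra.
have fE : f (x +i* y)%C = ft x y by rewrite /ft !cE// ltW.
have E1 : F1 (x + h) (y + k) - F1 (x + h) y = 'i%C * (B (x + h) (y + k) - B (x + h) y).
  by rewrite /F1; ring.
have E2 : F1 (x + h) y - F1 x y = A y (x + h) - A y x.
  by rewrite !F12 ?(ltW xs) ?(ltW ys)// /F2; ring.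
have b1 : cn ((A y (x + h) - ft x y * (x + h)%:C%C) - (A y x - ft x y * x%:C%C)) <= e / 2 * `|h|.
  rewrite (_ : `|h| = `|x + h - x|); last by congr (`|_|); ring.
  have tb t : `|t - x| <= `|x + h - x| -> `|t| <= s.
    rewrite [x + h - x]addrAC subrr add0r => tx.
    by have := ler_normD (t - x) x; rewrite subrK; lra.
  apply: (rderiv_mean_abs (phi := fun t => A y t - ft x y * t%:C%C)
     (l := fun t => ft t y - ft x y)) => t tx.
    by apply: rderivB; [apply: AP; exact: tb|exact: rderivM_cst].
  apply/ltW/dP; rewrite subrr normr0 addr0 (le_lt_trans tx)// [x + h - x]addrAC subrr add0r.
  lra.
have b2 : cn ((B (x + h) (y + k) - ft x y * (y + k)%:C%C) - (B (x + h) y - ft x y * y%:C%C)) <= e / 2 * `|k|.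
  rewrite (_ : `|k| = `|y + k - y|); last by congr (`|_|); ring.
  have tb t : `|t - y| <= `|y + k - y| -> `|t| <= s.
    rewrite [y + k - y]addrAC subrr add0r => tx.
    by have := ler_normD (t - y) y; rewrite subrK; lra.
  apply: (rderiv_mean_abs (phi := fun t => B (x + h) t - ft x y * t%:C%C)
     (l := fun t => ft (x + h) t - ft x y)) => t tx.
    by apply: rderivB; [apply: BP; exact: tb|exact: rderivM_cst].
  apply/ltW/dP; move: tx; rewrite [y + k - y]addrAC [x + h - x]addrAC !subrr !add0r; lra.
rewrite fE /=.
have -> : F1 (x + h) (y + k) - F1 x y - ft x y * (h +i* k)%C =
   ((A y (x + h) - ft x y * (x + h)%:C%C) - (A y x - ft x y * x%:C%C)) +
   'i%C * ((B (x + h) (y + k) - ft x y * (y + k)%:C%C) - (B (x + h) y - ft x y * y%:C%C)).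
  have -> : F1 (x + h) (y + k) - F1 x y =
      (F1 (x + h) (y + k) - F1 (x + h) y) + (F1 (x + h) y - F1 x y) by ring.
  rewrite E1 E2 [(h +i* k)%C]complexE /= !realCD; ring.
rewrite (le_trans (cnD _ _))// cnM cn_i mul1r (splitr e) mulrDl lerD//.
  by rewrite (le_trans b1)// ler_wpM2l// ltW.
by rewrite (le_trans b2)// ler_wpM2l// ltW.
Qed.

Lemma primitive f z0 (s : R) : 0 < s ->
  (forall z, cn (z - z0) <= 2 * s -> exists l, cderiv f z l) ->
  exists F, forall z, cn (z - z0) < s -> cderiv F z (f z).
Proof.
move=> s0 df.
have [|F HF] := @primitive0 (fun z => f (z + z0)) s s0.
  move=> z zs; have [|l dl] := df (z + z0); first by rewrite addrK.
  by exists l; apply: cderiv_shift.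
exists (fun z => F (z - z0)) => z zs; apply: cderiv_shift.
by have := HF _ zs; rewrite subrK.
Qed.
End Primitive.

(** * The maximum principle for twice differentiable functions *)

Section Maximum.
Variable R : realType.
Local Notation C := R[i].
Implicit Types (f g : C -> C) (z l : C).

(** Second order differentiability at [z], a separate hypothesis until [hol_cderiv2] derives it from
    differentiability on a disc. *)
Definition cderiv2 f z := exists f' : C -> C, exists2 d : R, 0 < d &
  (forall w, cn (w - z) < d -> cderiv f w (f' w)) /\ exists l, cderiv f' z l.

Lemma cderiv2_cderiv f z : cderiv2 f z -> exists l, cderiv f z l.
Proof. by move=> [f' [d d0 [H _]]]; exists (f' z); apply: H; rewrite subrr cn0. Qed.

Lemma cderiv2_cst (a z : C) : cderiv2 (fun=> a) z.
Proof.
exists (fun=> 0); exists 1 => //; split; last by exists 0; exact: cderiv_cst.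
by move=> w _; exact: cderiv_cst.
Qed.

Lemma cderiv2_id z : cderiv2 id z.
Proof.
exists (fun=> 1); exists 1 => //; split; last by exists 0; exact: cderiv_cst.
by move=> w _; exact: cderiv_id.
Qed.

Lemma cderiv2D f g z : cderiv2 f z -> cderiv2 g z -> cderiv2 (fun w => f w + g w) z.
Proof.
move=> [f' [d d0 [H [l L]]]] [g' [e e0 [G [m M]]]].
exists (fun w => f' w + g' w); exists (Num.min d e); first by rewrite lt_min d0.
split; last by exists (l + m); exact: cderivD.
by move=> w; rewrite lt_min => /andP[/H ? /G ?]; exact: cderivD.
Qed.

Lemma cderiv2M f g z : cderiv2 f z -> cderiv2 g z -> cderiv2 (fun w => f w * g w) z.
Proof.
move=> [f' [d d0 [H [l L]]]] [g' [e e0 [G [m M]]]].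
exists (fun w => f w * g' w + g w * f' w); exists (Num.min d e); first by rewrite lt_min d0.
have fz : cderiv f z (f' z) by apply: H; rewrite subrr cn0.
have gz : cderiv g z (g' z) by apply: G; rewrite subrr cn0.
split; last by eexists; apply: cderivD; apply: cderivM; eassumption.
by move=> w; rewrite lt_min => /andP[/H ? /G ?]; exact: cderivM.
Qed.

Lemma cderiv2Z (a : C) f z : cderiv2 f z -> cderiv2 (fun w => a * f w) z.
Proof. by move=> ?; apply: cderiv2M => //; exact: cderiv2_cst. Qed.

Lemma cderiv2B f g z : cderiv2 f z -> cderiv2 g z -> cderiv2 (fun w => f w - g w) z.
Proof.
move=> ? /(cderiv2Z (-1)) H; apply: cderiv2D => //.
by under eq_fun do rewrite -mulN1r.
Qed.

Lemma cderiv2X f z n : cderiv2 f z -> cderiv2 (fun w => f w ^+ n) z.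
Proof.
move=> fz; elim: n => [|n ih]; first exact: cderiv2_cst.
by under eq_fun do rewrite exprS; exact: cderiv2M.
Qed.

Lemma cderiv_neq0 f z l : cderiv f z l -> f z != 0 ->
  exists2 d : R, 0 < d & forall w, cn (w - z) < d -> f w != 0.
Proof.
move=> fl fz0; have c0 : 0 < cn (f z) by rewrite cn_gt0.
have [d d0 dP] := cderiv_continuous fl c0; exists d => // w /dP.
rewrite [z + _]addrC subrK; apply: contraTN => /eqP ->.
by rewrite sub0r cnN ltxx.
Qed.

Lemma cderiv2V f z : cderiv2 f z -> f z != 0 -> cderiv2 (fun w => (f w)^-1) z.
Proof.
move=> [f' [d d0 [H [l L]]]] fz0.
have fz : cderiv f z (f' z) by apply: H; rewrite subrr cn0.
have [e e0 eP] := cderiv_neq0 fz fz0.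
exists (fun w => - ((f w)^-1 * (f w)^-1 * f' w)); exists (Num.min d e).
  by rewrite lt_min d0.
split.
  move=> w; rewrite lt_min => /andP[/H fw /eP fw0].
  by have := cderivV fw0 fw; rewrite -exprVn expr2.
have fV := cderivV fz0 fz.
by eexists; apply: cderivN; apply: cderivM L; apply: cderivM; exact: fV.
Qed.

Lemma cderiv2_shift f z (a : C) : cderiv2 f (z + a) -> cderiv2 (fun w => f (w + a)) z.
Proof.
move=> [f' [d d0 [H [l L]]]]; exists (fun w => f' (w + a)); exists d => //.
split; last by exists l; exact: cderiv_shift.
by move=> w wz; apply: cderiv_shift; apply: H; rewrite opprD addrACA subrr addr0.
Qed.

(** Mean value inequality along the segment for the remainder [r], whose derivative is [o(h)]
    there. *)
Lemma peano2 f z : cderiv2 f z -> exists a b : C, forall e : R, 0 < e ->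
  exists2 d : R, 0 < d & forall h, cn h < d ->
    cn (f (z + h) - f z - a * h - b * h ^+ 2) <= e * cn h ^+ 2.
Proof.
move=> [f' [d d0 [H [l L]]]]; exists (f' z), (l / 2) => e e0.
have [d' d'0 d'P] := L _ e0; exists (Num.min d d'); first by rewrite lt_min d0.
move=> h; rewrite lt_min => /andP[hd hd'].
pose r (w : C) := f w - f' z * (w - z) - l / 2 * ((w - z) * (w - z)).
have tb (t : R) : 0 <= t <= 1 -> cn (t%:C%C * h) <= cn h.
  by move=> /andP[? ?]; rewrite cnM cn_real ger0_norm// ler_piMl ?cn_ge0.
have := @rderiv_mean R (fun t => r (z + t%:C%C * h))
  (fun t => h * (f' (z + t%:C%C * h) - f' z - l * (t%:C%C * h))) 0 1 (e * cn h ^+ 2) ler01.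
rewrite subr0 mulr1 mul0r addr0 mul1r /r subrr !mulr0 !subr0 [z + h - z]addrAC subrr add0r.
rewrite -expr2 => K.
have -> : f (z + h) - f z - f' z * h - l / 2 * h ^+ 2 =
  f (z + h) - f' z * h - l / 2 * h ^+ 2 - f z by ring.
apply: K => t t01; have := tb t t01 => th.
  apply: (cderiv_rderiv (f := fun w => f w - f' z * (w - z) - l / 2 * ((w - z) * (w - z)))).
  have d1 w : cderiv (fun u => u - z) w 1.
    by rewrite -[1]subr0; apply: cderivB; [exact: cderiv_id|exact: cderiv_cst].
  have := cderivB (cderivB (H (z + t%:C%C * h) _) (cderivZ (f' z) (d1 _)))
     (cderivZ (l / 2) (cderivM (d1 _) (d1 _))).
  rewrite [z + t%:C%C * h - z]addrAC subrr add0r => /(_ (le_lt_trans th hd)).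
  set m := (X in cderiv _ _ X) => Hm; suff -> : f' (z + t%:C%C * h) - f' z - l * (t%:C%C * h) = m by [].
  by rewrite /m; field.
rewrite cnM (_ : e * cn h ^+ 2 = cn h * (e * cn h)); last by ring.
rewrite ler_wpM2l ?cn_ge0//.
by rewrite (le_trans (d'P _ (le_lt_trans th hd')))// ler_wpM2l// ltW.
Qed.

Definition ccont f z := forall e : R, 0 < e -> exists2 d : R, 0 < d &
  forall w, cn (w - z) < d -> cn (f w - f z) < e.

Lemma cderiv_ccont f z l : cderiv f z l -> ccont f z.
Proof.
move=> fl e /(cderiv_continuous fl)[d d0 dP]; exists d => // w /dP.
by rewrite [z + _]addrC subrK.
Qed.

Lemma compact_cdisc (z0 : C) (r : R) : compact [set z : C^o | cn (z - z0) <= r].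
Proof.
have pc : continuous (fun p : R * R => (p.1 +i* p.2)%C : C^o).
  move=> -[x y] A /nbhsC_P[d d0 dA].
  have d20 : 0 < d / 2 by rewrite divr_gt0.
  exists (ball x (d / 2), ball y (d / 2)) => /=.
    by split; apply: nbhsx_ballx.
  move=> [u v] /= [] ; rewrite -!ball_normE/= => xu yv; apply: dA.
  rewrite (le_lt_trans (ler_cn_ReIm _))//= [in ltLHS]distrC [`|v - y|]distrC; lra.
pose a := complex.Re z0; pose b := complex.Im z0.
have ic : compact (`[a - r, a + r] `*` `[b - r, b + r] : set (R * R)).
  by apply: compact_setX; exact: segment_compact.
have cB := continuous_compact (continuous_subspaceT pc) ic.
apply: (subclosed_compact _ cB).
  rewrite (_ : [set _ | _] = ~` [set z | r < cn (z - z0)]); last first.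
    by apply/seteqP; split=> z /=; rewrite leNgt => /negP.
  apply: open_closedC; rewrite openE => z /= zr; apply/nbhsC_P.
  exists (cn (z - z0) - r); first by rewrite subr_gt0.
  by move=> w /= wz; have := cnD (z - w) (w - z0); rewrite addrA subrK [cn (z - w)]cnC; lra.
move=> [x y] /= zr; exists (x, y) => //=.
have := ler_Re_cn ((x +i* y)%C - z0); have := ler_Im_cn ((x +i* y)%C - z0).
rewrite ReD ImD ReN ImN -/a -/b; set p := complex.Im _; set q := complex.Re _.
rewrite /p /q {p q}; rewrite [complex.Im _]/= [complex.Re _]/= !ler_norml !in_itv/=.
by move=> /andP[? ?] /andP[? ?]; split; apply/andP; split; lra.
Qed.

Lemma continuous_CR (u : C -> R) z :
  (forall e : R, 0 < e -> exists2 d : R, 0 < d &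
    forall w, cn (w - z) < d -> `|u w - u z| < e) ->
  {for (z : C^o), continuous (u : C^o -> R)}.
Proof.
move=> H A /nbhs_ballP[d /= d0 dA]; have [e e0 eP] := H d d0.
apply/nbhsC_P; exists e => // w /eP ?; apply: dA.
by rewrite -ball_normE/= distrC.
Qed.

(** Otherwise, after a rotation, [Re (w * f) + e * |z|^2] has its maximum over [K] at a point [zs]
    off [B]. Summing over [zs + t], [zs - t], [zs + i t], [zs - i t] cancels the first and second
    order terms of [f], while the square contributes [4 e t^2], against maximality. *)
Lemma weak_maximum f (K B : set C) (r m : R) :
  compact (K : set C^o) -> (forall z, K z -> cn z <= r) ->
  (forall z, K z -> ccont f z) ->
  (forall z, K z -> B z -> cn (f z) <= m) ->
  (forall z, K z -> ~ B z -> cderiv2 f z /\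
      exists2 d : R, 0 < d & forall w, cn (w - z) < d -> K w) ->
  forall z, K z -> cn (f z) <= m.
Proof.
move=> cK Kr fc fB f2 z1 Kz1; rewrite leNgt; apply/negP => mz1.
have [w w1 wE] := cn_rotate (f z1).
pose sq (z : C) := complex.Re z ^+ 2 + complex.Im z ^+ 2.
have sqE z : sq z = cn z ^+ 2.
  by case: z => x y; rewrite /sq /= sqr_sqrtr// addr_ge0// sqr_ge0.
(* So small that on [K] the correction [e * sq] stays below the excess of [cn (f z1)] over [m]; this
   keeps the maximum off [B]. *)
pose e := (cn (f z1) - m) / (2 * (r ^+ 2 + 1)).
have r20 : 0 < r ^+ 2 + 1 by have := sqr_ge0 r; lra.
have e0 : 0 < e by rewrite divr_gt0 ?subr_gt0// mulr_gt0.
have er : e * r ^+ 2 < cn (f z1) - m.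
  rewrite /e mulrAC ltr_pdivrMr; last by rewrite mulr_gt0.
  rewrite ltr_pM2l ?subr_gt0//; have := sqr_ge0 r; lra.
pose u z := complex.Re (w * f z) + e * sq z.
have uc : {within (K : set C^o), continuous (u : C^o -> R)}.
  apply: continuous_in_subspaceT => z /set_mem Kz.
  have c1 : {for (z : C^o), continuous (fun z : C^o => complex.Re (w * f z))}.
    apply: continuous_CR => d d0.
    have [d' d'0 dP] := fc z Kz d d0; exists d' => // v /dP.
    apply: le_lt_trans; rewrite -ReN -ReD -mulrBr (le_trans (ler_Re_cn _))//.
    by rewrite cnM w1 mul1r.
  have cRI (p : C -> R) : (forall z v, `|p z - p v| <= cn (z - v)) ->
      {for (z : C^o), continuous (p : C^o -> R)}.
    move=> H; apply: continuous_CR => d d0; exists d => // v vz.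
    by rewrite (le_lt_trans (H _ _)).
  have cRe : {for (z : C^o), continuous (@complex.Re R : C^o -> R)}.
    by apply: cRI => ? ?; rewrite -ReN -ReD ler_Re_cn.
  have cIm : {for (z : C^o), continuous (@complex.Im R : C^o -> R)}.
    by apply: cRI => ? ?; rewrite -ImN -ImD ler_Im_cn.
  have cc : {for (z : C^o), continuous (cst e : C^o -> R)} by exact: cst_continuous.
  exact: (continuousD c1 (continuousM cc
    (continuousD (continuousM cRe cRe) (continuousM cIm cIm)))).
have [|zs /set_mem Kzs zsmax] := compact_EVT_max _ cK uc; first by exists z1.
have zsB : ~ B zs.
  move=> /(fB _ Kzs) fzs.
  have := zsmax z1 (mem_set Kz1); rewrite /u wE [complex.Re _%:C%C]/=.
  apply/negP; rewrite -ltNge.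
  have := ler_Re_cn (w * f zs); rewrite cnM w1 mul1r => /(le_trans (ler_norm _)) H1.
  have H2 : e * sq zs <= e * r ^+ 2.
    rewrite ler_pM2l// sqE ler_sqr ?nnegrE ?cn_ge0//; first exact: Kr.
    by rewrite (le_trans (cn_ge0 zs))// Kr.
  have H3 : 0 <= e * sq z1 by rewrite mulr_ge0 ?(ltW e0)// sqE sqr_ge0.
  lra.
have [/peano2[a [b pf]] [d d0 dK]] := f2 _ Kzs zsB.
have [d' d'0 d'P] := pf (e / 2) (divr_gt0 e0 (ltr0Sn R 1)).
pose t := Num.min d d' / 2.
have t0 : 0 < t by rewrite divr_gt0// lt_min d0.
have td : t < d.
  by rewrite ltr_pdivrMr//; apply: (@le_lt_trans _ _ d); [rewrite ge_min lexx|lra].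
have td' : t < d'.
  by rewrite ltr_pdivrMr//; apply: (@le_lt_trans _ _ d'); [rewrite ge_min lexx orbT|lra].
pose rem h := f (zs + h) - f zs - a * h - b * h ^+ 2.
have P (h : C) : cn h = t -> complex.Re (w * f (zs + h)) + e * sq (zs + h) <= u zs /\
    - (e / 2 * t ^+ 2) <= complex.Re (w * rem h).
  move=> ht; split.
    by apply: zsmax; apply/mem_set/dK; rewrite addrAC subrr add0r ht.
  have := d'P h; rewrite ht => /(_ td'); rewrite -/(rem h) => H.
  have := ler_Re_cn (w * rem h); rewrite cnM w1 mul1r ler_norml; lra.
pose tc : C := t%:C%C; pose ti : C := 'i%C * tc.
have n1 : cn tc = t by rewrite cn_real ger0_norm// ltW.
have n2 : cn ti = t by rewrite cnM cn_i mul1r.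
have [A1 B1] := P _ n1; have [A2 B2] := P (- tc) (etrans (cnN _) n1).
have [A3 B3] := P _ n2; have [A4 B4] := P (- ti) (etrans (cnN _) n2).
have S : rem tc + rem (- tc) + rem ti + rem (- ti) =
   f (zs + tc) + f (zs - tc) + f (zs + ti) + f (zs - ti) - 4 * f zs.
  have : (ti) ^+ 2 = - (tc ^+ 2) by rewrite /ti exprMn sqr_i mulN1r.
  by rewrite /rem => E; rewrite !sqrrN E; ring.
have S' : complex.Re (w * rem tc) + complex.Re (w * rem (- tc)) + complex.Re (w * rem ti) +
     complex.Re (w * rem (- ti)) =
   complex.Re (w * f (zs + tc)) + complex.Re (w * f (zs - tc)) + complex.Re (w * f (zs + ti)) +
     complex.Re (w * f (zs - ti)) - 4 * complex.Re (w * f zs).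
  have -> : 4 * complex.Re (w * f zs) = complex.Re (w * (4 * f zs)).
    rewrite mulrCA; have -> : 4 = (4 : R)%:C%C :> C by rewrite rmorph_nat.
    by rewrite ReMr.
  transitivity (complex.Re (w * (rem tc + rem (- tc) + rem ti + rem (- ti)))).
    by rewrite !mulrDr !ReD.
  by rewrite S !mulrDr mulrN !ReD ReN.
have SQ : sq (zs + tc) + sq (zs - tc) + sq (zs + ti) + sq (zs - ti) = 4 * sq zs + 4 * t ^+ 2.
  by rewrite /sq /ti /tc; case: (zs) => x y /=; ring.
have et : 0 < e * t ^+ 2 by rewrite mulr_gt0// exprn_gt0.
have SE : e * sq (zs + tc) + e * sq (zs - tc) + e * sq (zs + ti) + e * sq (zs - ti) =
    4 * (e * sq zs) + 4 * (e * t ^+ 2).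
  by rewrite -!mulrDr SQ; ring.
have EE : e / 2 * t ^+ 2 = (e * t ^+ 2) / 2 by rewrite mulrAC.
rewrite /u in A1 A2 A3 A4; rewrite EE in B1 B2 B3 B4; lra.
Unshelve. all: by end_near. Qed.
End Maximum.

(** * Lipschitz and second order estimates *)

Section Second.
Variable R : realType.
Local Notation C := R[i].
Implicit Types (f g : C -> C) (z l : C).

Lemma expr_large (x L : R) : 1 < x -> exists n, L < x ^+ n.
Proof.
move=> x1; pose y := x - 1; have y0 : 0 < y by rewrite subr_gt0.
have [k kP] := pow2_large L ltr01; rewrite mul1r in kP.
have bern n : 1 + n%:R * y <= x ^+ n.
  elim: n => [|n ih]; first by rewrite mul0r addr0 expr0.
  rewrite exprS; have -> : x = 1 + y by rewrite /y; ring.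
  have H : (1 + y) * (1 + n%:R * y) <= (1 + y) * (1 + y) ^+ n.
    by rewrite ler_wpM2l//; [lra|have -> : 1 + y = x by rewrite /y; ring].
  apply: le_trans H; rewrite -natr1; have : 0 <= n%:R * (y * y).
    by rewrite mulr_ge0// mulr_ge0// ltW.
  have := ler0n R n; lra.
pose n := Num.Def.archi_bound (`|L| / y); exists n.
have := archi_boundP (divr_ge0 (normr_ge0 L) (ltW y0)); rewrite -/n ltr_pdivrMr// => H.
by rewrite (lt_le_trans _ (bern n))//; have := ler_norm L; lra.
Qed.

Definition hol2 f z (r : R) := forall w, cn (w - z) < r -> cderiv2 f w.

Lemma hol2_sub f z w (r s : R) : hol2 f z r -> cn (w - z) + s <= r -> hol2 f w s.
Proof.
move=> H ws u us; apply: H; have := cnD (u - w) (w - z); rewrite addrA subrK; lra.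
Qed.

(* The maximum principle is applied to [h q(h)^m], [q] the difference quotient:
   it vanishes at [0], so [q] need not be differentiable there; then [m -> oo]. *)
Lemma lip2 f z (r M : R) : 0 < r -> hol2 f z r ->
  (forall w, cn (w - z) < r -> cn (f w) <= M) ->
  forall h, cn h <= r / 2 -> cn (f (z + h) - f z) <= 4 * M / r * cn h.
Proof.
move=> r0 hf fM h hr; pose s := r / 2.
have s0 : 0 < s by rewrite divr_gt0.
have M0 : 0 <= M by rewrite (le_trans (cn_ge0 (f z)))// fM// subrr cn0.
have -> : 4 * M / r = 2 * M / s by rewrite /s; field; exact: lt0r_neq0.
have dom w : cn w <= s -> cn (z + w - z) < r.
  by rewrite addrAC subrr add0r /s; lra.
have num w : cn w <= s -> cn (f (z + w) - f z) <= 2 * M.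
  move=> ws; rewrite (le_trans (cnB _ _))//.
  have := fM _ (dom _ ws); have := fM z; rewrite subrr cn0 => /(_ r0); lra.
have [->|h0] := eqVneq h 0; first by rewrite addr0 subrr !cn0 mulr0.
have ch0 : 0 < cn h by rewrite cn_gt0.
pose q w := (f (z + w) - f z) / w.
pose c := 2 * M / s.
have c0 : 0 <= c by rewrite /c divr_ge0// ?mulr_ge0// ltW.
have q2 w : cn w <= s -> w != 0 -> cderiv2 q w.
  move=> ws w0; apply: cderiv2M.
    apply: cderiv2B; last exact: cderiv2_cst.
    by under eq_fun do rewrite addrC; apply: cderiv2_shift; rewrite addrC; apply: hf; exact: dom.
  by apply: cderiv2V => //; exact: cderiv2_id.
have main m : cn h * cn (q h) ^+ m.+1 <= s * c ^+ m.+1.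
  rewrite -cnX -cnM.
  have := @weak_maximum R (fun w => w * q w ^+ m.+1) [set w | cn (w - 0) <= s]
    [set w | w = 0 \/ cn w = s] s (s * c ^+ m.+1) (@compact_cdisc R 0 s).
  move=> /(_ _ _ _ _ h); apply => /=.
  - by move=> w; rewrite subr0.
  - move=> w; rewrite subr0 => ws; have [->|w0] := eqVneq w 0.
      have [l fl] := cderiv2_cderiv (hf z ltac:(by rewrite subrr cn0)).
      have [d d0 dP] := fl 1 ltr01.
      pose B := cn l + 1; have B0 : 0 < B by rewrite /B; have := cn_ge0 l; lra.
      move=> e e0; exists (Num.min d (e / B ^+ m.+1)).
        by rewrite lt_min d0 divr_gt0// exprn_gt0.
      move=> v; rewrite subr0 mul0r subr0 lt_min => /andP[vd ve].
      have [->|v0] := eqVneq v 0; first by rewrite mul0r cn0.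
      rewrite cnM cnX; move: ve; rewrite ltr_pdivlMr ?exprn_gt0//; apply: le_lt_trans.
      rewrite ler_wpM2l ?cn_ge0// lerXn2r ?nnegrE ?cn_ge0 ?(ltW B0)//.
      rewrite /q cnM cnV ler_pdivrMr ?cn_gt0//.
      have := dP v vd; have := cnD (f (z + v) - f z - l * v) (l * v).
      rewrite subrK cnM /B; lra.
    have := cderiv2M (cderiv2_id w) (cderiv2X m.+1 (q2 w ws w0)).
    by move=> /cderiv2_cderiv[l]; exact: cderiv_ccont.
  - move=> w _ [->|ws]; first by rewrite mul0r cn0 mulr_ge0 ?(ltW s0)// exprn_ge0.
    rewrite cnM cnX ws ler_wpM2l ?(ltW s0)// lerXn2r ?nnegrE ?cn_ge0//.
    by rewrite /q cnM cnV ws ler_wpM2r ?invr_ge0 ?(ltW s0)//; apply: num; rewrite ws.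
  - move=> w; rewrite subr0 => ws /not_orP[/eqP w0 /eqP ws']; split.
      by apply: cderiv2M; [exact: cderiv2_id|apply: cderiv2X; exact: q2].
    exists (s - cn w); first by rewrite subr_gt0 lt_neqAle ws'.
    by move=> v vw; rewrite subr0; have := cnD (v - w) w; rewrite subrK; lra.
  - by rewrite subr0.
have qc : cn (q h) <= c.
  rewrite leNgt; apply/negP => cq.
  have [cE|cn0'] := eqVneq c 0.
    have := main 0%N; rewrite cE expr1 mulr0; apply/negP; rewrite -ltNge mulr_gt0//.
    by rewrite -cE.
  have cp : 0 < c by rewrite lt_neqAle eq_sym cn0'.
  have [m mP] := @expr_large (cn (q h) / c) (s / cn h) ltac:(by rewrite ltr_pdivlMr// mul1r).
  have mP1 : s / cn h < (cn (q h) / c) ^+ m.+1.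
    have qc1 : 1 <= cn (q h) / c by rewrite ler_pdivlMr// mul1r ltW.
    rewrite (lt_le_trans mP)// exprS; apply: ler_peMl => //.
    by rewrite exprn_ge0// divr_ge0// cn_ge0.
  have := main m; apply/negP; rewrite -ltNge; move: mP1.
  rewrite expr_div_n ltr_pdivlMr ?exprn_gt0// mulrAC ltr_pdivrMr//.
  by rewrite [_ * cn h]mulrC.
move: qc; rewrite /q cnM cnV ler_pdivrMr//.
Qed.

(** [lip2] twice: for [f] in direction [k], then for [w => f (w + k) - f w] in direction [h]. Each
    use is on a disc of radius [r / 2], which turns [4 * 4] into 64. *)
Lemma second_difference f z (r M : R) : 0 < r -> hol2 f z r ->
  (forall w, cn (w - z) < r -> cn (f w) <= M) ->
  forall h k, cn h <= r / 4 -> cn k <= r / 4 ->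
  cn (f (z + h + k) - f (z + h) - (f (z + k) - f z)) <= 64 * M / r ^+ 2 * (cn h * cn k).
Proof.
move=> r0 hf fM h k hr kr; have r20 : 0 < r / 2 by rewrite divr_gt0.
have dom w v : cn (w - z) < r / 2 -> cn v <= r / 4 -> cn (w + v - z) < r.
  by move=> wz vr; have := cnD (w - z) v; rewrite addrAC; lra.
have := @lip2 (fun w => f (w + k) - f w) z (r / 2) (8 * M / r * cn k) r20.
move=> /(_ _ _ h) H.
have -> : 64 * M / r ^+ 2 * (cn h * cn k) = 4 * (8 * M / r * cn k) / (r / 2) * cn h.
  by field; exact: lt0r_neq0.
apply: H; last lra.
- move=> w wz; apply: cderiv2B.
    by apply: cderiv2_shift; apply: hf; exact: dom.
  by apply: hf; lra.
move=> w wz.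
have := @lip2 f w (r / 2) M r20; have -> : 4 * M / (r / 2) = 8 * M / r by field; exact: lt0r_neq0.
apply; last lra.
  by apply: hol2_sub hf _; lra.
by move=> u uw; apply: fM; have := cnD (u - w) (w - z); rewrite addrA subrK; lra.
Qed.

(** The second difference divided by [k], in the limit [k -> 0]. *)
Lemma cderiv_lip2 f z l m h (r M : R) : 0 < r -> hol2 f z r ->
  (forall w, cn (w - z) < r -> cn (f w) <= M) ->
  cderiv f z l -> cderiv f (z + h) m -> cn h <= r / 4 ->
  cn (m - l) <= 64 * M / r ^+ 2 * cn h.
Proof.
move=> r0 hf fM fl fm hr; set K := 64 * M / r ^+ 2.
apply/ler_addgt0Pr => e e0; have e20 : 0 < e / 2 by rewrite divr_gt0.
have [d d0 dP] := fl _ e20; have [d' d'0 d'P] := fm _ e20.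
pose t := Num.min (r / 4) (Num.min d d' / 2).
have t0 : 0 < t by rewrite lt_min !divr_gt0// lt_min d0.
have mm : Num.min d d' / 2 < d /\ Num.min d d' / 2 < d'.
  by split; rewrite ltr_pdivrMr//; case: (leP d d'); lra.
have tb : [/\ t <= r / 4, t < d & t < d'].
  have H : t <= Num.min d d' / 2 by rewrite /t ge_min lexx orbT.
  by split; [rewrite /t ge_min lexx|lra|lra].
have [t1 t2 t3] := tb; pose k : C := t%:C%C.
have kt : cn k = t by rewrite cn_real ger0_norm// ltW.
have := @second_difference f z r M r0 hf fM h k hr; rewrite kt => /(_ t1) S.
have := dP k; rewrite kt => /(_ t2) D; have := d'P k; rewrite kt => /(_ t3) D'.
rewrite -(ler_pM2r t0) -kt -cnM kt.
have -> : (m - l) * k = - (f (z + h + k) - f (z + h) - m * k) + (f (z + k) - f z - l * k) +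
  (f (z + h + k) - f (z + h) - (f (z + k) - f z)) by ring.
rewrite (le_trans (cnD _ _))// (le_trans (lerD (cnD _ _) (lexx _)))// cnN.
have : K * (cn h * t) = K * cn h * t by rewrite mulrA.
rewrite -/K in S; lra.
Qed.

Lemma taylor_hol2 f z l h (r M : R) : 0 < r -> hol2 f z r ->
  (forall w, cn (w - z) < r -> cn (f w) <= M) ->
  cderiv f z l -> cn h <= r / 4 ->
  cn (f (z + h) - f z - l * h) <= 64 * M / r ^+ 2 * cn h ^+ 2.
Proof.
move=> r0 hf fM fl hr.
have M0 : 0 <= M by rewrite (le_trans (cn_ge0 (f z)))// fM// subrr cn0.
have [f' f'P] : {f' : C -> C | forall w, cn (w - z) < r -> cderiv f w (f' w)}.
  pose S w := `[< cn (w - z) < r >].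
  have H w : exists l, cn (w - z) < r -> cderiv f w l.
    have [wr|wr] := pselect (cn (w - z) < r); last by exists 0.
    by have [m fm] := cderiv2_cderiv (hf w wr); exists m.
  by exists (fun w => projT1 (cid (H w))) => w; exact: (projT2 (cid (H w))).
have tb (t : R) : 0 <= t <= 1 -> cn (t%:C%C * h) <= cn h.
  by move=> /andP[? ?]; rewrite cnM cn_real ger0_norm// ler_piMl ?cn_ge0.
have dom (t : R) : 0 <= t <= 1 -> cn (z + t%:C%C * h - z) < r.
  by move=> /tb; rewrite addrAC subrr add0r; lra.
have := @rderiv_mean R (fun t => f (z + t%:C%C * h) - (l * h) * t%:C%C)
  (fun t => h * f' (z + t%:C%C * h) - l * h) 0 1 (64 * M / r ^+ 2 * cn h ^+ 2) ler01.
rewrite subr0 mulr1 mul0r addr0 mul1r mulr1 mulr0 subr0 => K.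
rewrite addrAC; apply: K => t t01.
  apply: rderivB; last exact: rderivM_cst.
  by apply: cderiv_rderiv; apply: f'P; exact: dom.
rewrite mulrC -mulrBl cnM expr2 mulrA ler_wpM2r ?cn_ge0//.
have K0 : 0 <= 64 * M / r ^+ 2 by exact: divr_ge0 (mulr_ge0 (ler0n _ _) M0) (sqr_ge0 _).
have := cderiv_lip2 r0 hf fM fl (f'P _ (dom t t01)) (le_trans (tb t t01) hr).
by move=> /le_trans; apply; rewrite ler_wpM2l//; exact: tb.
Qed.

(* Symmetric form of the second order Taylor estimate, closed under pointwise limits. *)
Definition quad f z (K d : R) := forall h k, cn h <= d -> cn k <= d ->
  cn ((f (z + h) - f z) * k - (f (z + k) - f z) * h) <= K * (cn h * cn k * (cn h + cn k)).

Lemma hol2_quad f z (r M : R) : 0 < r -> hol2 f z r ->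
  (forall w, cn (w - z) < r -> cn (f w) <= M) -> quad f z (64 * M / r ^+ 2) (r / 4).
Proof.
move=> r0 hf fM h k hr kr.
have [l fl] := cderiv2_cderiv (hf z ltac:(by rewrite subrr cn0)).
have Th := taylor_hol2 r0 hf fM fl hr; have Tk := taylor_hol2 r0 hf fM fl kr.
set K := 64 * M / r ^+ 2 in Th Tk *.
have -> : (f (z + h) - f z) * k - (f (z + k) - f z) * h =
  (f (z + h) - f z - l * h) * k - (f (z + k) - f z - l * k) * h by ring.
rewrite (le_trans (cnB _ _))// !cnM.
have := ler_wpM2r (cn_ge0 k) Th; have := ler_wpM2r (cn_ge0 h) Tk; lra.
Qed.

Lemma quad_limit f z (K d : R) :
  (forall h k (e : R), cn h <= d -> cn k <= d -> 0 < e -> exists2 g, quad g z K d &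
     [/\ cn (g z - f z) <= e, cn (g (z + h) - f (z + h)) <= e &
         cn (g (z + k) - f (z + k)) <= e]) -> quad f z K d.
Proof.
move=> H h k hd kd; apply/ler_addgt0Pr => e e0.
pose b := 2 * (cn h + cn k) + 1.
have b0 : 0 < b by rewrite /b; have := cn_ge0 h; have := cn_ge0 k; lra.
have [g gq [g1 g2 g3]] := H h k (e / b) hd kd (divr_gt0 e0 b0).
have := gq h k hd kd; set A := (X in cn X) => HA.
have -> : (f (z + h) - f z) * k - (f (z + k) - f z) * h =
   A + (- ((g (z + h) - f (z + h)) - (g z - f z)) * k +
   ((g (z + k) - f (z + k)) - (g z - f z)) * h) by rewrite /A; ring.
rewrite (le_trans (cnD _ _))// lerD// (le_trans (cnD _ _))// !cnM cnN.
have E1 := cnB (g (z + h) - f (z + h)) (g z - f z).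
have E2 := cnB (g (z + k) - f (z + k)) (g z - f z).
have {}E1 : cn (g (z + h) - f (z + h) - (g z - f z)) <= 2 * (e / b) by lra.
have {}E2 : cn (g (z + k) - f (z + k) - (g z - f z)) <= 2 * (e / b) by lra.
have := ler_wpM2r (cn_ge0 k) E1; have := ler_wpM2r (cn_ge0 h) E2.
have : e / b * b = e by rewrite divfK// gt_eqF.
have : 0 < e / b by rewrite divr_gt0.
rewrite /b; set eb := e / _; lra.
Qed.

Lemma cauchy_limit (x : nat -> C) (K : R) :
  (forall n m, (n <= m)%N -> cn (x m - x n) <= K / 2 ^+ n) ->
  exists l, forall n, cn (x n - l) <= 4 * K / 2 ^+ n.
Proof.
move=> xK.
have real (y : nat -> R) : (forall n m, (n <= m)%N -> `|y m - y n| <= K / 2 ^+ n) ->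
    exists s, forall n, `|y n - s| <= 2 * K / 2 ^+ n.
  move=> yK.
  have [s sP] : exists s, forall n, y n - 2 * K / 2 ^+ n <= s <= y n - 2 * K / 2 ^+ n + 4 * K / 2 ^+ n.
    apply: (nested_intervals (x := fun n => y n - 2 * K / 2 ^+ n)) => n.
    have := yK n n.+1 (leqnSn n); rewrite ler_norml.
    have e a : a * K / 2 ^+ n = a * (K / 2 ^+ n) by rewrite mulrA.
    have e' a : a * K / 2 ^+ n.+1 = a * (K / 2 ^+ n) / 2.
      by rewrite exprSr invfM !mulrA.
    rewrite !e !e'; set t := K / _; move=> /andP[? ?]; split; lra.
  exists s => n; have := sP n.
  have e a : a * K / 2 ^+ n = a * (K / 2 ^+ n) by rewrite mulrA.
  by rewrite !e; set t := K / _; rewrite ler_norml; lra.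
have [n m nm|a aP] := real (fun n => complex.Re (x n)).
  by rewrite -ReN -ReD (le_trans (ler_Re_cn _))// xK.
have [n m nm|b bP] := real (fun n => complex.Im (x n)).
  by rewrite -ImN -ImD (le_trans (ler_Im_cn _))// xK.
exists (a +i* b)%C => n; rewrite (le_trans (ler_cn_ReIm _))//.
have := aP n; have := bP n; rewrite ReD ImD ReN ImN [complex.Re (_ +i* _)%C]/= [complex.Im (_ +i* _)%C]/=.
have e c : c * K / 2 ^+ n = c * (K / 2 ^+ n) by rewrite mulrA.
rewrite !e; lra.
Qed.
End Second.

(** * Holomorphic functions of one variable: regularity, Cauchy estimates, maximum principle,
    propagation of smallness *)

Section Cauchy.
Variable R : realType.
Local Notation C := R[i].
Implicit Types (f g : C -> C) (z l : C).

(** [quad] makes the difference quotients along [d / 2 ^+ n] a Cauchy sequence; letting [k] run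
    through these steps in [quad] gives the Taylor bound for their limit [l]. *)
Lemma quad_cderiv f z (K d : R) : 0 < d -> 0 <= K -> quad f z K d ->
  exists2 l, cderiv f z l &
    forall h, cn h <= d -> cn (f (z + h) - f z - l * h) <= K * cn h ^+ 2.
Proof.
move=> d0 K0 fq.
pose k n : C := (d / 2 ^+ n)%:C%C.
have p2 n : (0 : R) < 2 ^+ n by rewrite exprn_gt0.
have kE n : cn (k n) = d / 2 ^+ n by rewrite cn_real ger0_norm// divr_ge0// ltW.
have kd n : cn (k n) <= d.
  rewrite kE ler_pdivrMr// ler_peMr ?(ltW d0)// exprn_ege1//; lra.
have k0 n : k n != 0 by rewrite -cn_gt0 kE divr_gt0.
pose q n := (f (z + k n) - f z) / k n.
have qh h n : cn h <= d -> cn (f (z + h) - f z - q n * h) <= K * cn h * (cn h + cn (k n)).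
  move=> hd; rewrite -(ler_pM2r (x := cn (k n))) ?cn_gt0// -cnM.
  have -> : (f (z + h) - f z - q n * h) * k n =
    (f (z + h) - f z) * k n - (f (z + k n) - f z) * h.
    by rewrite /q; move: (k n) (k0 n) => t t0; field.
  have := fq h (k n) hd (kd n); move=> /le_trans; apply.
  by rewrite le_eqVlt; apply/orP; left; apply/eqP; ring.
have [l lP] : exists l, forall n, cn (q n - l) <= 4 * (2 * K * d) / 2 ^+ n.
  apply: cauchy_limit => n m nm.
  have := qh (k m) n (kd m).
  have -> : f (z + k m) - f z - q n * k m = (q m - q n) * k m.
    by rewrite /q; move: (k n) (k m) (k0 n) (k0 m) => t u t0 u0; field; rewrite t0.
  rewrite cnM -mulrA [cn (k m) * _]mulrC mulrA ler_pM2r ?cn_gt0// => /le_trans; apply.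
  have kmn : cn (k m) <= d / 2 ^+ n.
    rewrite kE ler_pM2l// lef_pV2 ?posrE//; apply: ler_weXn2l => //; lra.
  have -> : 2 * K * d / 2 ^+ n = K * (d / 2 ^+ n + d / 2 ^+ n) by ring.
  by rewrite ler_wpM2l// lerD// kE.
have main h : cn h <= d -> cn (f (z + h) - f z - l * h) <= K * cn h ^+ 2.
  move=> hd; apply/ler_addgt0Pr => e e0.
  have [n nP] := pow2_large (9 * K * d * cn h) e0.
  have := cnD (f (z + h) - f z - q n * h) ((q n - l) * h).
  have -> : f (z + h) - f z - q n * h + (q n - l) * h = f (z + h) - f z - l * h by ring.
  move=> /le_trans; apply; rewrite cnM.
  have H1 := qh h n hd; have H2 := ler_wpM2r (cn_ge0 h) (lP n).
  apply: (le_trans (lerD H1 H2)); rewrite kE.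
  have -> : 4 * (2 * K * d) / 2 ^+ n = 8 * K * (d / 2 ^+ n) by ring.
  have : 9 * K * (d / 2 ^+ n) * cn h <= e.
    by rewrite (_ : _ * cn h = 9 * K * d * cn h / 2 ^+ n) ?ler_pdivrMr ?ltW//; ring.
  set t := d / _; lra.
exists l => // e e0; exists (Num.min d (e / (K + 1))).
  by rewrite lt_min d0 divr_gt0//; lra.
move=> h; rewrite lt_min ltr_pdivlMr; last lra.
move=> /andP[hd he]; rewrite (le_trans (main _ (ltW hd)))// expr2 mulrA ler_wpM2r ?cn_ge0//.
rewrite mulrC (le_trans _ (ltW he))// ler_wpM2l ?cn_ge0//; lra.
Qed.

Definition hol f z (r : R) := forall w, cn (w - z) < r -> exists l, cderiv f w l.

Lemma hol_sub f z w (r s : R) : hol f z r -> cn (w - z) + s <= r -> hol f w s.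
Proof.
move=> H ws u us; apply: H; have := cnD (u - w) (w - z); rewrite addrA subrK; lra.
Qed.

Lemma hol_fun f z (r : R) : hol f z r ->
  {f' : C -> C | forall w, cn (w - z) < r -> cderiv f w (f' w)}.
Proof.
move=> hf.
have H w : exists l, cn (w - z) < r -> cderiv f w l.
  have [wr|wr] := pselect (cn (w - z) < r); last by exists 0.
  by have [m fm] := hf w wr; exists m.
by exists (fun w => projT1 (cid (H w))) => w; exact: (projT2 (cid (H w))).
Qed.

Lemma cderiv_quotient f w l : cderiv f w l -> forall e : R, 0 < e -> exists2 d : R, 0 < d &
  forall t, t != 0 -> cn t < d -> cn ((f (w + t) - f w) / t - l) <= e.
Proof.
move=> fl e e0; have [d d0 dP] := fl e e0; exists d => // t t0 td.
rewrite -(ler_pM2r (x := cn t)) ?cn_gt0// -cnM mulrBl divfK//; exact: dP.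
Qed.

(** The primitive [F] of [f] is twice differentiable, so its second difference quotients are bounded
    uniformly in the steps and satisfy [quad] with one constant. Letting one step tend to 0 gives
    [quad] for the difference quotients of [f], letting the other tend to 0 gives it for [f']; hence
    [f'] is differentiable. *)
Lemma hol_cderiv2 f z (r : R) : 0 < r -> hol f z r -> cderiv2 f z.
Proof.
move=> r0 hf; have [f' f'P] := hol_fun hf.
have [F FP] : exists F, forall w, cn (w - z) < r / 4 -> cderiv F w (f w).
  apply: primitive; first by rewrite divr_gt0.
  by move=> w wz; apply: hf; lra.
have F2 : hol2 F z (r / 4).
  move=> w wz; exists f; exists (r / 4 - cn (w - z)); first by rewrite subr_gt0.
  split; last by apply: hf; lra.
  move=> u uw; apply: FP; have := cnD (u - w) (w - z); rewrite addrA subrK; lra.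
have [p p0 pP] := cderiv_ccont (FP z ltac:(by rewrite subrr cn0 divr_gt0)) ltr01.
pose s := Num.min (r / 4) p; pose M := cn (F z) + 1.
have s0 : 0 < s by rewrite lt_min divr_gt0.
have sr : s <= r / 4 by rewrite ge_min lexx.
have sp : s <= p by rewrite ge_min lexx orbT.
have Fs : hol2 F z s by move=> w wz; apply: F2; lra.
have FM w : cn (w - z) < s -> cn (F w) <= M.
  move=> ws; have := pP w (lt_le_trans ws sp); have := cnD (F w - F z) (F z).
  by rewrite subrK /M; lra.
have M0 : 0 <= M by rewrite /M; have := cn_ge0 (F z); lra.
pose M1 := 64 * M / (s / 2) ^+ 2.
have M10 : 0 <= M1 by exact: divr_ge0 (mulr_ge0 (ler0n _ _) M0) (sqr_ge0 _).
pose K := 64 * M1 / (s / 2) ^+ 2.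
have K0 : 0 <= K by exact: divr_ge0 (mulr_ge0 (ler0n _ _) M10) (sqr_ge0 _).
have s20 : 0 < s / 2 by rewrite divr_gt0.
have dom w v : cn (w - z) < s / 2 -> cn v <= s / 8 -> cn (w + v - z) < s / 2 + s / 8.
  by move=> wz vr; have := cnD (w - z) v; rewrite addrAC; lra.
have near3 (h : C) : cn h <= s / 8 -> cn (z + h - z) < s / 2.
  by rewrite [z + h - z]addrAC subrr add0r; lra.
have near0 : cn (z - z) < s / 2 by rewrite subrr cn0.
have quad1 h k : h != 0 -> k != 0 -> cn h <= s / 8 -> cn k <= s / 8 ->
    quad (fun w => (F (w + h + k) - F (w + h) - (F (w + k) - F w)) / (h * k)) z K (s / 8).
  move=> h0 k0 hs ks; have -> : s / 8 = s / 2 / 4 by field.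
  have sub2 a : cn a <= s / 8 -> forall w, cn (w - z) < s / 2 -> cderiv2 F (w + a).
    by move=> as8 w wz; apply: Fs; have := dom w a wz as8; lra.
  apply: hol2_quad => // w wz.
    apply: cderiv2M; last exact: cderiv2_cst.
    apply: cderiv2B; apply: cderiv2B.
    - under eq_fun do rewrite -addrA; apply: cderiv2_shift; apply: Fs; rewrite addrA.
      by have := dom w h wz hs; have := cnD (w + h - z) k; rewrite [w + h - z + k]addrAC; lra.
    - by apply: cderiv2_shift; exact: sub2.
    - by apply: cderiv2_shift; exact: sub2.
    - by apply: Fs; lra.
  rewrite cnM cnV ler_pdivrMr ?cn_gt0 ?mulf_neq0// cnM.
  apply: second_difference => //; [|move=> u uw|lra|lra].
    by apply: hol2_sub Fs _; lra.
  by apply: FM; have := cnD (u - w) (w - z); rewrite addrA subrK; lra.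
have quad2 h : h != 0 -> cn h <= s / 8 -> quad (fun w => (f (w + h) - f w) / h) z K (s / 8).
  move=> h0 hs; apply: quad_limit => a b e as8 bs8 e0.
  have eh0 : 0 < e * cn h / 2 by rewrite divr_gt0// mulr_gt0// cn_gt0.
  have P w : cn (w - z) < s / 2 -> exists2 d : R, 0 < d & forall t, t != 0 -> cn t < d ->
     cn ((F (w + h + t) - F (w + h) - (F (w + t) - F w)) / (h * t) - (f (w + h) - f w) / h) <= e.
    move=> wz.
    have [d d0 dP] := cderiv_quotient (FP w ltac:(lra)) eh0.
    have [d' d'0 d'P] := cderiv_quotient (FP (w + h) ltac:(have := dom w h wz hs; lra)) eh0.
    exists (Num.min d d'); first by rewrite lt_min d0.
    move=> t t0; rewrite lt_min => /andP[/(dP _ t0) H1 /(d'P _ t0) H2].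
    rewrite -(ler_pM2r (x := cn h)) ?cn_gt0// -cnM.
    have -> : ((F (w + h + t) - F (w + h) - (F (w + t) - F w)) / (h * t) - (f (w + h) - f w) / h) * h =
      ((F (w + h + t) - F (w + h)) / t - f (w + h)) - ((F (w + t) - F w) / t - f w).
      by field; rewrite t0 h0.
    by rewrite (le_trans (cnB _ _))//; lra.
  have [d1 d10 D1] := P z near0.
  have [d2 d20 D2] := P _ (near3 _ as8).
  have [d3 d30 D3] := P _ (near3 _ bs8).
  pose t := Num.min (s / 8) (Num.min d1 (Num.min d2 d3) / 2).
  have mm : 0 < Num.min d1 (Num.min d2 d3) by rewrite !lt_min d10 d20.
  have t0 : 0 < t by rewrite lt_min !divr_gt0.
  have ts : t <= s / 8 by rewrite ge_min lexx.
  have tm : t < Num.min d1 (Num.min d2 d3).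
    apply: (@le_lt_trans _ _ (Num.min d1 (Num.min d2 d3) / 2)); last lra.
    by rewrite ge_min lexx orbT.
  move: tm; rewrite !lt_min => /and3P[t1 t2 t3].
  have tE : cn (t%:C%C : C) = t by rewrite cn_real ger0_norm// ltW.
  have tn0 : (t%:C%C : C) != 0 by rewrite -cn_gt0 tE.
  exists (fun w => (F (w + h + t%:C%C) - F (w + h) - (F (w + t%:C%C) - F w)) / (h * t%:C%C)).
    by apply: quad1 => //; rewrite tE.
  by split; [apply: D1|apply: D2|apply: D3]; rewrite ?tE.
have quad3 : quad f' z K (s / 8).
  apply: quad_limit => a b e as8 bs8 e0.
  have P w : cn (w - z) < s / 2 -> exists2 d : R, 0 < d & forall t, t != 0 -> cn t < d ->
     cn ((f (w + t) - f w) / t - f' w) <= e.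
    by move=> wz; apply: cderiv_quotient => //; apply: f'P; lra.
  have [d1 d10 D1] := P z near0.
  have [d2 d20 D2] := P _ (near3 _ as8).
  have [d3 d30 D3] := P _ (near3 _ bs8).
  pose t := Num.min (s / 8) (Num.min d1 (Num.min d2 d3) / 2).
  have mm : 0 < Num.min d1 (Num.min d2 d3) by rewrite !lt_min d10 d20.
  have t0 : 0 < t by rewrite lt_min !divr_gt0.
  have ts : t <= s / 8 by rewrite ge_min lexx.
  have tm : t < Num.min d1 (Num.min d2 d3).
    apply: (@le_lt_trans _ _ (Num.min d1 (Num.min d2 d3) / 2)); last lra.
    by rewrite ge_min lexx orbT.
  move: tm; rewrite !lt_min => /and3P[t1 t2 t3].
  have tE : cn (t%:C%C : C) = t by rewrite cn_real ger0_norm// ltW.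
  have tn0 : (t%:C%C : C) != 0 by rewrite -cn_gt0 tE.
  exists (fun w => (f (w + t%:C%C) - f w) / t%:C%C).
    by apply: quad2 => //; rewrite tE.
  by split; [apply: D1|apply: D2|apply: D3]; rewrite ?tE.
have [l f'l _] := quad_cderiv (divr_gt0 s0 (ltr0Sn R 7)) K0 quad3.
by exists f', r => //; split=> //; exists l.
Qed.

Lemma hol_hol2 f z (r : R) : hol f z r -> hol2 f z r.
Proof.
move=> hf w wz; apply: (@hol_cderiv2 f w (r - cn (w - z))); first by rewrite subr_gt0.
by apply: hol_sub hf _; rewrite addrC subrK.
Qed.

Section CauchyEstimates.
Variables (f : C -> C) (z : C) (r M : R).
Hypotheses (r0 : 0 < r) (hf : hol f z r) (fM : forall w, cn (w - z) < r -> cn (f w) <= M).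

Lemma hol_lipschitz h : cn h <= r / 2 -> cn (f (z + h) - f z) <= 4 * M / r * cn h.
Proof. exact: (lip2 r0 (hol_hol2 hf) fM). Qed.

Lemma hol_taylor l h : cderiv f z l -> cn h <= r / 4 ->
  cn (f (z + h) - f z - l * h) <= 64 * M / r ^+ 2 * cn h ^+ 2.
Proof. exact: (taylor_hol2 r0 (hol_hol2 hf) fM). Qed.

Lemma hol_quad : quad f z (64 * M / r ^+ 2) (r / 4).
Proof. exact: (hol2_quad r0 (hol_hol2 hf) fM). Qed.

Lemma hol_deriv_bound l : cderiv f z l -> cn l <= 4 * M / r.
Proof.
move=> fl; apply/ler_addgt0Pr => e e0; have [d d0 dP] := fl e e0.
pose t := Num.min (d / 2) (r / 2).
have t0 : 0 < t by rewrite lt_min !divr_gt0.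
have [t1 t2] : t <= d / 2 /\ t <= r / 2 by split; rewrite ge_min lexx ?orbT.
have tE : cn (t%:C%C : C) = t by rewrite cn_real ger0_norm// ltW.
have := dP (t%:C%C) ltac:(rewrite tE; lra); rewrite tE => H1.
have := @hol_lipschitz (t%:C%C) ltac:(rewrite tE; lra); rewrite tE => H2.
rewrite -(ler_pM2r t0) -[X in cn l * X]tE -cnM.
have := cnB (f (z + t%:C%C) - f z) (f (z + t%:C%C) - f z - l * t%:C%C).
rewrite opprB addrC subrK; move=> /le_trans; apply; lra.
Qed.

(** With [g = 1 - f / f z] of nonnegative real part, [q = e / (e + g)] has modulus at most 1 and
    value 1 at [z]. The Lipschitz bound keeps [q] within 1/2 of 1 at [z + h], which means
    [cn (g (z + h)) <= 3 * e] for every [e > 0]. *)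
Lemma strong_maximum : (forall w, cn (w - z) < r -> cn (f w) <= cn (f z)) ->
  forall h, cn h <= r / 8 -> f (z + h) = f z.
Proof.
move=> fmax h hr; have r_gt0 := r0.
have dom k : cn k <= r / 8 -> cn (z + k - z) < r.
  by rewrite [z + k - z]addrAC subrr add0r; lra.
have [fz0|fz0] := eqVneq (f z) 0.
  have := fmax _ (dom h hr); rewrite fz0 cn0 => H.
  by apply/eqP; rewrite -cn_eq0 eq_le H cn_ge0.
pose g w := 1 - f w / f z.
have gRe w : cn (w - z) < r -> 0 <= complex.Re (g w).
  move=> /fmax H; rewrite /g ReD ReN [complex.Re 1]/=.
  have := ler_Re_cn (f w / f z); rewrite cnM cnV => /(le_trans (ler_norm _)).
  have : cn (f w) / cn (f z) <= 1 by rewrite ler_pdivrMr ?mul1r ?cn_gt0.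
  lra.
have gh e : 0 < e -> cn (g (z + h)) <= 3 * e.
  move=> e0; pose q w := e%:C%C / (e%:C%C + g w).
  have den w : cn (w - z) < r -> e <= cn (e%:C%C + g w).
    move=> /gRe gw; have := ler_Re_cn (e%:C%C + g w) => /(le_trans (ler_norm _)).
    by rewrite ReD [complex.Re _%:C%C]/=; lra.
  have den0 w : cn (w - z) < r -> e%:C%C + g w != 0.
    by move=> /den ew; rewrite -cn_gt0; lra.
  have hq : hol q z r.
    move=> w wr; have := hol_hol2 hf wr => fw.
    suff /cderiv2_cderiv : cderiv2 q w by [].
    apply: cderiv2M; first exact: cderiv2_cst.
    apply: cderiv2V; last exact: den0.
    apply: cderiv2D; first exact: cderiv2_cst.
    apply: cderiv2B; first exact: cderiv2_cst.
    by apply: cderiv2M => //; exact: cderiv2_cst.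
  have qM w : cn (w - z) < r -> cn (q w) <= 1.
    move=> /den ew; rewrite cnM cnV cn_real ger0_norm ?(ltW e0)// ler_pdivrMr ?mul1r//.
    lra.
  have qz : q z = 1.
    rewrite /q /g divff// subrr addr0 divff//.
    by rewrite -cn_eq0 cn_real normr_eq0 gt_eqF.
  have := lip2 r0 (hol_hol2 hq) qM (h := h) ltac:(lra); rewrite qz => H.
  have {}H : cn (q (z + h) - 1) <= 1 / 2.
    apply: (le_trans H); rewrite mulr1 mulrAC ler_pdivrMr//; lra.
  have H1 : 1 / 2 <= cn (q (z + h)).
    by have := cnD (q (z + h)) (1 - q (z + h)); rewrite addrC subrK cn1 cnC; lra.
  have E := den _ (dom h hr).
  move: H1; rewrite cnM cnV cn_real ger0_norm ?(ltW e0)// ler_pdivlMr; last lra.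
  have := cnB (e%:C%C + g (z + h)) e%:C%C.
  rewrite addrAC subrr add0r cn_real ger0_norm ?(ltW e0)//.
  lra.
have g0 : g (z + h) = 0.
  apply/eqP; rewrite -cn_eq0; apply/eqP/le_anti; rewrite cn_ge0 andbT.
  apply/ler_addgt0Pr => e e0; rewrite add0r.
  by have := gh (e / 3) (divr_gt0 e0 (ltr0Sn R 2)); rewrite mulrC divfK.
by move/eqP: g0; rewrite /g subr_eq0 eq_sym => /eqP /(canRL (divfK fz0)); rewrite mul1r.
Qed.

End CauchyEstimates.

(* Three circles: the maximum principle for [f h^-a] on an annulus, [a] large. *)
Lemma propagation_disc (r k M e : R) : 0 < k -> k <= r / 2 -> 0 < e ->
  exists2 d : R, 0 < d & forall f z, hol f z r ->
    (forall w, cn (w - z) < r -> cn (f w) <= M) ->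
    (forall w, cn (w - z) <= k -> cn (f w) <= d) ->
    forall w, cn (w - z) <= r / 2 -> cn (f w) <= e.
Proof.
move=> k0 kr e0; have r0 : 0 < r by lra.
pose s := 3 * r / 4.
have s0 : 0 < s by rewrite /s; lra.
(* On the outer circle, of radius [s = (3 / 2) * (r / 2)], division by [h ^+ a] gains the factor
   [(3 / 2) ^+ a], which beats [M / e]. The loss on the inner circle is paid by [d]. *)
have [a aP] := @expr_large R (3 / 2) (`|M| / e) ltac:(lra).
have p0 : 0 < (r / 2 / k) ^+ a by rewrite exprn_gt0// divr_gt0//; lra.
exists (Num.min e (e / (r / 2 / k) ^+ a)); first by rewrite lt_min e0 divr_gt0.
set d := Num.min _ _ => f z hf fM fd w wr.
have [wk|kw] := leP (cn (w - z)) k.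
  by rewrite (le_trans (fd _ wk))// /d ge_min lexx.
pose g h := f (h + z) * (h ^+ a)^-1.
pose B := e * ((r / 2) ^+ a)^-1.
have B0 : 0 <= B by rewrite mulr_ge0 ?(ltW e0)// invr_ge0 exprn_ge0//; lra.
have ga h : cn h != 0 -> cn (g h) = cn (f (h + z)) / cn h ^+ a.
  by move=> _; rewrite cnM cnV cnX.
have g2 h : k <= cn h -> cn h <= s -> cderiv2 g h.
  move=> kh hs; apply: cderiv2M.
    by apply: cderiv2_shift; apply: (hol_hol2 hf); rewrite addrK /s in hs *; lra.
  apply: cderiv2V; first exact/cderiv2X/cderiv2_id.
  by rewrite expf_neq0// -cn_gt0; lra.
have cK : compact ([set h | k <= cn h /\ cn h <= s] : set (C^o)).
  apply: (subclosed_compact _ (@compact_cdisc R 0 s)); last first.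
    by move=> h /= []; rewrite subr0.
  rewrite (_ : [set _ | _] = ~` [set h | cn h < k] `&` ~` [set h | s < cn h]); last first.
    by apply/seteqP; split=> h /=; rewrite !leNgt => -[/negP ? /negP ?].
  apply: closedI; apply: open_closedC; rewrite openE => h /= hk; apply/nbhsC_P.
    exists (k - cn h); first by rewrite subr_gt0.
    by move=> v /= vh; have := cnD (v - h) h; rewrite subrK; lra.
  exists (cn h - s); first by rewrite subr_gt0.
  by move=> v /= vh; have := cnD (h - v) v; rewrite subrK [cn (h - v)]cnC; lra.
have := @weak_maximum R g _ [set h | cn h = k \/ cn h = s] s B cK.
move=> /(_ _ _ _ _ (w - z)) W.
have : cn (g (w - z)) <= B.
  apply: W => /=.
  - by move=> h [].
  - by move=> h [kh hs]; have [l gl] := cderiv2_cderiv (g2 h kh hs); exact: cderiv_ccont gl.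
  - move=> h [kh hs] hB; have ch0 : 0 < cn h by lra.
    rewrite ga ?gt_eqF// ler_pdivrMr ?exprn_gt0//.
    case: hB => hE.
      rewrite (le_trans (fd _ _)) ?addrK ?hE// /d ge_min; apply/orP; right.
      rewrite /B expr_div_n invfM invrK mulrA //.
    rewrite (le_trans (fM _ _)) ?addrK ?hE//; first by rewrite /s; lra.
    have aP' : `|M| <= e * (3 / 2) ^+ a by move: aP; rewrite ltr_pdivrMr// mulrC => /ltW.
    have -> : B * s ^+ a = e * (3 / 2) ^+ a.
      rewrite /B -mulrA [_^-1 * _]mulrC -expr_div_n; congr (_ * _ ^+ _).
      by rewrite /s; field; exact: lt0r_neq0.
    exact: le_trans (ler_norm M) aP'.
  - move=> h [kh hs] /not_orP[/eqP hk /eqP hs']; split; first exact: g2.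
    exists (Num.min (cn h - k) (s - cn h)).
      by rewrite lt_min !subr_gt0 !lt_neqAle kh hs hs' eq_sym hk.
    move=> v; rewrite lt_min => /andP[v1 v2]; split.
      by have := cnD (h - v) v; rewrite subrK [cn (h - v)]cnC; lra.
    by have := cnD (v - h) h; rewrite subrK; lra.
  - by rewrite /s; lra.
have wz0 : 0 < cn (w - z) by lra.
rewrite ga ?gt_eqF// subrK ler_pdivrMr ?exprn_gt0// /B => /le_trans; apply.
rewrite -mulrA ger_pMr// mulrC ler_pdivrMr ?exprn_gt0//; last lra.
by rewrite mul1r lerXn2r ?nnegrE//; lra.
Qed.
End Cauchy.

(** * Holomorphic functions on normed spaces *)

Section RealNorm.
Variables (R : realType) (V : normedModType R[i]).
Local Notation C := R[i].
Implicit Types (u v w : V).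

(** The norm of a module over [R[i]] is itself an element of [R[i]]; a real value is needed for
    ordered field arithmetic. *)
Definition vn v : R := complex.Re `|v|.

Lemma normE v : `|v| = (vn v)%:C%C.
Proof. by rewrite RRe_real// normr_real. Qed.

Lemma vn_ge0 v : 0 <= vn v.
Proof. by have := normr_ge0 v; rewrite normE lecR. Qed.

Lemma vn0 : vn 0 = 0. Proof. by rewrite /vn normr0. Qed.

Lemma vnD u v : vn (u + v) <= vn u + vn v.
Proof. by rewrite -lecR realCD -!normE ler_normD. Qed.

Lemma vnN v : vn (- v) = vn v. Proof. by rewrite /vn normrN. Qed.

Lemma vnC u v : vn (u - v) = vn (v - u). Proof. by rewrite /vn distrC. Qed.

Lemma vnB u v : vn (u - v) <= vn u + vn v.
Proof. by rewrite -[vn v]vnN vnD. Qed.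

Lemma vnZ (a : C) v : vn (a *: v) = cn a * vn v.
Proof. by apply: complexI; rewrite realCM -!normE normrZ normrcE. Qed.

Lemma vn_eq0 v : (vn v == 0) = (v == 0).
Proof. by rewrite -[v == 0]normr_eq0 normE -(inj_eq (@complexI R)). Qed.

Lemma vn_gt0 v : (0 < vn v) = (v != 0).
Proof. by rewrite lt_neqAle vn_ge0 andbT eq_sym vn_eq0. Qed.

Lemma nbhsV_P v (A : set V) :
  nbhs v A <-> exists2 d : R, 0 < d & forall w, vn (w - v) < d -> A w.
Proof.
split.
  move=> /nbhs_ballP[e /= e0 eA].
  have eE : e = (complex.Re e)%:C%C by rewrite RRe_real// gtr0_real.
  exists (complex.Re e); first by move: e0; rewrite eE ltcR.
  by move=> w wz; apply: eA; rewrite -ball_normE/= distrC normE eE ltcR.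
move=> [d d0 dA]; apply/nbhs_ballP; exists d%:C%C; first by rewrite /= ltcR.
by move=> w; rewrite -ball_normE/= distrC normE ltcR; exact: dA.
Qed.

End RealNorm.

Section Frechet.
Variable R : realType.
Local Notation C := R[i].

Lemma vnCo (z : C) : vn (z : C^o) = cn z.
Proof. by rewrite /vn normrcE. Qed.

Definition fderiv (V W : normedModType C) (f : V -> W) (z : V) (L : V -> W) :=
  forall e : R, 0 < e -> exists2 d : R, 0 < d &
    forall v, vn v < d -> vn (f (z + v) - f z - L v) <= e * vn v.

Lemma differentiable_fderiv (V W : normedModType C) (f : V -> W) z :
  differentiable f z -> fderiv f z ('d f z).
Proof.
move=> df e e0; have /eqaddoP/(_ e%:C%C) := diff_locally df.
rewrite ltcR => /(_ e0); near_simpl => /nbhsV_P[d d0 dP]; exists d => // v vd.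
have := dP v; rewrite subr0 => /(_ vd); rewrite !fctE /= /shift /=.
by rewrite !normE -realCM lecR [v + z]addrC opprD addrA.
Qed.

Lemma continuous_vn (V W : normedModType C) (f : V -> W) z :
  (forall e : R, 0 < e -> exists2 d : R, 0 < d &
    forall w, vn (w - z) < d -> vn (f w - f z) < e) <-> {for z, continuous f}.
Proof.
split=> H.
  move=> A /nbhsV_P[e e0 eA]; apply/nbhsV_P; have [d d0 dP] := H e e0.
  by exists d => // w /dP ?; exact: eA.
move=> e e0; have : nbhs (f z) [set w | vn (w - f z) < e].
  by apply/nbhsV_P; exists e.
by move=> /H /nbhsV_P[d d0 dP]; exists d.
Qed.

Lemma fderiv_differentiable (V W : normedModType C) (f : V -> W) z (L : {linear V -> W}) :
  continuous L -> fderiv f z L -> differentiable f z /\ 'd f z = L :> (V -> W).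
Proof.
move=> cL fL.
have dg : f \o shift z = cst (f z) + L +o_ (0 : V) id.
  apply/eqaddoP => e e0; near_simpl.
  have eE : e = (complex.Re e)%:C%C by rewrite RRe_real// gtr0_real.
  have [d d0 dP] := fL (complex.Re e) ltac:(by move: e0; rewrite eE ltcR).
  apply/nbhsV_P; exists d => // v; rewrite subr0 => /dP.
  by rewrite !fctE /= /shift /= !normE [in X in _ -> X]eE -realCM lecR [v + z]addrC opprD addrA.
have dE := diff_unique cL dg; split=> //.
by apply/diff_locallyP; rewrite dE; split.
Unshelve. all: by end_near. Qed.

Lemma bounded_linear_continuous (V W : normedModType C) (L : {linear V -> W}) (K : R) :
  (forall v, vn (L v) <= K * vn v) -> continuous L.
Proof.
move=> LK z; apply/continuous_vn => e e0.
have K0 : 0 < `|K| + 1 by have := normr_ge0 K; lra.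
exists (e / (`|K| + 1)); first exact: divr_gt0.
move=> w; rewrite ltr_pdivlMr// -linearB => we; apply: (le_lt_trans (LK _)).
rewrite (le_lt_trans _ we)// mulrC ler_wpM2l ?vn_ge0//; have := ler_norm K; lra.
Qed.

Variable V : normedModType C.
Implicit Types (f g : V -> C^o) (z u v w : V).

Definition holV f z (r : R) := forall w, vn (w - z) < r -> differentiable f w.

Lemma holV_sub f z w (r s : R) : holV f z r -> vn (w - z) + s <= r -> holV f w s.
Proof.
move=> H ws u us; apply: H; have := vnD (u - w) (w - z); rewrite addrA subrK; lra.
Qed.

Lemma cderiv_line f z v (t : C) : differentiable f (z + t *: v) ->
  cderiv (fun s : C => f (z + s *: v) : C) t ('d f (z + t *: v) v).
Proof.
move=> /differentiable_fderiv H e e0; pose b := vn v + 1.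
have b0 : 0 < b by rewrite /b; have := vn_ge0 v; lra.
have [d d0 dP] := H (e / b) (divr_gt0 e0 b0); exists (d / b); first exact: divr_gt0.
move=> h; rewrite ltr_pdivlMr// => hd.
have hv : vn (h *: v) <= cn h * b by rewrite vnZ ler_wpM2l ?cn_ge0// /b; lra.
have := dP _ (le_lt_trans hv hd); rewrite -[z + _ + _]addrA -scalerDl linearZ/= vnCo.
rewrite [h *: 'd f _ v]mulrC => /le_trans; apply.
by rewrite -mulrA ler_wpM2l ?(ltW e0)// mulrC ler_pdivrMr.
Qed.

Lemma hol_line f z (r : R) u : holV f z r -> vn u <= 1 ->
  hol (fun s : C => f (z + s *: u) : C) 0 r.
Proof.
move=> hf u1 s; rewrite subr0 => sr; eexists; apply: cderiv_line; apply: hf.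
by rewrite addrAC subrr add0r vnZ (le_lt_trans _ sr)// ler_piMr// cn_ge0.
Qed.

Lemma ball_line z (r : R) u (s : C) : vn u <= 1 -> cn s < r -> vn (z + s *: u - z) < r.
Proof.
by move=> u1 sr; rewrite addrAC subrr add0r vnZ (le_lt_trans _ sr)// ler_piMr// cn_ge0.
Qed.

(** Reduces estimates in direction [v] to one complex line. The bound 1, instead of equality, admits
    [v = 0]. *)
Lemma unit_vector v : exists2 u, vn u <= 1 & v = ((vn v)%:C%C : C) *: u.
Proof.
have [->|v0] := eqVneq v 0; first by exists 0; rewrite ?vn0// scaler0.
exists (((vn v)^-1)%:C%C *: v).
  by rewrite vnZ cn_real ger0_norm ?invr_ge0 ?vn_ge0// mulVf// vn_eq0.
by rewrite scalerA -realCM divff ?vn_eq0// scale1r.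
Qed.

Lemma cn_vn v : cn ((vn v)%:C%C : C) = vn v.
Proof. by rewrite cn_real ger0_norm// vn_ge0. Qed.

Section Estimates.
Variables (f : V -> C^o) (z : V) (r M : R).
Hypotheses (r0 : 0 < r) (hf : holV f z r) (fM : forall w, vn (w - z) < r -> cn (f w) <= M).

Let lineM u : vn u <= 1 -> forall s : C, cn (s - 0) < r -> cn (f (z + s *: u) : C) <= M.
Proof. by move=> u1 s; rewrite subr0 => sr; apply: fM; exact: ball_line. Qed.

Lemma holV_lipschitz v : vn v <= r / 2 -> cn (f (z + v) - f z) <= 4 * M / r * vn v.
Proof.
move=> vr; have [u u1 vE] := unit_vector v.
have := hol_lipschitz r0 (hol_line hf u1) (lineM u1) (h := (vn v)%:C%C).
by rewrite cn_vn add0r scale0r addr0 -vE; apply.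
Qed.

Lemma holV_taylor v : vn v <= r / 4 ->
  cn (f (z + v) - f z - 'd f z v) <= 64 * M / r ^+ 2 * vn v ^+ 2.
Proof.
move=> vr; have [u u1 vE] := unit_vector v.
have df : differentiable f (z + (0 : C) *: u).
  by rewrite scale0r addr0; apply: hf; rewrite subrr vn0.
have := hol_taylor r0 (hol_line hf u1) (lineM u1) (h := (vn v)%:C%C) (cderiv_line df).
rewrite cn_vn add0r scale0r addr0 -vE [_ * _%:C%C]mulrC.
have -> : 'd f z v = (vn v)%:C%C * 'd f z u by rewrite {1}vE linearZ.
exact.
Qed.

Lemma holV_diff_bound v : cn ('d f z v) <= 4 * M / r * vn v.
Proof.
have [u u1 vE] := unit_vector v.
have df : differentiable f (z + (0 : C) *: u).
  by rewrite scale0r addr0; apply: hf; rewrite subrr vn0.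
have := hol_deriv_bound r0 (hol_line hf u1) (lineM u1) (cderiv_line df).
rewrite scale0r addr0 => H.
by rewrite {1}vE linearZ/= cnM cn_vn mulrC ler_wpM2r// vn_ge0.
Qed.

Lemma holV_strong_maximum : (forall w, vn (w - z) < r -> cn (f w) <= cn (f z)) ->
  forall v, vn v <= r / 8 -> f (z + v) = f z.
Proof.
move=> fmax v vr; have [u u1 vE] := unit_vector v.
have := @strong_maximum R _ 0 r r0 (hol_line hf u1) _ ((vn v)%:C%C).
rewrite cn_vn add0r scale0r addr0 -vE; apply => // s; rewrite subr0 => sr.
by apply: fmax; exact: ball_line.
Qed.

End Estimates.

Lemma propagation_ball (r k M e : R) : 0 < k -> k <= r / 2 -> 0 < e ->
  exists2 d : R, 0 < d & forall f z, holV f z r ->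
    (forall w, vn (w - z) < r -> cn (f w) <= M) ->
    (forall w, vn (w - z) <= k -> cn (f w) <= d) ->
    forall w, vn (w - z) <= r / 2 -> cn (f w) <= e.
Proof.
move=> k0 kr e0; have [d d0 dP] := @propagation_disc R r k M e k0 kr e0.
exists d => // f z hf fM fd w wr; have [u u1 vE] := unit_vector (w - z).
have := dP _ 0 (hol_line hf u1) _ _ ((vn (w - z))%:C%C); rewrite subr0 cn_vn -vE.
rewrite [z + (w - z)]addrC subrK; apply => // s; rewrite subr0 => sr.
  by apply: fM; exact: ball_line.
by apply: fd; rewrite addrAC subrr add0r vnZ (le_trans _ sr)// ler_piMr// cn_ge0.
Qed.

(** The inequality [quad] holds with a constant independent of [i] and survives pointwise
    convergence, so the limit has a derivative with a quadratic Taylor bound along every line. These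
    derivatives are limits of ['d (F i) z], hence linear in the direction. *)
Lemma holV_limit (F : nat -> V -> C^o) f z (r M : R) : 0 < r ->
  (forall i, holV (F i) z r) ->
  (forall i w, vn (w - z) < r -> cn (F i w) <= M) ->
  (forall w, vn (w - z) < r -> forall e : R, 0 < e ->
     exists i0, forall i, (i0 <= i)%N -> cn (F i w - f w) <= e) ->
  differentiable f z /\ (forall v (e : R), 0 < e ->
     exists i0, forall i, (i0 <= i)%N -> cn ('d (F i) z v - 'd f z v) <= e).
Proof.
move=> r0 hF FM Ff; pose K := 64 * M / r ^+ 2.
have zz : vn (z - z) < r by rewrite subrr vn0.
have M0 : 0 <= M by rewrite (le_trans (cn_ge0 (F 0%N z)))// FM.
have K0 : 0 <= K by exact: divr_ge0 (mulr_ge0 (ler0n _ _) M0) (sqr_ge0 _).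
have lim u : vn u <= 1 -> exists2 l : C, (forall h : C, cn h <= r / 4 ->
      cn (f (z + h *: u) - f z - l * h) <= K * cn h ^+ 2) &
    forall e : R, 0 < e -> exists i0, forall i, (i0 <= i)%N -> cn ('d (F i) z u - l) <= e.
  move=> u1.
  have q : quad (fun s : C => f (z + s *: u) : C) 0 K (r / 4).
    apply: quad_limit => h k e hr kr e0.
    have hr' : cn h < r by lra.
    have kr' : cn k < r by lra.
    have [i1 i1P] := Ff _ zz e e0.
    have [i2 i2P] := Ff _ (ball_line z u1 hr') e e0.
    have [i3 i3P] := Ff _ (ball_line z u1 kr') e e0.
    pose i := maxn i1 (maxn i2 i3).
    exists (fun s : C => F i (z + s *: u) : C).
      apply: hol_quad => //; first exact: hol_line.
      by move=> s; rewrite subr0 => sr; apply: FM; exact: ball_line.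
    rewrite !add0r !scale0r !addr0; split.
    - by apply: i1P; rewrite leq_maxl.
    - by apply: i2P; rewrite /i maxnCA leq_maxl.
    - by apply: i3P; rewrite /i maxnA leq_maxr.
  have [l lP lK] := quad_cderiv (divr_gt0 r0 (ltr0Sn R 3)) K0 q.
  have lK' h : cn h <= r / 4 -> cn (f (z + h *: u) - f z - l * h) <= K * cn h ^+ 2.
    by move=> /lK; rewrite add0r scale0r addr0.
  exists l => // e e0.
  (* At this step length two Taylor errors and two pointwise errors cost at most [e * t / 4] each;
     division by [t] leaves [e]. *)
  pose t := Num.min (r / 4) (e / (4 * K + 4)).
  have t0 : 0 < t by rewrite lt_min !divr_gt0//; lra.
  have t1 : t <= r / 4 by rewrite ge_min lexx.
  have tK : K * t ^+ 2 <= e * t / 4.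
    have : t <= e / (4 * K + 4) by rewrite ge_min lexx orbT.
    rewrite ler_pdivlMr; last lra.
    move=> H; have : t * (t * (4 * K + 4)) <= t * e by rewrite ler_pM2l.
    have : 0 <= t * t by rewrite mulr_ge0// ltW.
    rewrite expr2; lra.
  have tE : cn (t%:C%C : C) = t by rewrite cn_real ger0_norm// ltW.
  have et0 : 0 < e * t / 4 by rewrite divr_gt0// mulr_gt0.
  have tr : cn (t%:C%C : C) < r by rewrite tE; lra.
  have [i1 i1P] := Ff _ zz _ et0.
  have [i2 i2P] := Ff _ (ball_line z u1 tr) _ et0.
  exists (maxn i1 i2) => i; rewrite geq_max => /andP[/i1P H1 /i2P H2].
  have H3 := lK' t%:C%C; rewrite tE in H3; have {}H3 := H3 t1.
  have tu : vn ((t%:C%C : C) *: u) <= t by rewrite vnZ tE ler_piMr// ltW.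
  have H4 := holV_taylor r0 (hF i) (FM i) (le_trans tu t1).
  have {}H4 : cn (F i (z + (t%:C%C : C) *: u) - F i z - 'd (F i) z (t%:C%C *: u)) <= K * t ^+ 2.
    by rewrite (le_trans H4)// ler_wpM2l// lerXn2r ?nnegrE ?vn_ge0// ltW.
  rewrite linearZ/= in H4.
  rewrite -(ler_pM2r t0) -[X in cn _ * X]tE -cnM.
  have -> : ('d (F i) z u - l) * t%:C%C =
    (F i (z + (t%:C%C : C) *: u) - f (z + (t%:C%C : C) *: u)) - (F i z - f z)
    - (F i (z + (t%:C%C : C) *: u) - F i z - t%:C%C * 'd (F i) z u)
    + (f (z + (t%:C%C : C) *: u) - f z - l * t%:C%C) by ring.
  rewrite (le_trans (cnD _ _))// (le_trans (lerD (cnB _ _) (lexx _)))//.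
  rewrite (le_trans (lerD (lerD (cnB _ _) (lexx _)) (lexx _)))//.
  lra.
have lim' v : exists2 l : C, (vn v <= r / 4 -> cn (f (z + v) - f z - l) <= K * vn v ^+ 2) &
    forall e : R, 0 < e -> exists i0, forall i, (i0 <= i)%N -> cn ('d (F i) z v - l) <= e.
  have [u u1 vE] := unit_vector v; have [l l1 l2] := lim u u1.
  exists (l * (vn v)%:C%C) => [vr|e e0].
    by have := l1 (vn v)%:C%C; rewrite cn_vn -vE; apply.
  have b0 : 0 < vn v + 1 by have := vn_ge0 v; lra.
  have [i0 i0P] := l2 (e / (vn v + 1)) (divr_gt0 e0 b0); exists i0 => i /i0P.
  rewrite ler_pdivlMr// {2}vE linearZ/= [_ *: _]mulrC -mulrBl cnM cn_vn; apply: le_trans.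
  by rewrite ler_wpM2l ?cn_ge0//; lra.
pose L0 v : C^o := projT1 (cid2 (lim' v)).
have L1 v : vn v <= r / 4 -> cn (f (z + v) - f z - L0 v) <= K * vn v ^+ 2.
  by rewrite /L0; case: cid2.
have L2 v : forall e : R, 0 < e -> exists i0, forall i, (i0 <= i)%N -> cn ('d (F i) z v - L0 v) <= e.
  by rewrite /L0; case: cid2.
have L0lin : linear L0.
  move=> a u v; apply/eqP; rewrite -subr_eq0 -cn_eq0; apply/eqP/le_anti.
  rewrite cn_ge0 andbT; apply/ler_addgt0Pr => e e0; rewrite add0r.
  pose b := cn a + 2; have b0 : 0 < b by rewrite /b; have := cn_ge0 a; lra.
  have eb := divr_gt0 e0 b0.
  have [i1 i1P] := L2 (a *: u + v) _ eb.
  have [i2 i2P] := L2 u _ eb.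
  have [i3 i3P] := L2 v _ eb.
  pose i := maxn i1 (maxn i2 i3).
  have h1 := i1P i ltac:(by rewrite leq_maxl).
  have h2 := i2P i ltac:(by rewrite /i maxnCA leq_maxl).
  have h3 := i3P i ltac:(by rewrite /i maxnA leq_maxr).
  have -> : L0 (a *: u + v) - (a *: L0 u + L0 v) =
     - ('d (F i) z (a *: u + v) - L0 (a *: u + v)) + a * ('d (F i) z u - L0 u) +
     ('d (F i) z v - L0 v).
    have alg (D A B E G : C) : D - (a * E + G) = - (a * A + B - D) + a * (A - E) + (B - G) by ring.
    have -> : 'd (F i) z (a *: u + v) = a * 'd (F i) z u + 'd (F i) z v by exact: linearP.
    exact: alg.
  rewrite (le_trans (cnD _ _))// (le_trans (lerD (cnD _ _) (lexx _)))// cnN cnM.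
  have h4 := ler_wpM2l (cn_ge0 a) h2.
  have : e / b * (cn a + 2) = e by rewrite -/b divfK// gt_eqF.
  move: h1 h3 h4; clear; set t := e / b; lra.
pose Lm := GRing.isLinear.Build _ _ _ _ L0 L0lin.
pose L : {linear V -> C^o} := HB.pack L0 Lm.
have LB v : vn (L v) <= 4 * M / r * vn v.
  rewrite vnCo; apply/ler_addgt0Pr => e e0; have [i0 /(_ i0 (leqnn _)) H] := L2 v e e0.
  have := cnB ('d (F i0) z v) ('d (F i0) z v - L0 v); rewrite opprB addrC subrK.
  have := holV_diff_bound r0 (hF i0) (FM i0) v.
  by move=> H1 /le_trans; apply; lra.
have [df dE] : differentiable f z /\ 'd f z = L :> (V -> C^o).
  apply: fderiv_differentiable; first exact: bounded_linear_continuous LB.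
  move=> e e0; exists (Num.min (r / 4) (e / (K + 1))).
    by rewrite lt_min !divr_gt0//; lra.
  move=> v; rewrite lt_min => /andP[vr]; rewrite ltr_pdivlMr; last lra.
  move=> ve; rewrite vnCo (le_trans (L1 _ (ltW vr)))// expr2 mulrA ler_wpM2r ?vn_ge0//.
  rewrite mulrC (le_trans _ (ltW ve))// ler_wpM2l ?vn_ge0//; lra.
split; first exact: df.
move=> v e e0.
have dv : 'd f z v = L0 v by have := congr1 (fun h : V -> C^o => h v) dE.
have key (l : C) : l = L0 v -> exists i0, forall i, (i0 <= i)%N -> cn ('d (F i) z v - l) <= e.
  by move=> ->; exact: L2.
exact: key dv.
Qed.

Lemma differentiable_bounded f z : differentiable f z ->
  exists2 d : R, 0 < d & forall w, vn (w - z) < d -> cn (f w) <= cn (f z) + 1.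
Proof.
move=> /differentiable_continuous/continuous_vn/(_ 1 ltr01)[d d0 dP].
exists d => // w /dP; rewrite vnCo => H.
by have := cnD (f w - f z) (f z); rewrite subrK; lra.
Qed.

(** The directional derivative is a pointwise limit of difference quotients, which the Lipschitz
    estimate bounds; so [holV_limit] applies. *)
Lemma holV_diff f z (r : R) v : 0 < r -> holV f z r ->
  differentiable (fun w => 'd f w v : C^o) z.
Proof.
move=> r0 hf.
have [d d0 dP] := differentiable_bounded (hf z ltac:(by rewrite subrr vn0)).
set M := _ + 1 in dP; pose s := Num.min r d.
have s0 : 0 < s by rewrite lt_min r0.
have sr : s <= r by rewrite ge_min lexx.
have sd : s <= d by rewrite ge_min lexx orbT.
have M0 : 0 <= M by rewrite /M; have := cn_ge0 (f z); lra.
pose t i := (s / 8) / (vn v + 1) / 2 ^+ i.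
have b0 : 0 < vn v + 1 by have := vn_ge0 v; lra.
have p2 i : (0 : R) < 2 ^+ i by rewrite exprn_gt0.
have t0 i : 0 < t i by rewrite !divr_gt0.
have tE i : cn ((t i)%:C%C : C) = t i by rewrite cn_real ger0_norm// ltW.
have tn0 i : ((t i)%:C%C : C) != 0 by rewrite -cn_gt0 tE.
have tb i : t i * (vn v + 1) <= s / 8.
  have -> : t i * (vn v + 1) = s / 8 / 2 ^+ i.
    by rewrite /t; field; rewrite !gt_eqF.
  by rewrite ler_pdivrMr// ler_peMr ?exprn_ege1//; lra.
have tv i : vn (((t i)%:C%C : C) *: v) <= s / 8.
  rewrite vnZ tE (le_trans _ (tb i))//; apply: ler_wpM2l; first exact: ltW.
  lra.
pose F i w : C^o := (f (w + ((t i)%:C%C : C) *: v) - f w) / (t i)%:C%C.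
have [] // := @holV_limit F (fun w => 'd f w v) z (s / 2) (16 * M / s * (vn v + 1)).
- by rewrite divr_gt0.
- move=> i w ws.
  have d1 : differentiable f w by apply: hf; lra.
  have d2 : differentiable f (w + ((t i)%:C%C : C) *: v).
    apply: hf; have := vnD (w - z) (((t i)%:C%C : C) *: v); rewrite addrAC.
    by have := tv i; lra.
  have d3 : differentiable (fun w => f (w + ((t i)%:C%C : C) *: v)) w.
    apply: (@differentiable_comp _ _ _ _ (fun w => w + ((t i)%:C%C : C) *: v) f) => //.
  exact: (differentiableM (differentiableB d3 d1) (differentiable_cst _ _)).
- move=> i w ws; rewrite /F cnM cnV tE ler_pdivrMr//.
  have hw : holV f w (s / 2) by apply: holV_sub hf _; lra.
  have wM u : vn (u - w) < s / 2 -> cn (f u) <= M.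
    by move=> uw; apply: dP; have := vnD (u - w) (w - z); rewrite addrA subrK; lra.
  have := holV_lipschitz (divr_gt0 s0 (ltr0Sn R 1)) hw wM (v := ((t i)%:C%C : C) *: v).
  have tvi := tv i.
  move=> /(_ ltac:(lra)) /le_trans; apply.
  rewrite vnZ tE; have -> : 4 * M / (s / 2) = 8 * M / s by field; exact: lt0r_neq0.
  have MS : 0 <= M / s by rewrite divr_ge0// ltW.
  have : 0 <= M / s * t i by exact: mulr_ge0 MS (ltW (t0 i)).
  have := vn_ge0 v => v0; have : 0 <= M / s * t i * vn v.
    exact: mulr_ge0 (mulr_ge0 MS (ltW (t0 i))) v0.
  lra.
move=> w ws e e0.
have df : differentiable f (w + (0 : C) *: v) by rewrite scale0r addr0; apply: hf; lra.
have [p p0 pP] := cderiv_quotient (cderiv_line df) e0.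
have [k kP] := pow2_large (s / 8 / (vn v + 1)) p0.
exists k => i ki; have := pP (t i)%:C%C (tn0 i); rewrite add0r scale0r addr0 tE; apply.
rewrite /t ltr_pdivrMr// (lt_le_trans kP)// ler_pM2l// ler_weXn2l//; lra.
Qed.

End Frechet.

(** * Generic linear combinations *)

Section GridChoice.
Variable R : realType.
Local Notation C := R[i].

(* Two grid values in a coordinate where [v] is at least 1 move the affine form
   by at least [1/Q], so every line of the grid in that direction has at most one bad point. *)
Lemma grid_bad_count (p Q : nat) (v : 'I_p -> C) (s : C) (i : 'I_p) : (0 < Q)%N ->
  1 <= cn (v i) ->
  (#|[set a : {ffun 'I_p -> 'I_Q} |
      (cn (s + \sum_i ((a i)%:R / Q%:R)%:C%C * v i) < (2 * Q%:R)^-1)%R]%SET| * Q <= Q ^ p)%N.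
Proof.
move=> Q0 v1; set S := (X in #|pred_of_set X|).
have Qp : (0 : R) < Q%:R by rewrite ltr0n.
(* Shifts the [i]-th coordinate cyclically. Injectivity on bad points times shifts says that the
   lines through bad points are distinct, which gives the count. *)
pose sh (x : {ffun 'I_p -> 'I_Q} * 'I_Q) : {ffun 'I_p -> 'I_Q} :=
  [ffun j => if j == i then Ordinal (ltn_pmod (x.1 j + x.2) Q0) else x.1 j].
have inj : {in finset.setX S [set: 'I_Q]%SET &, injective sh}.
  move=> [a c] [b d]; rewrite !inE/= !andbT => aS bS E.
  have off j : j != i -> a j = b j.
    by move=> ji; have := congr1 (fun f : {ffun _ -> _} => f j) E; rewrite !ffunE (negbTE ji).
  have ab : a i = b i.
    apply/eqP; apply: contraT => abi.
    have : cn ((a i)%:R / Q%:R - (b i)%:R / Q%:R)%:C%C * cn (v i) < Q%:R^-1.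
      rewrite -cnM.
      have -> : ((a i)%:R / Q%:R - (b i)%:R / Q%:R)%:C%C * v i =
         (s + \sum_i ((a i)%:R / Q%:R)%:C%C * v i) - (s + \sum_i ((b i)%:R / Q%:R)%:C%C * v i).
        pose rest := \sum_(j | j != i) ((b j)%:R / Q%:R)%:C%C * v j.
        have -> : \sum_i ((a i)%:R / Q%:R)%:C%C * v i = ((a i)%:R / Q%:R)%:C%C * v i + rest.
          by rewrite (bigD1 i)//=; congr (_ + _); apply: eq_bigr => j ji; rewrite off.
        have -> : \sum_i ((b i)%:R / Q%:R)%:C%C * v i = ((b i)%:R / Q%:R)%:C%C * v i + rest.
          by rewrite (bigD1 i).
        by rewrite realCD rmorphN; ring.
      rewrite (le_lt_trans (cnB _ _))//.
      have QE : (2 * Q%:R)^-1 + (2 * Q%:R)^-1 = Q%:R^-1 :> R.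
        by field; exact: lt0r_neq0.
      by rewrite -[ltRHS]QE; exact: ltrD.
    rewrite ltNge => /negP[]; rewrite -[leLHS]mulr1 ler_pM ?invr_ge0 ?(ltW Qp)//.
    rewrite cn_real -mulrBl normrM normfV [`|Q%:R|]ger0_norm ?(ltW Qp)// ler_pdivlMr ?mulVf ?gt_eqF//.
    wlog : a b abi {aS bS E off} / (a i < b i)%N => [H|lt].
      have [/H|/H|/val_inj/eqP] := ltngtP (a i) (b i); last by rewrite (negbTE abi).
        by apply.
      by rewrite distrC; apply; rewrite eq_sym.
    rewrite distrC ger0_norm ?subr_ge0 ?ler_nat ?(ltnW lt)//.
    by rewrite lerBrDl natr1 ler_nat.
  have {off}ab' : a = b by apply/ffunP => j; have [->//|/off] := eqVneq j i.
  congr (_, _) => //; have := congr1 (fun f : {ffun _ -> _} => f i) E.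
  rewrite !ffunE eqxx ab' /= => /(congr1 val)/= /eqP.
  rewrite eqn_modDl !modn_small// => /eqP; exact: val_inj.
have := card_in_imset inj; rewrite cardsX cardsT card_ord => <-.
by rewrite (leq_trans (max_card _))// card_ffun !card_ord.
Qed.

(** Double counting over all rows [a]: each [t] is bad for at most a fraction [1 / Q] of them. *)
Lemma grid_row (p Q : nat) (T : finType) (B : {set T}) (v : T -> 'I_p -> C) (s : T -> C) :
  (0 < Q)%N -> (forall t, exists i, 1 <= cn (v t i)) ->
  exists a : {ffun 'I_p -> 'I_Q},
    (#|[set t in B | (cn (s t + \sum_i ((a i)%:R / Q%:R)%:C%C * v t i) < (2 * Q%:R)^-1)%R]%SET| * Q <= #|B|)%N.
Proof.
move=> Q0 v1; apply: contrapT => N.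
pose bad (a : {ffun 'I_p -> 'I_Q}) t :=
  cn (s t + \sum_i ((a i)%:R / Q%:R)%:C%C * v t i) < (2 * Q%:R)^-1.
have lt a : (#|B| < #|[set t in B | bad a t]%SET| * Q)%N.
  by rewrite ltnNge; apply/negP => H; apply: N; exists a.
have : (\sum_(a : {ffun 'I_p -> 'I_Q}) #|[set t in B | bad a t]%SET| * Q <= Q ^ p * #|B|)%N.
  rewrite -big_distrl/=.
  have -> : (\sum_(a : {ffun 'I_p -> 'I_Q}) #|[set t in B | bad a t]%SET|)%N =
     (\sum_(t in B) #|[set a | bad a t]%SET|)%N.
    transitivity (\sum_(a : {ffun 'I_p -> 'I_Q}) \sum_(t in B | bad a t) 1)%N.
      by apply: eq_bigr => a _; rewrite sum1dep_card.
    rewrite (exchange_big_dep (mem B))/=; last by move=> a t _ /andP[].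
    by apply: eq_bigr => t tB; rewrite -sum1dep_card; apply: eq_bigl => a; rewrite tB.
  rewrite big_distrl/= mulnC -sum_nat_const; apply: leq_sum => t tB.
  by have [i vi] := v1 t; exact: grid_bad_count vi.
move=> H; have : (\sum_(a : {ffun 'I_p -> 'I_Q}) #|B|.+1 <= Q ^ p * #|B|)%N.
  by apply: leq_trans H; apply: leq_sum => a _; exact: lt.
rewrite sum_nat_const card_ffun !card_ord leq_pmul2l ?expn_gt0 ?Q0//.
by rewrite ltnn.
Qed.

(* The rows are chosen greedily: by [grid_bad_count] some row leaves at most a
   fraction [1 / Q] of the remaining [t] unserved. *)
Lemma grid_choice (m p Q : nat) (T : finType) (v : T -> 'I_p -> C) (s : T -> 'I_m -> C) :
  (0 < Q)%N -> (#|T| < Q ^ m)%N -> (forall t, exists i, 1 <= cn (v t i)) ->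
  exists a : 'I_m -> 'I_p -> R, (forall k i, 0 <= a k i <= 1) /\
    forall t, exists k, (2 * Q%:R)^-1 <= cn (s t k + \sum_i (a k i)%:C%C * v t i).
Proof.
move=> Q0 TQ v1.
have Qp : (0 : R) < Q%:R by rewrite ltr0n.
suff [a aP] : exists a : 'I_m -> {ffun 'I_p -> 'I_Q},
   (#|[set t | [forall k, (cn (s t k + \sum_i ((a k i)%:R / Q%:R)%:C%C * v t i) < (2 * Q%:R)^-1)%R]]%SET| * Q ^ m <= #|T|)%N.
  exists (fun k i => (a k i)%:R / Q%:R); split.
    by move=> k i; rewrite divr_ge0//= ler_pdivrMr// mul1r ler_nat ltnW.
  have E0 : [set t | [forall k, (cn (s t k + \sum_i ((a k i)%:R / Q%:R)%:C%C * v t i) < (2 * Q%:R)^-1)%R]]%SET = finset.set0.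
    apply/eqP; rewrite -cards_eq0; apply: contraTT TQ; rewrite -lt0n => c0.
    by rewrite -leqNgt (leq_trans _ aP)// leq_pmull.
  move=> t; have : t \notin finset.set0 by rewrite inE.
  rewrite -E0 inE negb_forall => /existsP[k]; rewrite -leNgt => ?; by exists k.
elim: m s {TQ} => [|m ih] s.
  exists (fun=> [ffun=> Ordinal Q0]); rewrite expn0 muln1 max_card//.
have [a aP] := ih (fun t k => s t (lift ord0 k)).
set B := (X in #|pred_of_set X|) in aP.
have [b bP] := @grid_row p Q T B v (fun t => s t ord0) Q0 v1.
exists (fun k => if unlift ord0 k is Some k' then a k' else b).
rewrite expnS mulnA (leq_trans _ aP)// leq_mul2r; apply/orP; right.
rewrite (leq_trans _ bP)// leq_mul2r; apply/orP; right.
apply: subset_leq_card; apply/fintype.subsetP => t; rewrite !inE => /forallP H.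
apply/andP; split; last by have := H ord0; rewrite unlift_none.
by apply/forallP => k; have := H (lift ord0 k); rewrite liftK.
Qed.

End GridChoice.

(** * Generic lower bounds by counting cells *)

Section Cells.
Variable R : realType.
Local Notation C := R[i].

Definition bounded_cells (T : Type) (d : nat) (cell : nat -> T -> nat) :=
  exists m, forall q x, (cell q x < m * q.+1 ^ d)%N.

(** Lipschitz continuity measured by cells instead of a metric, so that pieces of X, pairs of points
    and tangent vectors are treated alike. *)
Definition tame (T : Type) (L : set T) (cell : nat -> T -> nat) (h : T -> C) :=
  exists2 K : R, 0 <= K & forall q x y, (0 < q)%N -> L x -> L y ->
    cell q x = cell q y -> cn (h x - h y) * q%:R <= K.

Lemma tame_common (T : Type) (L : set T) cell (I : finType) (h : I -> T -> C) :
  (forall i, tame L cell (h i)) -> exists2 K : R, 0 <= K &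
   forall i q x y, (0 < q)%N -> L x -> L y -> cell q x = cell q y ->
     cn (h i x - h i y) * q%:R <= K.
Proof.
move=> hT; pose k i := projT1 (cid2 (hT i)).
have k0 i : 0 <= k i by rewrite /k; case: cid2.
exists (\sum_i k i); first by apply: sumr_ge0.
move=> i q x y q0 Lx Ly xy; rewrite (bigD1 i)//= (le_trans _ (_ : k i <= _))//.
  by move: xy; rewrite /k; case: cid2 => K ? H; exact: H.
by rewrite lerDl sumr_ge0.
Qed.

Lemma nat_above (x : R) : exists n : nat, x <= n%:R.
Proof.
exists (Num.Def.archi_bound `|x|); rewrite (le_trans (ler_norm x))// ltW//.
exact: archi_boundP.
Qed.

Lemma cn_sum (I : finType) (F : I -> C) : cn (\sum_i F i) <= \sum_i cn (F i).
Proof.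
elim/big_ind2 : _ => //; first by rewrite cn0.
by move=> x a y b xa yb; rewrite (le_trans (cnD _ _))// lerD.
Qed.

(* One representative per occupied cell reduces a bound on [L] to finitely many points. *)
Lemma cell_representatives (T : Type) (L : set T) (cell : T -> nat) (M : nat) x0 :
  L x0 -> (forall x, (cell x < M)%N) ->
  exists r : 'I_M -> T, (forall t, L (r t)) /\
    forall x, L x -> exists t, cell (r t) = cell x.
Proof.
move=> Lx0 cM.
have H (t : 'I_M) : exists y, L y /\ ((exists2 x, L x & cell x = t) -> cell y = t).
  have [[x Lx xt]|N] := pselect (exists2 x, L x & cell x = t); first by exists x.
  by exists x0.
exists (fun t => projT1 (cid (H t))); split=> [t|x Lx].
  by case: cid => y [].
exists (Ordinal (cM x)); case: cid => y [_ /= ->//].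
by exists x.
Qed.

(** At scale [c.+1 * Q] there are at most [m0 * c.+2 ^ d * Q ^ d] cells; the constant is smaller
    than [Q] by the choice of [Q], which costs one row beyond [d]. *)
Lemma cells_lt_grid (m0 c d m : nat) (Q := (m0 * c.+2 ^ d).+1) : (d < m)%N ->
  (m0 * (c.+1 * Q).+1 ^ d < Q ^ m)%N.
Proof.
move=> dm; have H : ((c.+1 * Q).+1 <= c.+2 * Q)%N.
  by rewrite [(c.+2 * _)%N]mulSn addnC -addn1 leq_add2l.
apply: (@leq_ltn_trans (m0 * c.+2 ^ d * Q ^ d)%N).
  by rewrite -mulnA leq_mul2l -expnMn; apply/orP; right; case: (d) => // ?; rewrite leq_exp2r.
apply: (@leq_trans (Q * Q ^ d)%N); first by rewrite ltn_pmul2r ?expn_gt0.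
by rewrite -expnS leq_pexp2l.
Qed.

(** At one representative per cell [grid_choice] gives a row of modulus at least [1 / (2 Q)]. The
    scale [q] is such a multiple of [Q] that moving inside a cell costs at most half of this.
    Dividing [s] by [tau] beforehand makes the coefficients at most [tau]. *)
Lemma generic_matrix (T : Type) (L : set T) d cell (m p : nat)
    (v : 'I_p -> T -> C) (s : 'I_m -> T -> C) (tau : R) :
  0 < tau -> (d < m)%N -> bounded_cells d cell ->
  (forall i, tame L cell (v i)) -> (forall k, tame L cell (s k)) ->
  (forall x, L x -> exists i, 1 <= cn (v i x)) ->
  exists (A : 'I_m -> 'I_p -> C) (eta : R), [/\ 0 < eta, forall k i, cn (A k i) <= tau &
    forall x, L x -> exists k, eta <= cn (s k x + \sum_i A k i * v i x)].
Proof.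
move=> tau0 dm [m0 cellm] vt st v1.
have [[x0 Lx0]|N] := pselect (exists x, L x); last first.
  exists (fun _ _ => 0), 1; split=> // [k i|x Lx]; first by rewrite cn0 ltW.
  by exfalso; apply: N; exists x.
have [Kv Kv0 KvP] := tame_common vt; have [Ks Ks0 KsP] := tame_common st.
have [c cP] := nat_above (4 * (Ks / tau + p%:R * Kv)).
pose Q := (m0 * c.+2 ^ d).+1; pose q := (c.+1 * Q)%N.
have Q0 : (0 < Q)%N by []; have q0 : (0 < q)%N by rewrite muln_gt0.
have Qp : (0 : R) < Q%:R by rewrite ltr0n.
have qp : (0 : R) < q%:R by rewrite ltr0n.
have cnt : (m0 * q.+1 ^ d < Q ^ m)%N.
  exact: cells_lt_grid.
have [r [rL rP]] := cell_representatives Lx0 (cellm q).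
have [||a [a01 aP]] := @grid_choice R m p Q _ (fun t i => v i (r t))
    (fun t k => s k (r t) / tau%:C%C) Q0.
- by rewrite card_ord.
- by move=> t; exact: v1.
have tauC : (tau%:C%C : C) != 0 by rewrite -cn_eq0 cn_real normr_eq0 gt_eqF.
exists (fun k i => tau%:C%C * (a k i)%:C%C), (tau / (4 * Q%:R)); split.
- by rewrite divr_gt0// mulr_gt0.
- move=> k i; have /andP[? ?] := a01 k i.
  by rewrite cnM !cn_real !ger0_norm ?(ltW tau0)// ler_piMr// ltW.
move=> x Lx; have [t tx] := rP x Lx; have [k kP] := aP t; exists k.
set y := r t in tx kP; have Ly : L y by exact: rL.
pose S z := s k z / tau%:C%C + \sum_i (a k i)%:C%C * v i z.
have SE z : s k z + \sum_i tau%:C%C * (a k i)%:C%C * v i z = tau%:C%C * S z.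
  rewrite /S mulrDr mulrCA divff// mulr1; congr (_ + _).
  by rewrite mulr_sumr; apply: eq_bigr => i _; rewrite mulrA.
rewrite SE cnM cn_real ger0_norm ?(ltW tau0)// ler_pM2l//.
have D : cn (S x - S y) * q%:R <= Ks / tau + p%:R * Kv.
  have -> : S x - S y = (s k x - s k y) / tau%:C%C + \sum_i (a k i)%:C%C * (v i x - v i y).
    have -> : \sum_i (a k i)%:C%C * (v i x - v i y) =
       \sum_i (a k i)%:C%C * v i x - \sum_i (a k i)%:C%C * v i y.
      by rewrite -sumrB; apply: eq_bigr => i _; rewrite mulrBr.
    by rewrite /S; ring.
  rewrite (le_trans (ler_wpM2r _ (cnD _ _)))// ?(ltW qp)// mulrDl lerD//.
    rewrite cnM cnV cn_real ger0_norm ?(ltW tau0)// mulrAC ler_wpM2r ?invr_ge0 ?(ltW tau0)//.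
    exact: KsP.
  rewrite (le_trans (ler_wpM2r _ (cn_sum _)))// ?(ltW qp)// mulr_suml.
  rewrite -[p in leRHS]card_ord -sum1_card natr_sum mulr_suml; apply: ler_sum => i _.
  rewrite mul1r cnM cn_real; have /andP[a0 a1] := a01 k i; rewrite ger0_norm// -mulrA.
  by rewrite (le_trans _ (KvP i q x y q0 Lx Ly (esym tx)))// ler_piMl// mulr_ge0 ?cn_ge0.
have D' : cn (S x - S y) <= (4 * Q%:R)^-1.
  rewrite -(ler_pM2r qp) (le_trans D)// /q natrM -[leLHS]mulr1 -(ler_pM2l (x := 4))//.
  rewrite mulr1 (le_trans cP)//.
  have -> : 4 * ((4 * Q%:R)^-1 * (c.+1%:R * Q%:R)) = c.+1%:R :> R.
    by field; exact: lt0r_neq0.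
  by rewrite ler_nat.
have := cnD (S x) (S y - S x); rewrite addrC subrK [cn (S y - S x)]cnC.
have H1 : (2 * Q%:R)^-1 <= cn (S y) by exact: kP.
have H2 : (2 * Q%:R)^-1 = (4 * Q%:R)^-1 + (4 * Q%:R)^-1 :> R.
  by field; exact: lt0r_neq0.
lra.
Qed.

(** Bernoulli's inequality for [sqrt rho], squared, gives growth of order [P^2]. *)
Lemma geometric_growth (rho B : R) : 1 < rho ->
  exists P0, forall P, (P0 <= P)%N -> B * P%:R <= rho ^+ P.
Proof.
move=> rho1; pose sg := Num.sqrt rho; pose y := sg - 1.
have rhoE : rho = sg ^+ 2 by rewrite sqr_sqrtr//; lra.
have y0 : 0 < y by rewrite subr_gt0 -sqrtr1 ltr_sqrt//; lra.
have bern n : 1 + n%:R * y <= sg ^+ n.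
  elim: n => [|n ih]; first by rewrite mul0r addr0 expr0.
  rewrite exprS; have -> : sg = 1 + y by rewrite /y; ring.
  have H : (1 + y) * (1 + n%:R * y) <= (1 + y) * (1 + y) ^+ n.
    by rewrite ler_wpM2l//; [lra|have -> : 1 + y = sg by rewrite /y; ring].
  apply: le_trans H; rewrite -natr1; have : 0 <= n%:R * (y * y).
    by rewrite mulr_ge0// mulr_ge0// ltW.
  have := ler0n R n; lra.
have [P0 P0P] := nat_above (B / y ^+ 2); exists P0 => P PP.
rewrite rhoE -exprM mulnC exprM.
have H1 : P%:R * y <= sg ^+ P by rewrite (le_trans _ (bern P))//; lra.
apply: (@le_trans _ _ ((P%:R * y) ^+ 2)); last first.
  by rewrite lerXn2r ?nnegrE// ?exprn_ge0// ?sqrtr_ge0// mulr_ge0// ltW.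
have -> : (P%:R * y) ^+ 2 = P%:R * y ^+ 2 * P%:R by ring.
by rewrite ler_wpM2r// -ler_pdivrMr ?exprn_gt0// (le_trans P0P)// ler_nat.
Qed.

Lemma cnXB (a b : C) (W : R) n : cn a <= W -> cn b <= W ->
  cn (a ^+ n - b ^+ n) <= n%:R * cn (a - b) * W ^+ n.-1.
Proof.
move=> aW bW; case: n => [|n]; first by rewrite !expr0 subrr cn0 !mul0r.
rewrite subrXX cnM -mulrA mulrCA ler_wpM2l ?cn_ge0//= (le_trans (cn_sum _))//.
have -> : n.+1%:R * W ^+ n = \sum_(i < n.+1) W ^+ n.
  by rewrite sumr_const card_ord mulr_natl.
apply: ler_sum => i _; rewrite cnM !cnX.
have -> : W ^+ n = W ^+ (n.+1.-1 - i) * W ^+ i.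
  by rewrite -exprD subnK//= -ltnS.
by rewrite ler_pM ?exprn_ge0 ?cn_ge0// lerXn2r ?nnegrE ?cn_ge0// (le_trans _ aW) ?cn_ge0.
Qed.

(** Divided by the P-th power of [ga x], the largest modulus among the [g i x], the family
    [g i x ^+ P] has an entry of modulus 1, so [grid_choice] yields a combination of size at least
    [ga ^+ P / (2 P)] at the representatives. Half of it survives inside the cells, and
    [rho ^+ P / (4 P)] eventually exceeds [|B|] plus the variation of [f]. *)
Lemma large_combination (T : Type) (L : set T) d cell (m p N0 : nat)
    (g : 'I_p -> T -> C) (f : 'I_m -> T -> C) (rho B : R) :
  1 < rho -> (d.*2 < m)%N -> bounded_cells d cell ->
  (forall i, tame L cell (g i)) -> (forall k, tame L cell (f k)) ->
  (forall x, L x -> exists i, rho <= cn (g i x)) ->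
  exists (P : nat) (A : 'I_m -> 'I_p -> R), [/\ (N0 <= P)%N, forall k i, 0 <= A k i <= 1 &
    forall x, L x -> exists k, B <= cn (f k x + \sum_i (A k i)%:C%C * g i x ^+ P)].
Proof.
move=> rho1 dm [m0 cellm] gt ft g1.
have [[x0 Lx0]|N] := pselect (exists x, L x); last first.
  exists N0, (fun _ _ => 0); split=> // [k i|x Lx]; first by rewrite lexx ler01.
  by exfalso; apply: N; exists x.
have [Kg Kg0 KgP] := tame_common gt; have [Kf Kf0 KfP] := tame_common ft.
pose e0 : R := expR 1.
have e00 : 0 < e0 by exact: expR_gt0.
have [c cP] := nat_above (4 * p%:R * Kg * e0 + Kg).
have [P0 P0P] := geometric_growth (4 * (`|B| + Kf)) rho1.
(* [P] is both the exponent and the number of grid values. A P-th power varies on a cell by a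
   relative amount of order [P / q], which has to stay below the gain [1 / P] of the grid; hence [q]
   of order [P ^ 2] and the hypothesis [d.*2 < m]. *)
pose P := (N0 + P0 + m0 * c.+2 ^ d).+1; pose q := (c.+1 * P ^ 2)%N.
have PP : (P0 <= P)%N by rewrite /P -addnS; lia.
have NP : (N0 <= P)%N by rewrite /P; lia.
have Pp : (0 : R) < P%:R by rewrite ltr0n.
have q0 : (0 < q)%N by rewrite muln_gt0 expn_gt0.
have qp : (0 : R) < q%:R by rewrite ltr0n.
have cnt : (m0 * q.+1 ^ d < P ^ m)%N.
  have H : (q.+1 <= c.+2 * P ^ 2)%N.
    by rewrite /q [(c.+2 * _)%N]mulSn addnC -addn1 leq_add2l expn_gt0.
  apply: (@leq_ltn_trans (m0 * c.+2 ^ d * P ^ (d.*2))%N).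
    rewrite -mulnA leq_mul2l; apply/orP; right.
    by rewrite -mul2n expnM -expnMn; case: (d) => // ?; rewrite leq_exp2r.
  apply: (@leq_trans (P * P ^ d.*2)%N); first by rewrite ltn_pmul2r ?expn_gt0// /P ltnS leq_addl.
  by rewrite -expnS leq_pexp2l.
have [r [rL rP]] := cell_representatives Lx0 (cellm q).
pose ga x := \big[Num.max/0]_i cn (g i x).
have ga_ge x i : cn (g i x) <= ga x by rewrite /ga (bigmaxD1 i)//= le_max lexx.
have ga_ex x : L x -> exists i, cn (g i x) = ga x.
  move=> Lx; have [i0 gi0] := g1 x Lx.
  have [i _ gaE] := @eq_bigmax _ _ _ 0 i0 xpredT (fun i => cn (g i x)) isT (fun i _ => cn_ge0 (g i x)).
  by exists i.
have ga1 x : L x -> rho <= ga x.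
  by move=> /[dup] Lx /g1[i gi]; exact: le_trans gi (ga_ge x i).
have gap x : L x -> 0 < ga x by move=> /ga1; lra.
have gaC x : L x -> ((ga x)%:C%C : C) != 0.
  by move=> /gap ?; rewrite -cn_eq0 cn_real normr_eq0 gt_eqF.
have P0' : (0 < P)%N by [].
have [||A [A01 AP]] := @grid_choice R m p P _ (fun t i => g i (r t) ^+ P / (ga (r t))%:C%C ^+ P)
    (fun t k => f k (r t) / (ga (r t))%:C%C ^+ P) P0'.
- by rewrite card_ord.
- move=> t; have [i gi] := ga_ex _ (rL t); exists i.
  rewrite -expr_div_n cnX cnM cnV cn_real ger0_norm ?(ltW (gap _ (rL t)))// gi.
  by rewrite divff ?expr1n// gt_eqF// gap.
exists P, A; split=> // x Lx; have [t tx] := rP x Lx; have [k kP] := AP t; exists k.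
set y := r t in tx kP; have Ly : L y by exact: rL.
pose S z := f k z + \sum_i (A k i)%:C%C * g i z ^+ P.
have gaPp : 0 < ga y ^+ P by rewrite exprn_gt0// gap.
have Sy : ga y ^+ P / (2 * P%:R) <= cn (S y).
  have E : S y = (f k y / (ga y)%:C%C ^+ P + \sum_i (A k i)%:C%C * (g i y ^+ P / (ga y)%:C%C ^+ P)) * (ga y)%:C%C ^+ P.
    rewrite /S mulrDl divfK ?expf_neq0 ?gaC// mulr_suml; congr (_ + _).
    by apply: eq_bigr => i _; rewrite mulrA divfK// expf_neq0// gaC.
  rewrite E cnM cnX cn_real ger0_norm ?(ltW (gap _ Ly))// mulrC ler_pM2r//.
have D (h : T -> C) K : cn (h x - h y) * q%:R <= K -> cn (h x - h y) <= K / q%:R.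
  by rewrite ler_pdivlMr.
have qP : c.+1%:R * P%:R ^+ 2 = q%:R :> R by rewrite /q natrM natrX.
have c0 : (0 : R) < c.+1%:R by [].
have cc : 4 * p%:R * Kg * e0 + Kg <= c.+1%:R by rewrite (le_trans cP)// ler_nat.
have pKe : 0 <= 4 * p%:R * Kg * e0 by rewrite !mulr_ge0// ltW.
have KgP' : Kg / q%:R <= P%:R^-1.
  rewrite ler_pdivrMr// -qP.
  have -> : P%:R^-1 * (c.+1%:R * P%:R ^+ 2) = c.+1%:R * P%:R :> R by field; exact: lt0r_neq0.
  have : c.+1%:R * 1 <= c.+1%:R * P%:R :> R by rewrite ler_pM2l// ler1n.
  lra.
have Dg i : cn (g i x ^+ P - g i y ^+ P) <= P%:R * (Kg / q%:R) * (e0 * ga y ^+ P).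
  have Di := D _ _ (KgP i q x y q0 Lx Ly (esym tx)).
  (* Bounds all [g i] at both points, since they vary by at most [1 / P] and [ga y >= 1]; its P-th
     power is at most [e0 * ga y ^+ P]. *)
  pose W := ga y * (1 + P%:R^-1).
  have ga_y1 : 1 <= ga y by have := ga1 _ Ly; lra.
  have P1 : (0 : R) < P%:R^-1 by rewrite invr_gt0.
  have gyW : cn (g i y) <= W.
    by rewrite (le_trans (ga_ge y i))// /W ler_peMr; lra.
  have gxW : cn (g i x) <= W.
    have := cnD (g i x - g i y) (g i y); rewrite subrK => /le_trans; apply.
    have h1 : P%:R^-1 <= ga y * P%:R^-1 by rewrite ler_peMl// ltW.
    by have := ga_ge y i; rewrite /W; lra.
  rewrite (le_trans (cnXB P gxW gyW))//.
  apply: ler_pM; first by rewrite mulr_ge0// cn_ge0.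
  - by rewrite exprn_ge0// (le_trans _ gyW)// cn_ge0.
  - by rewrite ler_wpM2l.
  have W1 : 1 <= W by rewrite /W -[leLHS]mulr1 ler_pM//; lra.
  rewrite (@le_trans _ _ (W ^+ P))//; first by rewrite ler_weXn2l// leq_pred.
  rewrite /W exprMn mulrC ler_pM2r//.
  have -> : e0 = expR P%:R^-1 ^+ P.
    by rewrite -expRM_natl divff// gt_eqF.
  have h1 := @expR_ge1Dx R P%:R^-1.
  by apply: lerXn2r; rewrite ?nnegrE ?expR_ge0//; lra.
have Dsum : cn (S x - S y) <= Kf + ga y ^+ P / (4 * P%:R).
  have -> : S x - S y = (f k x - f k y) + \sum_i (A k i)%:C%C * (g i x ^+ P - g i y ^+ P).
    have -> : \sum_i (A k i)%:C%C * (g i x ^+ P - g i y ^+ P) =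
       \sum_i (A k i)%:C%C * g i x ^+ P - \sum_i (A k i)%:C%C * g i y ^+ P.
      by rewrite -sumrB; apply: eq_bigr => i _; rewrite mulrBr.
    by rewrite /S; ring.
  rewrite (le_trans (cnD _ _))// lerD//.
    rewrite (le_trans (D _ _ (KfP k q x y q0 Lx Ly (esym tx))))// ler_pdivrMr//.
    by rewrite ler_peMr// ler1n.
  rewrite (le_trans (cn_sum _))//.
  apply: (@le_trans _ _ (\sum_(i < p) P%:R * (Kg / q%:R) * (e0 * ga y ^+ P))).
    apply: ler_sum => i _; rewrite cnM cn_real; have /andP[a0 a1] := A01 k i.
    by rewrite ger0_norm// (le_trans _ (Dg i))// ler_piMl// cn_ge0.
  rewrite sumr_const card_ord -[_ *+ p]mulr_natl.
  have -> : p%:R * (P%:R * (Kg / q%:R) * (e0 * ga y ^+ P)) =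
     (p%:R * Kg * e0) * (P%:R / q%:R) * ga y ^+ P by ring.
  rewrite [leRHS]mulrC ler_pM2r// -qP.
  have -> : P%:R / (c.+1%:R * P%:R ^+ 2) = (c.+1%:R * P%:R)^-1 :> R.
    by rewrite expr2 mulrA [(_ * _)^-1]invfM mulrCA divff ?mulr1// gt_eqF.
  rewrite ler_pdivrMr ?mulr_gt0//.
  have -> : (4 * P%:R)^-1 * (c.+1%:R * P%:R) = c.+1%:R / 4 :> R.
    by field; exact: lt0r_neq0.
  rewrite ler_pdivlMr//; lra.
have big : 4 * (`|B| + Kf) * P%:R <= ga y ^+ P.
  rewrite (le_trans (P0P _ PP))// lerXn2r ?nnegrE//; [lra| |exact: ga1].
  exact: ltW (gap _ Ly).
have big' : `|B| + Kf <= ga y ^+ P / (4 * P%:R).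
  by rewrite ler_pdivlMr ?mulr_gt0//; lra.
have := cnD (S x) (S y - S x); rewrite addrC subrK [cn (S y - S x)]cnC.
have H2 : ga y ^+ P / (2 * P%:R) = ga y ^+ P / (4 * P%:R) + ga y ^+ P / (4 * P%:R).
  by field; exact: lt0r_neq0.
have := ler_norm B; rewrite -/(S x); lra.
Qed.

End Cells.

(** * Cells and compact balls in C^n *)

Section RowVectors.
Variable R : realType.
Local Notation C := R[i].

Lemma cn_coord n (v : 'rV[C]_n) i : cn (v 0 i) <= vn v.
Proof.
rewrite -lecR -normE -normrcE -[`|v|]/(mx_norm v) mx_normE.
have H := le_bigmax 0%:nng (fun j : 'I_1 * 'I_n => `|v j.1 j.2|%:nng) (0, i).
exact: H.
Qed.

Lemma vn_rV_le n (v : 'rV[C]_n) (r : R) : 0 <= r ->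
  (forall i, cn (v 0 i) <= r) -> vn v <= r.
Proof.
move=> r0 H; have [v0|v0] := eqVneq v 0; first by rewrite v0 vn0.
have [[a i] vE] : exists i, mx_norm v = `|v i.1 i.2|.
  by apply: mx_norm_neq0; rewrite -[mx_norm v]/(`|v|) normr_eq0.
rewrite -lecR -normE -[`|v|]/(mx_norm v) vE normrcE lecR /= ord1; exact: H.
Qed.

(** Each of the 2n real coordinates, rescaled to [[0, q]], is truncated to an integer. The end point
    [q] is attained, so a coordinate takes [q.+1] values; this is the origin of [q.+1] in
    [bounded_cells]. *)
Lemma cells_ball n (z : 'rV[C]_n) (r : R) : 0 < r ->
  exists cell : nat -> 'rV[C]_n -> nat, bounded_cells (n * 2) cell /\
    exists2 K : R, 0 <= K & forall q x y, (0 < q)%N -> vn (x - z) <= r -> vn (y - z) <= r ->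
      cell q x = cell q y -> vn (x - y) * q%:R <= K.
Proof.
move=> r0; pose co (x : 'rV[C]_n) (p : 'I_n * bool) : R :=
  if p.2 then complex.Re (x 0 p.1 - z 0 p.1) else complex.Im (x 0 p.1 - z 0 p.1).
pose dg q x p : nat := Num.truncn ((co x p / r + 1) / 2 * q%:R).
pose f q x := [ffun p => inord (dg q x p)] : {ffun 'I_n * bool -> 'I_q.+1}.
exists (fun q x => nat_of_ord (enum_rank (f q x))); split.
  exists 1%N => q x; rewrite mul1n (leq_trans (ltn_ord _))//.
  by rewrite card_ffun card_prod !card_ord card_bool.
exists (4 * r) => [|q x y q0 xr yr E]; first by rewrite mulr_ge0// ltW.
have qp : (0 : R) < q%:R by rewrite ltr0n.
have {}E : f q x = f q y by apply: enum_rank_inj; exact: val_inj.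
have coP (w : 'rV[C]_n) p : vn (w - z) <= r -> 0 <= (co w p / r + 1) / 2 * q%:R <= q%:R.
  move=> wr; have : `|co w p| <= r.
    rewrite /co; case: ifP => _; rewrite (le_trans _ wr)//.
      by rewrite (le_trans (ler_Re_cn _))//; have := cn_coord (w - z) p.1; rewrite !mxE.
    by rewrite (le_trans (ler_Im_cn _))//; have := cn_coord (w - z) p.1; rewrite !mxE.
  rewrite ler_norml => /andP[h1 h2].
  have h3 : -1 <= co w p / r <= 1.
    by rewrite ler_pdivlMr// ler_pdivrMr// mulN1r mul1r h1.
  rewrite mulr_ge0 ?(ltW qp)//=; last by rewrite divr_ge0//; lra.
  by rewrite ler_piMl ?(ltW qp)//; lra.
have dgE p : dg q x p = dg q y p.
  have := congr1 (fun h : {ffun _ -> _} => val (h p)) E; rewrite !ffunE /= !inordK//.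
    have /andP[a b] := coP y p yr; rewrite ltnS /dg -(ler_nat R).
    by rewrite (le_trans _ b)// truncn_le.
  have /andP[a b] := coP x p xr; rewrite ltnS /dg -(ler_nat R).
  by rewrite (le_trans _ b)// truncn_le.
have coE p : `|co x p - co y p| * q%:R <= 2 * r.
  have /andP[xa _] := coP x p xr; have /andP[ya _] := coP y p yr.
  have /andP[x1 x2] := truncn_itv xa; have /andP[y1 y2] := truncn_itv ya.
  rewrite -/(dg q x p) in x1 x2; rewrite -/(dg q y p) -(dgE p) in y1 y2.
  rewrite -[(dg q x p).+1%:R]natr1 in x2 y2.
  have : `|(co x p / r + 1) / 2 * q%:R - (co y p / r + 1) / 2 * q%:R| <= 1.
    have absd (a b d : R) : d <= a -> a < d + 1 -> d <= b -> b < d + 1 -> `|a - b| <= 1.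
      by move=> *; rewrite ler_norml; apply/andP; split; lra.
    exact: absd x1 x2 y1 y2.
  have -> : (co x p / r + 1) / 2 * q%:R - (co y p / r + 1) / 2 * q%:R =
     ((co x p - co y p) * q%:R) / (2 * r) by field; exact: lt0r_neq0.
  rewrite normrM normfV [`|2 * r|]ger0_norm ?mulr_ge0 ?(ltW r0)// ler_pdivrMr ?mulr_gt0// mul1r.
  by rewrite normrM [`|q%:R|]ger0_norm// ltW.
rewrite -ler_pdivlMr//; apply: vn_rV_le; first by rewrite divr_ge0 ?mulr_ge0// ltW.
move=> i; rewrite ler_pdivlMr// (le_trans (ler_wpM2r (ltW qp) (ler_cn_ReIm _)))// mulrDl.
have h1 := coE (i, true); have h2 := coE (i, false); rewrite /co/= in h1 h2.
rewrite -ReN -ReD in h1; rewrite -ImN -ImD in h2.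
rewrite (_ : x 0 i - z 0 i - (y 0 i - z 0 i) = (x - y) 0 i) in h1 h2; last first.
  by rewrite !mxE; ring.
lra.
Qed.

Lemma compact_vball n (z : Cspace R n) (r : R) :
  compact ([set v | vn (v - z) <= r] : set (Cspace R n)).
Proof.
have [r0|r0] := leP 0 r; last first.
  rewrite (_ : [set _ | _] = set0); first exact: compact0.
  by apply/seteqP; split=> v //=; have := vn_ge0 (v - z); lra.
have := @rV_compact (C^o) n (fun i => [set w | cn (w - (z : 'rV[C]_n) 0 i) <= r])
  (fun i => @compact_cdisc R ((z : 'rV[C]_n) 0 i) r).
congr (compact _); apply/seteqP; split=> v /= H.
  by apply: vn_rV_le => // i; rewrite !mxE; exact: H.
by move=> i; rewrite (le_trans _ H)//; have := cn_coord (v - z) i; rewrite !mxE.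
Qed.

End RowVectors.

(** * Products and finite unions of cell systems *)

Section CellSystems.
Variable R : realType.
Local Notation C := R[i].

Lemma bounded_cells_comp (T U : Type) d (cell : nat -> T -> nat) (g : U -> T) :
  bounded_cells d cell -> bounded_cells d (fun q u => cell q (g u)).
Proof. by move=> [m mP]; exists m. Qed.

Lemma cells_pair (T U : Type) d e (c1 : nat -> T -> nat) (c2 : nat -> U -> nat) :
  bounded_cells d c1 -> bounded_cells e c2 ->
  exists c : nat -> T * U -> nat, bounded_cells (d + e) c /\
    forall q x y, c q x = c q y -> c1 q x.1 = c1 q y.1 /\ c2 q x.2 = c2 q y.2.
Proof.
move=> [m mP] [k kP].
have e1 q x : (c2 q x < k * q.+1 ^ e)%N by [].
exists (fun q x => c1 q x.1 * (k * q.+1 ^ e) + c2 q x.2)%N; split.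
  exists (m * k)%N => q x.
  have := mP q x.1; have := kP q x.2; set A := (k * _)%N; set B := (m * _)%N => h1 h2.
  rewrite (_ : m * k * q.+1 ^ (d + e) = B * A)%N; last by rewrite expnD /A /B; lia.
  by apply: (@leq_trans (c1 q x.1 * A + A)%N); [rewrite ltn_add2l|rewrite -mulSnr leq_mul2r h2 orbT].
move=> q x y; set D := (k * q.+1 ^ e)%N => E.
have D0 : (0 < D)%N by exact: leq_ltn_trans (leq0n _) (e1 q x.2).
have h1 : (c2 q x.2 < D)%N by exact: e1.
have h2 : (c2 q y.2 < D)%N by exact: e1.
split.
  by move: (congr1 (divn^~ D) E); rewrite /= !divnMDl// !divn_small// !addn0.
by move: (congr1 (modn^~ D) E); rewrite /= !modnMDl !modn_small.
Qed.

(** One cell system serves all functions of [H]; only the constant in [tame] depends on the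
    function. *)
Definition cell_tame (T : Type) (L : set T) d (H : set (T -> C)) :=
  exists cell, bounded_cells d cell /\ forall h, H h -> tame L cell h.

Lemma cell_tame_union (T : Type) (L1 L2 : set T) d H :
  cell_tame L1 d H -> cell_tame L2 d H -> cell_tame (L1 `|` L2) d H.
Proof.
move=> [c1 [[m1 b1] t1]] [c2 [[m2 b2] t2]].
exists (fun q x => if `[< L1 x >] then c1 q x else m1 * q.+1 ^ d + c2 q x)%N; split.
  exists (m1 + m2)%N => q x; rewrite mulnDl; case: asboolP => _.
    by rewrite (leq_trans (b1 q x))// leq_addr.
  by rewrite ltn_add2l.
move=> h Hh; have [K1 K10 P1] := t1 h Hh; have [K2 K20 P2] := t2 h Hh.
exists (K1 + K2); first by rewrite addr_ge0.
move=> q x y q0 Lx Ly; case: (asboolP (L1 x)) => xL; case: (asboolP (L1 y)) => yL E.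
- by rewrite (le_trans (P1 q x y q0 xL yL E))// lerDl.
- by have := b1 q x; rewrite E ltnNge leq_addr.
- by have := b1 q y; rewrite -E ltnNge leq_addr.
case: Lx => // Lx; case: Ly => // Ly.
by rewrite (le_trans (P2 q x y q0 Lx Ly (addnI E)))// lerDr.
Qed.

Lemma cell_tame_sub (T : Type) (L1 L2 : set T) d H :
  L1 `<=` L2 -> cell_tame L2 d H -> cell_tame L1 d H.
Proof.
move=> L12 [c [b t]]; exists c; split=> // h /t[K K0 P]; exists K => // q x y q0 /L12 ? /L12.
exact: P.
Qed.

Lemma cell_tame0 (T : Type) d H : @cell_tame T set0 d H.
Proof.
by exists (fun _ _ => 0%N); split=> [|h _]; [exists 1%N => q x; rewrite mul1n expn_gt0|exists 0].
Qed.

Lemma cell_tame_bigunion (T : Type) (I : eqType) (s : seq I) (L : I -> set T) d H :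
  (forall i, i \in s -> cell_tame (L i) d H) ->
  cell_tame [set x | exists2 i, i \in s & L i x] d H.
Proof.
elim: s => [|i s ih] HL.
  by apply: (cell_tame_sub _ (@cell_tame0 T d H)) => x [].
apply: (cell_tame_sub _ (cell_tame_union (HL i (mem_head _ _)) (ih _))).
  by move=> x [j]; rewrite inE => /predU1P[->|js] jx; [left|right; exists j].
by move=> j js; apply: HL; rewrite inE js orbT.
Qed.

End CellSystems.

(** * Holomorphic functions on Stein manifolds *)

Section ChartBasics.
Variables (K : numFieldType) (X : topologicalType) (n : nat) (c : chart K X n).

Lemma cinv_img v : (cmap c @` cdom c) v -> cdom c (cinv c v) /\ cmap c (cinv c v) = v.
Proof. by move=> [x cx <-]; rewrite cmapK. Qed.

Lemma cinv_cont v : (cmap c @` cdom c) v -> {for v, continuous (cinv c)}.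
Proof. by move=> [x cx <-]; exact: cinv_continuous. Qed.

Lemma cimg_nbhs x : cdom c x -> nbhs (cmap c x) (cmap c @` cdom c).
Proof. by move=> cx; apply: open_nbhs_nbhs; split; [exact: cimg_open|exists x]. Qed.

Lemma cdom_nbhs x : cdom c x -> nbhs x (cdom c).
Proof. by move=> cx; apply: open_nbhs_nbhs; split => //; exact: cdom_open. Qed.

End ChartBasics.

(** If no finite subfamily covered [A], the uncovered parts would generate a proper filter, and
    [f x] would separate its cluster point [x] from the part left uncovered by [f x] alone. *)
Lemma compact_finite_cover (T : topologicalType) (A : set T) (f : T -> set T) :
  compact A -> (forall x, A x -> nbhs x (f x)) ->
  exists s : seq T, (forall y, y \in s -> A y) /\
    forall x, A x -> exists2 y, y \in s & f y x.
Proof.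
move=> cA fA; apply: contrapT => N.
pose D := [set s : seq T | forall y, y \in s -> A y].
pose B (s : seq T) := A `&` [set x | ~ exists2 y, y \in s & f y x].
pose F := filter_from D B.
have FF : ProperFilter F.
  apply: filter_from_proper; last first.
    move=> s sA; apply: contrapT => /nonemptyPn B0; apply: N; exists s; split=> // x Ax.
    apply: contrapT => Nx; have : B s x by split.
    by rewrite B0.
  apply: filter_from_filter; first by exists [::].
  move=> s t sA tA; exists (s ++ t).
    by move=> y; rewrite mem_cat => /orP[/sA|/tA].
  by move=> x [Ax Nx]; split; split=> // -[y ys yx]; apply: Nx; exists y => //;
    rewrite mem_cat ys ?orbT.
have FA : F A by exists [::] => // x [].
have [x [Ax /(_ (B [:: x]) (f x))]] := cA F FF FA.
case=> [||y [[_ Ny] fy]]; last by apply: Ny; exists x => //; rewrite inE.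
  by exists [:: x] => // y; rewrite inE => /eqP ->.
exact: fA.
Qed.

Section Holo.
Variables (R : realType) (n : nat) (X : complex_manifold R n).
Local Notation C := R[i].
Local Notation V := (Cspace R n).
Implicit Types (h f g : X -> C) (x y : X).

Definition holo h := @holomorphic R n X (C^o) h.

Lemma atlas_cover x : exists2 c, (@atlas _ _ X) c & cdom c x.
Proof. by have [_ _ H _] := @atlasP _ _ X; exact: H. Qed.

Lemma X_hausdorff : hausdorff_space X.
Proof. by have [] := @atlasP _ _ X. Qed.

Lemma chart_ball (c : chart C X n) x : cdom c x ->
  exists2 r : R, 0 < r & forall v : V, vn (v - cmap c x) < r -> (cmap c @` cdom c) v.
Proof. by move=> cx; apply/(@nbhsV_P R V); exact: cimg_nbhs. Qed.

Lemma holo_continuous h : holo h -> continuous (h : X -> C^o).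
Proof.
move=> hh x; have [c Ac cx] := atlas_cover x.
have d : differentiable (h \o cinv c : V -> C^o) (cmap c x) by apply: hh => //; exists x.
have c1 : {for x, continuous ((h \o cinv c : V -> C^o) \o (cmap c : X -> V))}.
  apply: continuous_comp; first exact: cmap_continuous.
  exact: differentiable_continuous.
move=> A; have -> : h x = ((h \o cinv c : V -> C^o) \o (cmap c : X -> V)) x by rewrite /= cmapK.
move=> /c1; rewrite /= !nbhs_simpl /= => H.
apply: filterS2 (cdom_nbhs cx) H => y cy /=; by rewrite cmapK.
Qed.

Lemma holo_cst (a : C) : holo (fun=> a).
Proof. by move=> c Ac v _; exact: differentiable_cst. Qed.

Lemma holoD f g : holo f -> holo g -> holo (fun x => f x + g x).
Proof. by move=> hf hg c Ac v cv; apply: differentiableD; [exact: hf|exact: hg]. Qed.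

Lemma holoM f g : holo f -> holo g -> holo (fun x => f x * g x).
Proof.
move=> hf hg c Ac v cv.
exact: (@differentiableM _ _ (f \o cinv c) (g \o cinv c) v (hf c Ac v cv) (hg c Ac v cv)).
Qed.

Lemma holoZ (a : C) f : holo f -> holo (fun x => a * f x).
Proof. by move=> ?; apply: holoM => //; exact: holo_cst. Qed.

Lemma holoB f g : holo f -> holo g -> holo (fun x => f x - g x).
Proof.
by move=> hf hg; apply: holoD; [exact: hf|under eq_fun do rewrite -mulN1r; exact: holoZ].
Qed.

Lemma holoX f k : holo f -> holo (fun x => f x ^+ k).
Proof.
move=> hf; elim: k => [|k ih]; first exact: holo_cst.
by under eq_fun do rewrite exprS; exact: holoM.
Qed.

Lemma holo_sum (I : Type) (s : seq I) (F : I -> X -> C) :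
  (forall i, holo (F i)) -> holo (fun x => \sum_(i <- s) F i x).
Proof.
move=> hF; elim: s => [|i s ih].
  by under eq_fun do rewrite big_nil; exact: holo_cst.
by under eq_fun do rewrite big_cons; exact: holoD.
Qed.

Lemma cn_continuous : continuous (fun z : C^o => cn z : R).
Proof.
move=> z; apply: continuous_CR => e e0; exists e => // w wz; rewrite (le_lt_trans _ wz)//.
by have := cnBr w z; have := cnBr z w; rewrite [cn (z - w)]cnC ler_norml; lra.
Qed.

Lemma holo_cn_continuous h : holo h -> continuous (fun x => cn (h x)).
Proof.
move=> hh x; apply: (@continuous_comp _ _ _ (h : X -> C^o) (fun z : C^o => cn z : R) x).
  exact: holo_continuous.
exact: cn_continuous.
Qed.

Lemma open_cn_lt h (r : R) : holo h -> open [set x | cn (h x) < r].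
Proof.
move=> hh; apply: (@open_comp _ _ (fun x => cn (h x)) [set t | t < r]).
  by move=> x _; exact: holo_cn_continuous.
exact: open_lt.
Qed.

Lemma open_cn_gt h (r : R) : holo h -> open [set x | r < cn (h x)].
Proof.
move=> hh; apply: (@open_comp _ _ (fun x => cn (h x)) [set t | r < t]).
  by move=> x _; exact: holo_cn_continuous.
exact: open_gt.
Qed.

Lemma holo_bounded h (K : set X) : holo h -> compact K ->
  exists2 M : R, 0 <= M & forall x, K x -> cn (h x) <= M.
Proof.
move=> hh cK; have [[x0 Kx0]|N] := pselect (exists x, K x); last first.
  by exists 0 => // x Kx; exfalso; apply: N; exists x.
have [x Kx xM] := compact_EVT_max (ex_intro _ x0 Kx0) cK
  (continuous_subspaceT (holo_cn_continuous hh)).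
by exists (cn (h x)) => [|y Ky]; [exact: cn_ge0|apply: xM; exact: mem_set].
Qed.

Lemma X_locally_compact x (U : set X) : nbhs x U ->
  exists K, [/\ compact K, nbhs x K & K `<=` U].
Proof.
move=> xU; have [c Ac cx] := atlas_cover x.
have [r r0 rP] := chart_ball cx.
have xU' : nbhs (cinv c (cmap c x)) U by rewrite cmapK.
have /(@nbhsV_P R V)[s s0 sP] := cinv_continuous cx xU'.
pose t := Num.min r s / 2.
have m0 : 0 < Num.min r s by rewrite lt_min r0.
have t0 : 0 < t by rewrite divr_gt0.
have tm : t < Num.min r s by rewrite /t; lra.
move: tm; rewrite lt_min => /andP[tr ts].
exists (cinv c @` [set v : V | vn (v - cmap c x) <= t]); split.
- apply: continuous_compact; last exact: compact_vball.
  apply: continuous_in_subspaceT => v /set_mem /= vt.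
  by apply: cinv_cont; apply: rP; exact: le_lt_trans tr.
- have H : nbhs x (cmap c @^-1` [set v : V | vn (v - cmap c x) < t]).
    by apply: (cmap_continuous cx); apply/(@nbhsV_P R V); exists t.
  apply: filterS2 (cdom_nbhs cx) H => y cy yt.
  by exists (cmap c y); [exact: ltW|exact: cmapK].
- by move=> _ [v /= vt <-]; apply: sP; exact: le_lt_trans ts.
Qed.

Lemma holo_limit (F : nat -> X -> C) f :
  (forall i, holo (F i)) ->
  (forall x, exists2 U, nbhs x U & exists M : R, forall i y, U y -> cn (F i y) <= M) ->
  (forall x (e : R), 0 < e -> exists i0, forall i, (i0 <= i)%N -> cn (F i x - f x) <= e) ->
  holo f.
Proof.
move=> hF bF lF c Ac _ [x cx <-].
have [r r0 rP] := chart_ball cx.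
have [U xU [M MP]] := bF x.
have xU' : nbhs (cinv c (cmap c x)) U by rewrite cmapK.
have /(@nbhsV_P R V)[s s0 sP] := cinv_continuous cx xU'.
have rs0 : 0 < Num.min r s by rewrite lt_min r0.
have := @holV_limit R V (fun i => F i \o cinv c) (f \o cinv c) (cmap c x) (Num.min r s) M rs0.
case=> //.
- by move=> i v; rewrite lt_min => /andP[/rP cv _]; exact: hF.
- by move=> i v; rewrite lt_min => /andP[_ /sP Uv]; exact: MP.
- by move=> v _ e e0; exact: lF.
Qed.

Lemma small_power (t e : R) : 0 <= t -> t < 1 -> 0 < e -> exists k, forall j, (k <= j)%N -> t ^+ j <= e.
Proof.
move=> t0 t1 e0.
have mono k j : (k <= j)%N -> t ^+ k <= e -> t ^+ j <= e.
  by move=> kj; apply: le_trans; apply: ler_wiXn2l => //; exact: ltW.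
suff [k kP] : exists k, t ^+ k <= e by exists k => j kj; exact: mono kP.
have [->|tn0] := eqVneq t 0; first by exists 1%N; rewrite expr1 ltW.
have tp : 0 < t by rewrite lt_neqAle eq_sym tn0.
have [k kP] := @expr_large R t^-1 e^-1 ltac:(by rewrite invf_gt1).
by exists k; rewrite -lef_pV2 ?posrE ?exprn_gt0// -exprVn ltW.
Qed.

(** A high power of [f / f x], where [f] witnesses that [x] is off the hull. *)
Lemma hull_peak (K : set X) x (e : R) : compact K -> ~ holomorphic_hull K x -> 0 < e ->
  exists f, [/\ holo f, f x = 1 & forall y, K y -> cn (f y) <= e].
Proof.
move=> cK /existsNP[f /not_implyP[hf /negP]]; rewrite -ltNge => fx e0.
set s := sup _ in fx.
have [M M0 MP] := holo_bounded hf cK.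
have fs y : K y -> cn (f y) <= s.
  move=> Ky; apply: sup_upper_bound; last by exists y.
  by split; [exists (cn (f y)), y|exists M => _ [z Kz <-]; exact: MP].
have s0 : 0 <= s.
  have [[y Ky]|N] := pselect (exists y, K y); first exact: le_trans (cn_ge0 _) (fs y Ky).
  have E : [set cn (f y) | y in K] = set0.
    by apply/seteqP; split=> // t [y Ky _]; apply: N; exists y.
  by rewrite /s E sup0.
have fx0 : 0 < cn (f x) by lra.
have fxn0 : f x != 0 by rewrite -cn_gt0.
have [k kP] := @small_power (s / cn (f x)) e ltac:(by rewrite divr_ge0// cn_ge0)
  ltac:(by rewrite ltr_pdivrMr// mul1r) e0.
exists (fun y => ((f x)^-1 * f y) ^+ k); split.
- exact: holoX (holoZ _ hf).
- by rewrite mulVf// expr1n.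
move=> y Ky; rewrite cnX (le_trans _ (kP k (leqnn k)))// cnM cnV mulrC.
by rewrite lerXn2r ?nnegrE ?mulr_ge0 ?invr_ge0 ?cn_ge0// ler_wpM2r ?invr_ge0 ?cn_ge0// fs.
Qed.

End Holo.

Section Stein.
Variables (R : realType) (n : nat) (X : complex_manifold R n).
Hypothesis X_stein : stein X.
Local Notation C := R[i].
Local Notation V := (Cspace R n).
Implicit Types (h f g : X -> C) (x y : X).

Lemma separate x y : x <> y -> exists f, [/\ holo f, f x = 1 & f y = 0].
Proof.
have [_ sep _] := X_stein.
move=> /sep[f hf fxy]; have d0 : f x - f y != 0 by rewrite subr_eq0; exact/eqP.
exists (fun z => (f x - f y)^-1 * (f z - f y)); split.
- by apply: holoZ; apply: holoB => //; exact: holo_cst.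
- by rewrite mulVf.
- by rewrite subrr mulr0.
Qed.

Lemma separate_seq x (Q : seq X) : (forall q, q \in Q -> q <> x) ->
  exists f, [/\ holo f, f x = 1 & forall q, q \in Q -> f q = 0].
Proof.
elim: Q => [|q Q ih] H; first by exists (fun=> 1); split; [exact: holo_cst| |].
have [|f [hf fx fQ]] := ih; first by move=> p pQ; apply: H; rewrite inE pQ orbT.
have [|g [hg gx gq]] := @separate x q; first by move=> /esym; apply: H; rewrite mem_head.
exists (fun y => f y * g y); split; first exact: holoM.
  by rewrite fx gx mulr1.
by move=> p; rewrite inE => /predU1P[->|/fQ ->]; rewrite ?gq ?mulr0 ?mul0r.
Qed.

Lemma peak_function (K : set X) (Q : seq X) x (a : C) (e : R) :
  compact K -> ~ holomorphic_hull K x -> (forall q, q \in Q -> q <> x) -> 0 < e ->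
  exists f, [/\ holo f, f x = a, forall y, K y -> cn (f y) <= e &
    forall q, q \in Q -> f q = 0].
Proof.
move=> cK Kx Qx e0; have [f [hf fx fQ]] := separate_seq Qx.
have [M M0 MP] := holo_bounded hf cK.
pose b := (M + 1) * (cn a + 1).
have b0 : 0 < b by rewrite mulr_gt0//; have := cn_ge0 a; lra.
have [g [hg gx gK]] := hull_peak cK Kx (divr_gt0 e0 b0).
exists (fun y => a * (f y * g y)); split.
- by apply: holoZ; exact: holoM.
- by rewrite fx gx !mulr1.
- move=> y Ky; rewrite !cnM; have h1 := gK y Ky; have h2 := MP y Ky.
  have h3 : cn (f y) * cn (g y) <= (M + 1) * (e / b).
    by rewrite ler_pM ?cn_ge0//; lra.
  have h4 : cn a * (cn (f y) * cn (g y)) <= (cn a + 1) * ((M + 1) * (e / b)).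
    by rewrite ler_pM ?mulr_ge0 ?cn_ge0//; lra.
  rewrite (le_trans h4)//.
  have -> : (cn a + 1) * ((M + 1) * (e / b)) = b * (e / b).
    by rewrite [LHS]mulrA; congr (_ * _); exact: mulrC.
  by rewrite mulrC divfK// gt_eqF.
- by move=> q /fQ ->; rewrite mul0r mulr0.
Qed.

(** The bounds 1/4 and 3/2 lie on the two sides of 1, so that high powers are small on [K] and large
    on [L]. *)
Lemma peak_family (K L : set X) (Q : seq X) : compact K -> compact L ->
  (forall x, L x -> ~ holomorphic_hull K x /\ forall q, q \in Q -> q <> x) ->
  exists p (g : 'I_p -> X -> C), [/\ forall i, holo (g i),
    forall i y, K y -> cn (g i y) <= 1 / 4, forall i q, q \in Q -> g i q = 0 &
    forall x, L x -> exists i, 3 / 2 <= cn (g i x)].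
Proof.
move=> cK cL HL.
have F x : exists f, [/\ holo f, forall y, K y -> cn (f y) <= 1 / 4,
    forall q, q \in Q -> f q = 0 & L x -> f x = 2].
  have [Lx|Lx] := pselect (L x); last first.
    exists (fun=> 0); split; [exact: holo_cst| |by []|by []].
    by move=> y _; rewrite cn0; lra.
  have [Kx Qx] := HL x Lx.
  by have [f [? ? ? ?]] := @peak_function K Q x 2 (1 / 4) cK Kx Qx ltac:(lra); exists f; split.
pose f x := projT1 (cid (F x)).
have fP x : [/\ holo (f x), forall y, K y -> cn (f x y) <= 1 / 4,
    forall q, q \in Q -> f x q = 0 & L x -> f x x = 2] := projT2 (cid (F x)).
have [x Lx|s [_ sP]] := compact_finite_cover (f := fun x => [set y | 3 / 2 < cn (f x y)]) cL.
  apply: open_nbhs_nbhs; split; first by apply: open_cn_gt; have [] := fP x.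
  rewrite /=; have [_ _ _ /(_ Lx) ->] := fP x.
  have -> : (2 : C) = (2 : R)%:C%C by rewrite rmorph_nat.
  by rewrite cn_real ger0_norm//; lra.
exists (size s), (fun i => f (tnth (in_tuple s) i)); split.
- by move=> i; have [] := fP (tnth (in_tuple s) i).
- by move=> i; have [] := fP (tnth (in_tuple s) i).
- by move=> i; have [] := fP (tnth (in_tuple s) i).
move=> x /sP[y ys yx].
have /tnthP[i yi] : y \in in_tuple s by exact: ys.
by exists i; rewrite -yi ltW.
Qed.

End Stein.

(** * Enlarging and perturbing maps off a compact set *)

Section Largeness.
Variables (R : realType) (n : nat) (X : complex_manifold R n).
Local Notation C := R[i].
Local Notation V := (Cspace R n).
Local Notation holo := (@holo R n X).
Implicit Types (h f g : X -> C) (x y : X).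

Lemma cell_tame_nbhs x : exists2 U, nbhs x U & cell_tame U (n * 2) [set h | holo h].
Proof.
have [c Ac cx] := atlas_cover x; have [r r0 rP] := chart_ball cx.
(* Room for the Lipschitz estimate: balls of radius [4 * p] around points of the p-ball stay in the
   compact ball of radius [6 * p < r]. *)
pose p := r / 8; have p0 : 0 < p by rewrite divr_gt0.
set z : V := cmap c x in rP.
have [cell [cb [K K0 cP]]] := cells_ball z p0.
exists (cdom c `&` cmap c @^-1` [set v : V | vn (v - z) < p]).
  apply: filterI; first exact: cdom_nbhs.
  by apply: (cmap_continuous cx); apply/(@nbhsV_P R V); exists p.
exists (fun q y => cell q (cmap c y)); split; first exact: bounded_cells_comp.
move=> h hh.
have cK : compact (cinv c @` [set v : V | vn (v - z) <= 6 * p]).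
  apply: continuous_compact; last exact: compact_vball.
  apply: continuous_in_subspaceT => v /set_mem /= vt.
  by apply: cinv_cont; apply: rP; rewrite /p in vt; lra.
have [M M0 MP] := holo_bounded hh cK.
exists (M / p * K); first by rewrite !mulr_ge0// invr_ge0 ltW.
move=> q y y' q0 [cy /= yp] [cy' /= y'p] E.
have qp : (0 : R) < q%:R by rewrite ltr0n.
have hv : holV (h \o cinv c : V -> C^o) (cmap c y) (4 * p).
  move=> w wy; apply: hh => //; apply: rP.
  by have := vnD (w - cmap c y) (cmap c y - z); rewrite addrA subrK /p in wy yp *; lra.
have hM (w : V) : vn (w - cmap c y) < 4 * p -> cn ((h \o cinv c) w) <= M.
  move=> wy; apply: MP; exists w => //=.
  by have := vnD (w - cmap c y) (cmap c y - z); rewrite addrA subrK; lra.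
have yy' : vn (cmap c y' - cmap c y : V) <= 4 * p / 2.
  have := vnB (cmap c y' - z : V) (cmap c y - z); rewrite opprB addrA subrK; lra.
have := holV_lipschitz (mulr_gt0 (ltr0Sn R 3) p0) hv hM yy'.
rewrite [cmap c y + _]addrC subrK /= !cmapK// => H.
rewrite cnC (le_trans (ler_wpM2r (ltW qp) H))//.
have -> : 4 * M / (4 * p) = M / p by field; exact: lt0r_neq0.
rewrite -[leLHS]mulrA; apply: ler_wpM2l; first by rewrite divr_ge0// ltW.
by apply: cP; rewrite ?(ltW yp) ?(ltW y'p).
Qed.

Lemma cell_tame_compact (L : set X) : compact L -> cell_tame L (n * 2) [set h | holo h].
Proof.
move=> cL; pose U x := projT1 (cid2 (cell_tame_nbhs x)).
have [x _|s [_ sP]] := compact_finite_cover (f := U) cL.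
  by rewrite /U; case: cid2.
apply: (cell_tame_sub _ (@cell_tame_bigunion R X X s U (n * 2) _ _)).
  by move=> x /sP.
by move=> x _; rewrite /U; case: cid2.
Qed.

Hypothesis X_stein : stein X.

(** The correction combines P-th powers of peak functions with coefficients in [[0, 1]]: it is small
    on [K] because [P] is large, and large on [L] by [large_combination]. *)
Lemma largeness (m : nat) (K L : set X) (Q : seq X) (f : 'I_m -> X -> C) (e B : R) :
  ((n * 2).*2 < m)%N -> compact K -> compact L ->
  (forall x, L x -> ~ holomorphic_hull K x /\ forall q, q \in Q -> q <> x) ->
  (forall k, holo (f k)) -> 0 < e ->
  exists u : 'I_m -> X -> C, [/\ forall k, holo (u k),
    forall k y, K y -> cn (u k y) <= e, forall k q, q \in Q -> u k q = 0 &
    forall x, L x -> exists k, B <= cn (f k x + u k x)].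
Proof.
move=> nm cK cL LK hf e0.
have [p [g [hg gK gQ gL]]] := peak_family X_stein cK cL LK.
have [cell [cb ct]] := cell_tame_compact cL.
have p10 : (0 : R) < p%:R + 1 by rewrite ltr_wpDl.
have [N0 N0P] := @small_power R (1 / 4) (e / (p%:R + 1)) ltac:(lra) ltac:(lra)
  (divr_gt0 e0 p10).
(* The bound [N0.+1] forces [P > 0], so that the powers still vanish on [Q]. *)
have [P [A [NP A01 AP]]] := @large_combination R X L (n * 2) cell m p N0.+1 g f (3 / 2) B
  ltac:(lra) nm cb (fun i => ct _ (hg i)) (fun k => ct _ (hf k)) gL.
exists (fun k x => \sum_i (A k i)%:C%C * g i x ^+ P); split=> //.
- by move=> k; apply: holo_sum => i; apply: holoZ; exact: holoX.
- move=> k y Ky; rewrite (le_trans (cn_sum _))//.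
  apply: (@le_trans _ _ (\sum_(i < p) e / (p%:R + 1))).
    apply: ler_sum => i _; rewrite cnM cn_real cnX; have /andP[a0 a1] := A01 k i.
    rewrite ger0_norm//; apply: (@le_trans _ _ (1 * (1 / 4) ^+ P)).
      by rewrite ler_pM ?exprn_ge0 ?cn_ge0// lerXn2r ?nnegrE ?cn_ge0// gK.
    by rewrite mul1r; apply: N0P; exact: ltnW.
  rewrite sumr_const card_ord -[_ *+ p]mulr_natl mulrCA ler_piMr ?(ltW e0)//.
  by rewrite ler_pdivrMr// mul1r lerDl.
- move=> k q qQ; rewrite big1// => i _; rewrite gQ// expr0n.
  by case: (P) NP => // ? _; rewrite mulr0.
Qed.

(** Newton interpolation: a peak function that vanishes at the points already treated corrects the
    value at the new one. *)
Lemma interpolation (K : set X) (Q : seq X) (d : X -> C) (e : R) :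
  compact K -> uniq Q -> (forall q, q \in Q -> ~ holomorphic_hull K q) -> 0 < e ->
  exists w, [/\ holo w, forall y, K y -> cn (w y) <= e & forall q, q \in Q -> w q = d q].
Proof.
move=> cK; elim: Q e => [|q Q ih] e /=.
  move=> _ _ e0; exists (fun=> 0); split; [exact: holo_cst| |by []].
  by move=> y _; rewrite cn0 ltW.
move=> /andP[qQ uQ] HQ e0; have e20 : 0 < e / 2 by rewrite divr_gt0.
have [w [hw wK wQ]] := ih (e / 2) uQ (fun p pQ => HQ p ltac:(by rewrite inE pQ orbT)) e20.
have Kq : ~ holomorphic_hull K q by apply: HQ; rewrite mem_head.
have Qq p : p \in Q -> p <> q by move=> pQ pq; rewrite -pq pQ in qQ.
have [v [hv vq vK vQ]] := peak_function X_stein (d q - w q) cK Kq Qq e20.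
exists (fun y => w y + v y); split.
- exact: holoD.
- by move=> y Ky; have := cnD (w y) (v y); have := wK y Ky; have := vK y Ky; lra.
- move=> p; rewrite inE => /predU1P[->|pQ]; first by rewrite vq addrC subrK.
  by rewrite vQ// wQ// addr0.
Qed.

Lemma hull_lt (K : set X) f (r : R) x : holo f -> 0 <= r -> (forall y, K y -> cn (f y) <= r) ->
  r < cn (f x) -> ~ holomorphic_hull K x.
Proof.
move=> hf r0 fK fx /(_ f hf); apply/negP; rewrite -ltNge (le_lt_trans _ fx)//.
have [[y Ky]|N] := pselect (exists y, K y).
  by apply: ge_sup; [exists (cn (f y)), y|move=> _ [z Kz <-]; exact: fK].
have E : [set cn (f y) | y in K] = set0.
  by apply/seteqP; split=> // t [y Ky _]; apply: N; exists y.
by rewrite E sup0.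
Qed.

Lemma compact_bigunion (s : seq X) (P : pred X) (F : X -> set X) :
  (forall q, q \in s -> compact (F q)) ->
  compact [set x | exists2 q, q \in s /\ P q & F q x].
Proof.
elim: s => [|q s ih] H.
  rewrite (_ : [set _ | _] = set0); first exact: compact0.
  by apply/seteqP; split=> // x [q []].
have cs := ih (fun p ps => H p ltac:(by rewrite inE ps orbT)).
have cq : compact (F q) by apply: H; rewrite mem_head.
case Pq : (P q); last first.
  rewrite (_ : [set _ | _] = [set x | exists2 q, q \in s /\ P q & F q x])//.
  apply/seteqP; split=> x [p [ps Pp] Fp].
    by move: ps; rewrite inE => /predU1P[pq|ps]; [rewrite pq Pq in Pp|exists p].
  by exists p => //; rewrite inE ps orbT.
rewrite (_ : [set _ | _] = F q `|` [set x | exists2 q, q \in s /\ P q & F q x]).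
  exact: compactU.
apply/seteqP; split=> x.
  by move=> [p [+ Pp] Fp]; rewrite inE => /predU1P[<-|ps]; [left|right; exists p].
move=> [Fq|[p [ps Pp] Fp]]; first by exists q; rewrite ?mem_head.
by exists p => //; rewrite inE ps orbT.
Qed.

Lemma compact_diff (A B : set X) : compact A -> open B -> compact (A `\` B).
Proof.
by move=> cA oB; rewrite setDE; apply: compact_closedI => //; exact: open_closedC.
Qed.

(** * One stage: prescribed values at finitely many points, large values on a shell *)

Section Stage.
Variables (m : nat) (Mb Sb : bool -> set X) (Q : seq X) (O : X -> set X) (bl : X -> bool).
Variables (d f : bool -> 'I_m -> X -> C) (e B : R).
Hypotheses (nm : ((n * 2).*2 < m)%N) (e0 : 0 < e).
Hypotheses (cM : forall b, compact (Mb b)) (cS : forall b, compact (Sb b)).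
Hypothesis SM : forall b x, Sb b x -> ~ holomorphic_hull (Mb b) x.
Hypothesis OM : forall b q x, q \in Q -> O q x -> ~ holomorphic_hull (Mb b) x.
Hypotheses (uQ : uniq Q) (cO : forall q, q \in Q -> compact (O q) /\ nbhs q (O q)).
Hypothesis dO : forall p q x, p \in Q -> q \in Q -> O p x -> O q x -> p = q.
Hypothesis hf : forall b k, holo (f b k).

(* Near [q] only the block [bl q], the one carrying the largest coordinate of the
   value prescribed at [q], has to stay close to that value; the other block takes
   over the task of being large on [O q] away from [q]. *)
Lemma stage : exists f' : bool -> 'I_m -> X -> C, [/\ forall b k, holo (f' b k),
  forall b k x, Mb b x -> cn (f' b k x - f b k x) <= e,
  forall b k q, q \in Q -> f' b k q = d b k q,
  forall b x, Sb b x -> (forall q, q \in Q -> ~ O q x) -> exists k, B <= cn (f' b k x) &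
  forall q x, q \in Q -> O q x -> (exists b k, B <= cn (f' b k x)) \/
    forall k, cn (f' (bl q) k x - d (bl q) k q) <= 1 / 2].
Proof.
have e20 : 0 < e / 2 by rewrite divr_gt0.
have Oq q : q \in Q -> O q q by move=> /cO[_]; exact: nbhs_singleton.
have Qhull b q : q \in Q -> ~ holomorphic_hull (Mb b) q.
  by move=> qQ; apply: (OM qQ); exact: Oq.
have W b k := interpolation (fun q => d b k q - f b k q) (@cM b) uQ (fun q => @Qhull b q) e20.
pose w b k := projT1 (cid (W b k)).
have wP b k : [/\ holo (w b k), forall y, Mb b y -> cn (w b k y) <= e / 2 &
    forall q, q \in Q -> w b k q = d b k q - f b k q] := projT2 (cid (W b k)).
pose h b k x := f b k x + w b k x.
have hh b k : holo (h b k) by apply: holoD => //; have [] := wP b k.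
have hQ b k q : q \in Q -> h b k q = d b k q.
  by move=> qQ; have [_ _ /(_ q qQ) wq] := wP b k; rewrite /h wq addrC subrK.
pose iO := [set x | exists2 q, q \in Q & (O q)^° x].
pose L' b := (Sb b `\` iO) `|` [set x | exists2 q, q \in Q /\ bl q != b & O q x].
have oiO : open iO.
  rewrite (_ : iO = \bigcup_(q in [set q | q \in Q]) (O q)^°).
    by apply: bigcup_open => q _; exact: open_interior.
  by apply/seteqP; split=> x [q qs Fq]; exists q.
have cL' b : compact (L' b).
  apply: compactU; first exact: compact_diff.
  by apply: compact_bigunion => q /cO[].
have L'P b x : L' b x -> ~ holomorphic_hull (Mb b) x /\
    forall q, q \in [seq q <- Q | bl q == b] -> q <> x.
  move=> [[Sx Nx]|[q [qQ bq] Ox]]; split.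
  - exact: SM.
  - move=> q; rewrite mem_filter => /andP[_ qQ] qx; apply: Nx; exists q => //.
    by rewrite -qx; have [] := cO qQ.
  - exact: (OM qQ).
  - move=> p; rewrite mem_filter => /andP[/eqP pb pQ] px.
    have := dO pQ qQ (Oq _ pQ); rewrite px => /(_ Ox) xq.
    by move: bq; rewrite -xq -px pb eqxx.
(* These peak functions are not added to [f]. Being at most 1/2 on [Cb b] and at least 3/2 on [L b],
   they certify that [L b] misses the hull of [Cb b]. *)
have G b := peak_family X_stein (@cM b) (@cL' b) (L'P b).
pose np b := projT1 (cid (G b)).
pose g b : 'I_(np b) -> X -> C := projT1 (cid (projT2 (cid (G b)))).
have gP b : [/\ forall i, holo (g b i), forall i y, Mb b y -> cn (g b i y) <= 1 / 4,
   forall i q, q \in [seq q <- Q | bl q == b] -> g b i q = 0 &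
   forall x, L' b x -> exists i, 3 / 2 <= cn (g b i x)] :=
   projT2 (cid (projT2 (cid (G b)))).
have O'E q : exists O', q \in Q -> [/\ compact O', nbhs q O', O' `<=` O q,
    forall x, O' x -> forall i, cn (g (bl q) i x) <= 1 / 2 &
    forall x, O' x -> forall k, cn (h (bl q) k x - d (bl q) k q) <= 1 / 4].
  have [qQ|qQ] := boolP (q \in Q); last by exists set0.
  have [cOq nO] := cO qQ; have [hg _ g0 _] := gP (bl q).
  have n1 : nbhs q [set x | forall i, cn (g (bl q) i x) < 1 / 2].
    apply: filter_forall => i; apply: open_nbhs_nbhs; split; first exact: open_cn_lt.
    by rewrite /= g0 ?cn0 ?mem_filter ?eqxx//; lra.
  have n2 : nbhs q [set x | forall k, cn (h (bl q) k x - d (bl q) k q) < 1 / 4].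
    apply: filter_forall => k; apply: open_nbhs_nbhs; split.
      by apply: (@open_cn_lt _ _ _ (fun x => h (bl q) k x - d (bl q) k q)); apply: holoB => //; exact: holo_cst.
    by rewrite /= hQ// subrr cn0; lra.
  have [ O' [cO' nO' O's]] := X_locally_compact (filterI nO (filterI n1 n2)).
  exists O' => _; split=> // x /O's[Ox [x1 x2]] //.
    by move=> i; exact: ltW.
  by move=> k; exact: ltW.
pose O' q := projT1 (cid (O'E q)).
have O'P q : q \in Q -> [/\ compact (O' q), nbhs q (O' q), O' q `<=` O q,
    forall x, O' q x -> forall i, cn (g (bl q) i x) <= 1 / 2 &
    forall x, O' q x -> forall k, cn (h (bl q) k x - d (bl q) k q) <= 1 / 4] :=
   projT2 (cid (O'E q)).
pose Cb b := Mb b `|` [set x | exists2 q, q \in Q /\ bl q == b & O' q x].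
have cC b : compact (Cb b).
  by apply: compactU => //; apply: compact_bigunion => q /O'P[].
have gC b i x : Cb b x -> cn (g b i x) <= 1 / 2.
  have [_ gM _ _] := gP b.
  move=> [/(gM i)|[q [qQ /eqP bq] /=]]; first lra.
  by have [_ _ _ H _] := O'P q qQ; move: H; rewrite bq => H /H.
(* Inside [O' q] the block [bl q] is held; on the rest of [O q] the other block is enlarged. *)
pose L b := (Sb b `\` iO) `|` [set x | exists2 q, q \in Q /\ bl q != b & (O q `\` (O' q)^°) x].
have cL b : compact (L b).
  apply: compactU; first exact: compact_diff.
  apply: compact_bigunion => q qQ; apply: compact_diff; first by have [] := cO qQ.
  exact: open_interior.
have LP b x : L b x -> ~ holomorphic_hull (Cb b) x /\ forall q, q \in Q -> q <> x.
  move=> Lx; split.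
    have : L' b x by case: Lx => [|[q qb [Oqx _]]]; [left|right; exists q].
    have [hg _ _ gL] := gP b; move=> /gL[i gi].
    by apply: (@hull_lt _ (g b i) (1 / 2) x (hg i)); [lra|move=> y; exact: gC|lra].
  move=> q qQ qx; case: Lx => [[_ N]|[p [pQ _] [Op Np]]].
    by apply: N; exists q => //; rewrite -qx; have [] := cO qQ.
  apply: Np; rewrite -qx in Op *; rewrite -(dO qQ pQ (Oq _ qQ) Op).
  by have [] := O'P q qQ.
have e'0 : 0 < Num.min (e / 2) (1 / 4) by rewrite lt_min e20; lra.
have U b := largeness B nm (@cC b) (@cL b) (LP b) (hh b) e'0.
pose u b := projT1 (cid (U b)).
have uP b : [/\ forall k, holo (u b k),
    forall k y, Cb b y -> cn (u b k y) <= Num.min (e / 2) (1 / 4), forall k q, q \in Q -> u b k q = 0 &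
    forall x, L b x -> exists k, B <= cn (h b k x + u b k x)] := projT2 (cid (U b)).
exists (fun b k x => h b k x + u b k x); split.
- by move=> b k; apply: holoD => //; have [] := uP b.
- move=> b k x Mx; have [_ wM _] := wP b k; have [_ uC _ _] := uP b.
  have := uC k x (or_introl Mx); rewrite le_min => /andP[u1 _].
  have -> : h b k x + u b k x - f b k x = w b k x + u b k x by rewrite /h; ring.
  by rewrite (le_trans (cnD _ _))//; have := wM x Mx; lra.
- by move=> b k q qQ; have [_ _ u0 _] := uP b; rewrite u0// addr0 hQ.
- move=> b x Sx Nx; have [_ _ _ uL] := uP b; apply: uL; left; split=> // -[q qQ /interior_subset].
  exact: Nx.
- move=> q x qQ Ox; have [xO'|xO'] := pselect ((O' q)^° x); last first.
    left; exists (~~ bl q); have [_ _ _ uL] := uP (~~ bl q); apply: uL; right.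
    by exists q => //; split=> //; case: (bl q).
  right=> k; have [_ uC _ _] := uP (bl q); have O'x := interior_subset xO'.
  have := uC k x (or_intror _); rewrite le_min => /(_ (ex_intro2 _ _ q (conj qQ (eqxx _)) O'x)).
  move=> /andP[_ u2]; have [_ _ _ _ H] := O'P q qQ; have := H x O'x k.
  have := cnD (h (bl q) k x - d (bl q) k q) (u (bl q) k x).
  by rewrite addrAC; lra.
Qed.

End Stage.

(** The difference [h x - h y] serves as the one-element family of [generic_matrix] over pairs of
    points, whose cells have exponent [4 n]. *)
Lemma generic_separation (m : nat) (K K' M : set X) h (f : 'I_m -> X -> C) (e : R) :
  ((n * 2).*2 < m)%N -> compact K -> compact K' -> compact M -> holo h ->
  (forall x y, K x -> K' y -> 1 <= cn (h x - h y)) -> (forall k, holo (f k)) -> 0 < e ->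
  exists f' : 'I_m -> X -> C, [/\ forall k, holo (f' k),
    forall k x, M x -> cn (f' k x - f k x) <= e &
    exists2 eta : R, 0 < eta & forall x y, K x -> K' y -> exists k, eta <= cn (f' k x - f' k y)].
Proof.
move=> nm cK cK' cM hh h1 hf e0.
have [c1 [b1 t1]] := cell_tame_compact cK; have [c2 [b2 t2]] := cell_tame_compact cK'.
have [c [cb cP]] := cells_pair b1 b2.
have [Mh Mh0 MhP] := holo_bounded hh cM.
have tameB g : holo g -> tame (K `*` K') c (fun p => g p.1 - g p.2).
  move=> hg; have [K1 K10 P1] := t1 g hg; have [K2 K20 P2] := t2 g hg.
  exists (K1 + K2); first exact: addr_ge0.
  move=> q x y q0 [x1 x2] [y1 y2] /cP[E1 E2].
  have := P1 q x.1 y.1 q0 x1 y1 E1; have := P2 q x.2 y.2 q0 x2 y2 E2 => H2 H1.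
  have -> : g x.1 - g x.2 - (g y.1 - g y.2) = (g x.1 - g y.1) - (g x.2 - g y.2) by ring.
  by rewrite (le_trans (ler_wpM2r _ (cnB _ _)))// mulrDl lerD.
have Mh1 : 0 < Mh + 1 by lra.
have nm' : (n * 2 + n * 2 < m)%N by rewrite addnn.
have [A [eta [eta0 Ae AP]]] := @generic_matrix R _ (K `*` K') (n * 2 + n * 2) c m 1
  (fun _ p => h p.1 - h p.2) (fun k p => f k p.1 - f k p.2) _ (divr_gt0 e0 Mh1)
  nm' cb (fun _ => tameB h hh) (fun k => tameB _ (hf k))
  (fun p Kp => ex_intro _ ord0 (h1 _ _ Kp.1 Kp.2)).
exists (fun k x => f k x + A k ord0 * h x); split.
- by move=> k; apply: holoD; [exact: hf|exact: holoZ].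
- move=> k x Mx; rewrite addrAC subrr add0r cnM.
  have := ler_pM (cn_ge0 _) (cn_ge0 _) (Ae k ord0) (MhP x Mx) => /le_trans; apply.
  have e1 : 0 < e / (Mh + 1) by rewrite divr_gt0.
  have : e / (Mh + 1) * (Mh + 1) = e by rewrite divfK// gt_eqF.
  lra.
exists eta => // x y Kx Ky; have [k] := AP (x, y) (conj Kx Ky).
rewrite big_ord1 /= => H; exists k; apply: (le_trans H).
rewrite le_eqVlt; apply/orP; left; apply/eqP; congr cn; ring.
Qed.

End Largeness.

(** * Immersivity and separation of points *)

Section Immersion.
Variables (R : realType) (n : nat) (X : complex_manifold R n).
Local Notation C := R[i].
Local Notation V := (Cspace R n).
Local Notation holo := (@holo R n X).

Lemma near_eq_diff (U W : normedModType C) (f g : U -> W) z :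
  {near z, f =1 g} -> differentiable f z ->
  differentiable g z /\ 'd g z = 'd f z :> (U -> W).
Proof.
move=> fg df; have fgz : f z = g z := nbhs_singleton fg.
apply: fderiv_differentiable; first exact: diff_continuous.
move=> e e0; have [d d0 dP] := differentiable_fderiv df e0.
have /(@nbhsV_P R U)[s s0 sP] := fg.
exists (Num.min d s); first by rewrite lt_min d0.
move=> v; rewrite lt_min => /andP[vd vs]; rewrite -fgz -sP; first exact: dP.
by rewrite [z + v]addrC addrK.
Qed.

Lemma diff_coord (U : normedModType C) N (f : U -> Cspace R N) z k :
  differentiable f z ->
  differentiable (fun v => f v ord0 k : C^o) z /\
  forall w, 'd (fun v => f v ord0 k : C^o) z w = ('d f z w) ord0 k.
Proof.
move=> df.
have lin : linear (fun v : Cspace R N => v ord0 k : C^o) by move=> a u v; rewrite !mxE.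
pose glM := GRing.isLinear.Build _ _ _ _ _ lin.
pose L : {linear Cspace R N -> C^o} := HB.pack (fun v : Cspace R N => v ord0 k : C^o) glM.
have cL : continuous L.
  apply: (@bounded_linear_continuous R _ _ L 1) => v; rewrite mul1r vnCo; exact: cn_coord.
have dL : differentiable L (f z) by exact: linear_differentiable.
have E := diff_comp df dL.
split; first exact: (@differentiable_comp _ _ _ _ f L z df dL).
move=> w; transitivity ('d L (f z) ('d f z w)).
  exact: (congr1 (fun h => h w) E).
exact: (congr1 (fun h => h ('d f z w)) (diff_lin (f z) cL)).
Qed.

Definition good_chart (c : chart C X n) := forall c', (@atlas _ _ X) c' ->
  compatible (@diff_on C) c c' /\ compatible (@diff_on C) c' c.

(** The chart is taken from the maximal atlas because the coordinate systems supplied by [stein]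
    need not belong to [atlas]. *)
Definition immersive_at (I : finType) (f : I -> X -> C) x :=
  exists c : chart C X n, [/\ good_chart c, cdom c x &
    forall w : V, w != 0 -> exists k, 'd (f k \o cinv c : V -> C^o) (cmap c x) w != 0].

Lemma near_chart (c1 : chart C X n) x (P : set X) : cdom c1 x -> nbhs x P ->
  \forall v \near cmap c1 x, P (cinv c1 v).
Proof. by move=> cx xP; apply: (cinv_continuous cx); rewrite cmapK. Qed.

Lemma near_transition (W : normedModType C) (g : X -> W) (c1 c2 : chart C X n) x :
  cdom c1 x -> cdom c2 x ->
  {near cmap c1 x, (g \o cinv c2) \o (cmap c2 \o cinv c1) =1 g \o cinv c1}.
Proof.
move=> c1x c2x; have := near_chart c1x (cdom_nbhs c2x).
by apply: filterS => v c2v /=; rewrite cmapK.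
Qed.

Lemma holo_good (W : normedModType C) (g : X -> W) c x : holomorphic g -> good_chart c ->
  cdom c x -> differentiable (g \o cinv c) (cmap c x).
Proof.
move=> hg gc cx; have [c1 A1 c1x] := atlas_cover x.
have [K1 K2] := gc c1 A1.
apply: (near_eq_differentiable (near_transition g cx c1x)).
apply: differentiable_comp; first by apply: K1; exists x.
by rewrite /= cmapK//; apply: hg => //; exists x.
Qed.

(** The chain rule carries a kernel vector into the chart [c], where it must vanish; the transition
    map has a differentiable inverse, so the vector was 0. *)
Lemma immersive_of_coords N (j : X -> Cspace R N) : holomorphic j ->
  (forall x, immersive_at (fun k x => j x ord0 k) x) -> immersive j.
Proof.
move=> hj H c1 x A1 c1x.
suff ker : forall u, 'd (j \o cinv c1) (cmap c1 x) u = 0 -> u = 0.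
  by move=> u v E; apply/eqP; rewrite -subr_eq0; apply/eqP/ker; rewrite linearB E subrr.
move=> u du; have [c [gc cx Hc]] := H x.
have [K1 K2] := gc c1 A1.
have dT : differentiable (cmap c \o cinv c1) (cmap c1 x) by apply: K2; exists x.
have Tx : (cmap c \o cinv c1) (cmap c1 x) = cmap c x by rewrite /= cmapK.
have dj : differentiable (j \o cinv c) (cmap c x) by exact: holo_good.
have E1 : 'd (j \o cinv c1) (cmap c1 x) u =
    'd (j \o cinv c) (cmap c x) ('d (cmap c \o cinv c1) (cmap c1 x) u).
  have dj' : differentiable (j \o cinv c) ((cmap c \o cinv c1) (cmap c1 x)) by rewrite Tx.
  have D := differentiable_comp dT dj'.
  have [_ E] := near_eq_diff (near_transition j c1x cx) D.
  transitivity ('d ((j \o cinv c) \o (cmap c \o cinv c1)) (cmap c1 x) u).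
    exact: (congr1 (fun h => h u) E).
  transitivity ('d (j \o cinv c) ((cmap c \o cinv c1) (cmap c1 x)) ('d (cmap c \o cinv c1) (cmap c1 x) u)).
    exact: (congr1 (fun h => h u) (diff_comp dT dj')).
  by rewrite Tx.
have T0 : 'd (cmap c \o cinv c1) (cmap c1 x) u = 0.
  apply/eqP; apply: contrapT => /negP /Hc[k]; apply/negP; rewrite negbK.
  by have [_ /= ->] := diff_coord k dj; rewrite -E1 du mxE.
have dS : differentiable (cmap c1 \o cinv c) ((cmap c \o cinv c1) (cmap c1 x)).
  by rewrite Tx; apply: K1; exists x.
have nid : {near cmap c1 x, (cmap c1 \o cinv c) \o (cmap c \o cinv c1) =1 id}.
  have := near_chart c1x (cdom_nbhs cx); have := cimg_nbhs c1x.
  by apply: filterS2 => v [y cy <-] /= cdy; rewrite (cmapK cdy) (cmapK cy).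
have [_ E2] := near_eq_diff nid (differentiable_comp dT dS).
transitivity ('d id (cmap c1 x) u).
  by rewrite diff_val.
rewrite -(linear0 ('d (cmap c1 \o cinv c) ((cmap c \o cinv c1) (cmap c1 x)))) -T0.
transitivity ('d ((cmap c1 \o cinv c) \o (cmap c \o cinv c1)) (cmap c1 x) u).
  exact: (congr1 (fun h => h u) E2).
exact: (congr1 (fun h => h u) (diff_comp dT dS)).
Qed.

End Immersion.

Section GenericProperties.
Variables (R : realType) (n : nat) (X : complex_manifold R n) (m : nat).
Local Notation C := R[i].
Local Notation V := (Cspace R n).
Local Notation holo := (@holo R n X).
Implicit Types (h : X -> C) (f j : 'I_m -> X -> C).

(** A density and openness condition: maps can be perturbed so that [P] holds for everything close
    to the perturbed map on [K]. The tolerance [dl] is what lets [P] survive the limit. *)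
Definition generic (K : set X) (P : set ('I_m -> X -> C)) := compact K /\
  forall f (M : set X) (e : R), (forall k, holo (f k)) -> compact M -> 0 < e ->
  exists f', [/\ forall k, holo (f' k), forall k x, M x -> cn (f' k x - f k x) <= e &
    exists2 dl : R, 0 < dl & forall j, (forall k, holo (j k)) ->
      (forall k x, K x -> cn (j k x - f' k x) <= dl) -> P j].

Hypothesis X_stein : stein X.
Hypothesis nm : ((n * 2).*2 < m)%N.

Lemma generic_separate (x y : X) : x <> y -> exists U W K, [/\ nbhs x U, nbhs y W &
  generic K (fun j => forall x' y', U x' -> W y' -> exists k, j k x' <> j k y')].
Proof.
move=> xy; have [h [hh hx hy]] := separate X_stein xy.
have nb z : nbhs z [set w | cn (h w - h z) < 1 / 4].
  apply: open_nbhs_nbhs; split; last by rewrite /= subrr cn0; lra.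
  by apply: (@open_cn_lt _ _ _ (fun w => h w - h z)); apply: holoB => //; exact: holo_cst.
have [U [cU nU Us]] := X_locally_compact (nb x).
have [W [cW nW Ws]] := X_locally_compact (nb y).
exists U, W, (U `|` W); split=> //; split; first exact: compactU.
move=> f M e hf cM e0.
(* On these neighbourhoods [h] separates only by 1/2; doubling it reaches the bound 1 required by
   [generic_separation]. *)
have sep x' y' : U x' -> W y' -> 1 <= cn (2 * h x' - 2 * h y').
  move=> /Us /= Ux /Ws /= Wy; have -> : 2 * h x' - 2 * h y' = 2 * (h x' - h y') by ring.
  have c2 : cn (2 : C) = 2.
    have -> : (2 : C) = (2 : R)%:C%C by rewrite rmorph_nat.
    by rewrite cn_real ger0_norm//; lra.
  rewrite cnM c2.
  have : cn (1 : C) <= cn (h x' - h y') + (cn (h x' - h x) + cn (h y' - h y)).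
    have -> : (1 : C) = (h x' - h y') - ((h x' - h x) - (h y' - h y)) by rewrite hx hy; ring.
    by rewrite (le_trans (cnB _ _))// lerD2l cnB.
  by rewrite cn1; lra.
have [f' [hf' f'M [eta eta0 etaP]]] :=
  generic_separation nm cU cW cM (holoZ 2 hh) sep hf e0.
exists f'; split=> //; exists (eta / 4); first by rewrite divr_gt0.
move=> j _ jf x' y' Ux Wy; have [k kP] := etaP x' y' Ux Wy; exists k => jE.
have h1 := jf k x' (or_introl Ux); have h2 := jf k y' (or_intror Wy).
have : cn (f' k x' - f' k y') <= cn (j k x' - f' k x') + cn (j k y' - f' k y').
  rewrite -[leRHS]addrC; have -> : f' k x' - f' k y' = (j k y' - f' k y') - (j k x' - f' k x').
    by rewrite jE; ring.
  exact: cnB.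
lra.
Qed.

Lemma diff_axpy (a : C) (f g : V -> C^o) (z w : V) :
  differentiable f z -> differentiable g z ->
  differentiable (fun v => a * f v + g v : C^o) z /\
  'd (fun v => a * f v + g v : C^o) z w = a * 'd f z w + 'd g z w.
Proof.
move=> df dg; have da : differentiable (a *: f) z by exact: differentiableZ.
split; first exact: (differentiableD da dg).
transitivity ('d (a *: f) z w + 'd g z w).
  exact: (congr1 (fun h : V -> C^o => h w) (diffD da dg)).
by congr (_ + _); exact: (congr1 (fun h : V -> C^o => h w) (diffZ a df)).
Qed.

Lemma diff_combination (I : Type) (s : seq I) (a : I -> C) (g : I -> V -> C^o) (z w : V) :
  (forall i, differentiable (g i) z) ->
  differentiable (fun v => \sum_(i <- s) a i * g i v : C^o) z /\
  'd (fun v => \sum_(i <- s) a i * g i v : C^o) z w = \sum_(i <- s) a i * 'd (g i) z w.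
Proof.
move=> dg; elim: s => [|i s [ih1 ih2]].
  under eq_fun do rewrite big_nil; rewrite big_nil; split; first exact: differentiable_cst.
  by rewrite diff_cst.
have E : (fun v => \sum_(i <- i :: s) a i * g i v : C^o) =
    (fun v => a i * g i v + \sum_(i <- s) a i * g i v : C^o).
  by apply/funext => v; rewrite big_cons.
rewrite E big_cons -ih2; exact: diff_axpy.
Qed.

Lemma unit_coord (w : V) : vn w = 1 -> exists i, 1 <= cn (w ord0 i).
Proof.
move=> w1; apply: contrapT => /forallNP N.
have : vn w <= \big[Order.max/0]_i cn (w ord0 i).
  apply: vn_rV_le; last by move=> i; exact: le_bigmax.
  exact: bigmax_ge_id.
rewrite w1 leNgt => /negP; apply; apply: bigmax_lt => // i _.
by rewrite ltNge; apply/negP; exact: N.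
Qed.

(** ['d f v w] is linear and bounded in [w], and Lipschitz in [v] by the Lipschitz estimate for the
    holomorphic function [u => 'd f u w]. *)
Lemma diff_tame (f : V -> C^o) (z : V) (p M : R) cell : 0 < p -> holV f z (8 * p) ->
  (forall w, vn (w - z) < 8 * p -> cn (f w) <= M) ->
  (exists2 K : R, 0 <= K & forall q (x y : V * V), (0 < q)%N -> vn (x.1 - z) <= p -> vn (y.1 - z) <= p ->
     vn (x.2 - 0) <= 1 -> vn (y.2 - 0) <= 1 -> cell q x = cell q y ->
     vn (x.1 - y.1) * q%:R <= K /\ vn (x.2 - y.2) * q%:R <= K) ->
  tame [set x : V * V | vn (x.1 - z) <= p /\ vn x.2 = 1] cell (fun x => 'd f (x.1) (x.2)).
Proof.
move=> p0 hf fM [K K0 KP].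
have p20 : 0 < 2 * p by lra. have p40 : 0 < 4 * p by lra.
have fsub v : vn (v - z) < 5 * p -> holV f v (2 * p) /\
    (forall w, vn (w - v) < 2 * p -> cn (f w) <= M).
  move=> vz; split.
    by apply: (holV_sub hf); have := vn_ge0 (v - z); lra.
  move=> w wv; apply: fM; have := vnD (w - v) (v - z); rewrite addrA subrK; lra.
have db v w : vn (v - z) < 5 * p -> cn ('d f v w) <= 2 * M / p * vn w.
  move=> /fsub[h1 h2]; have := holV_diff_bound p20 h1 h2 w.
  by have -> : 4 * M / (2 * p) = 2 * M / p by field; exact: lt0r_neq0.
have M0 : 0 <= M.
  by apply: le_trans (cn_ge0 (f z)) (fM z _); rewrite subrr vn0; lra.
have Mp0 : 0 <= M / p by rewrite divr_ge0// ltW.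
have lip v v' w : vn (v - z) <= p -> vn (v' - z) <= p -> vn w = 1 ->
    cn ('d f v' w - 'd f v w) <= 2 * (M / p) / p * vn (v' - v).
  move=> vz v'z w1.
  have hg : holV (fun u => 'd f u w : C^o) v (4 * p).
    move=> u uv; apply: (holV_diff (f := f) w p0); apply: (holV_sub hf).
    by have := vnD (u - v) (v - z); rewrite addrA subrK; clear -uv vz p0; lra.
  have gM u : vn (u - v) < 4 * p -> cn ('d f u w) <= 2 * M / p.
    move=> uv; have := @db u w; rewrite w1 mulr1; apply.
    by have := vnD (u - v) (v - z); rewrite addrA subrK; clear -uv vz p0; lra.
  have vv : vn (v' - v) <= 4 * p / 2.
    by have := vnB (v' - z) (v - z); rewrite opprB addrA subrK; clear -vz v'z; lra.
  have := holV_lipschitz p40 hg gM vv; rewrite [v + _]addrC subrK /=.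
  by have -> : 4 * (2 * M / p) / (4 * p) = 2 * (M / p) / p by field; rewrite lt0r_neq0.
pose D := 2 * (M / p) / p.
have D0 : 0 <= D by rewrite divr_ge0 ?(ltW p0)// mulr_ge0.
exists (D * K + 2 * M / p * K).
  by rewrite addr_ge0// mulr_ge0// -mulrA mulr_ge0.
move=> q [v w] [v' w'] q0 [/= vz w1] [/= v'z w'1] E.
have qp : (0 : R) <= q%:R by [].
have [] := KP q (v, w) (v', w') q0 vz v'z _ _ E; rewrite /= ?subr0 ?w1 ?w'1// => K1 K2.
have L1 := lip v' v w v'z vz w1; have v'5 : vn (v' - z) < 5 * p by clear -v'z p0; lra.
have L2 := db v' (w - w') v'5.
have T : cn ('d f v w - 'd f v' w') <= D * vn (v - v') + 2 * M / p * vn (w - w').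
  apply: (@le_trans _ _ (cn ('d f v w - 'd f v' w) + cn ('d f v' (w - w')))); last exact: lerD.
  have -> : 'd f v w - 'd f v' w' = ('d f v w - 'd f v' w) + 'd f v' (w - w').
    have gen (a b b' c : C) : c = b - b' -> a - b' = (a - b) + c.
      by move=> ->; rewrite [RHS]addrA subrK.
    exact: gen (linearB ('d f v') w w').
  exact: cnD.
apply: (le_trans (ler_wpM2r qp T)); rewrite mulrDl; apply: lerD.
  by rewrite -mulrA; apply: ler_wpM2l.
rewrite -[leLHS]mulrA; apply: ler_wpM2l K2.
by rewrite -mulrA; apply: mulr_ge0.
Qed.

(** In the chart supplied by [stein] the coordinates are restrictions of global functions [Fi i],
    with the coordinate forms as differentials. Adding a small combination of them and applying
    [generic_matrix] to unit tangent vectors bounds the differential from below. *)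
Lemma generic_immersive (x : X) : exists U K, nbhs x U /\
  generic K (fun j => forall y, U y -> immersive_at j y).
Proof.
have [_ _ /(_ x)[F [c [hF gc cx cF]]]] := X_stein.
have [r r0 rP] := chart_ball cx; set z : V := cmap c x in rP.
pose p := r / 9; have p0 : 0 < p by rewrite divr_gt0.
have r9 : r = 9 * p by rewrite /p; field.
pose Bz (s : R) := cinv c @` [set v : V | vn (v - z) <= s].
have cB s : s < r -> compact (Bz s).
  move=> sr; apply: continuous_compact; last exact: compact_vball.
  apply: continuous_in_subspaceT => v /set_mem /= vt.
  by apply: cinv_cont; apply: rP; exact: le_lt_trans sr.
exists (cdom c `&` cmap c @^-1` [set v : V | vn (v - z) < p]), (Bz (2 * p)); split.
  apply: filterI; first exact: cdom_nbhs.
  by apply: (cmap_continuous cx); apply/(@nbhsV_P R V); exists p.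
split=> [|f M e hf cM e0]; first by apply: cB; lra.
pose Fi (i : 'I_n) (y : X) : C := F y ord0 i.
have hFi i : holo (Fi i).
  move=> c1 A1 v cv.
  exact: (@diff_coord R V n (F \o cinv c1) v i (hF c1 A1 v cv)).1.
have hol g : holo g -> holV (g \o cinv c : V -> C^o) z (8 * p).
  move=> hg v vz; have [y cy <-] : (cmap c @` cdom c) v by apply: rP; lra.
  exact: (holo_good hg gc cy).
have bnd g : holo g -> exists M : R, forall w : V, vn (w - z) < 8 * p -> cn ((g \o cinv c) w) <= M.
  move=> hg; have [B B0 BP] := holo_bounded hg (cB (8 * p) ltac:(lra)).
  by exists B => w wz; apply: BP; exists w => //=; exact: ltW.
have [c1 [b1 [K1 K10 P1]]] := cells_ball z p0.
have [c2 [b2 [K2 K20 P2]]] := cells_ball (0 : V) (ltr01 : 0 < (1 : R)).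
have [cell [cb cP]] := cells_pair b1 b2.
pose L := [set v : V * V | vn (v.1 - z) <= p /\ vn v.2 = 1].
have cellP : exists2 K : R, 0 <= K & forall q (x y : V * V), (0 < q)%N -> vn (x.1 - z) <= p -> vn (y.1 - z) <= p ->
     vn (x.2 - 0) <= 1 -> vn (y.2 - 0) <= 1 -> cell q x = cell q y ->
     vn (x.1 - y.1) * q%:R <= K /\ vn (x.2 - y.2) * q%:R <= K.
  exists (K1 + K2); first exact: addr_ge0.
  move=> q v w q0 v1 w1 v2 w2 /cP[E1 E2].
  split; [apply: le_trans (P1 _ _ _ q0 v1 w1 E1) _|apply: le_trans (P2 _ _ _ q0 v2 w2 E2) _].
    by rewrite lerDl.
  by rewrite lerDr.
have tf k : tame L cell (fun v => 'd (f k \o cinv c : V -> C^o) (v.1) (v.2)).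
  have [B BP] := bnd _ (hf k); exact: diff_tame p0 (hol _ (hf k)) BP cellP.
have tF (i : 'I_n) : tame L cell (fun v => v.2 ord0 i).
  have [K K0 KP] := cellP; exists K => // q v w q0 [v1 v2] [w1 w2] E.
  have [] := KP q v w q0 v1 w1 _ _ E; rewrite ?subr0 ?v2 ?w2// => _; apply: le_trans.
  by have := cn_coord (v.2 - w.2) i; rewrite !mxE => ?; rewrite ler_wpM2r.
have MFi i := holo_bounded (hFi i) cM.
pose MF i := projT1 (cid2 (MFi i)).
have MF0 i : 0 <= MF i by rewrite /MF; case: cid2.
have MFP i y : M y -> cn (Fi i y) <= MF i by rewrite /MF; case: cid2 => /= ? ?; exact.
pose S := \sum_i MF i.
have S0 : 0 < S + 1 by have := @sumr_ge0 R _ (index_enum 'I_n) xpredT MF (fun i _ => MF0 i); rewrite -/S; clear; lra.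
have nm' : (n * 2 + n * 2 < m)%N by rewrite addnn.
have [A [eta [eta0 Ae AP]]] := @generic_matrix R _ L (n * 2 + n * 2) cell m n
  (fun i v => v.2 ord0 i) (fun k v => 'd (f k \o cinv c : V -> C^o) (v.1) (v.2)) _ (divr_gt0 e0 S0)
  nm' cb tF tf (fun v Lv => unit_coord Lv.2).
pose f' k y := f k y + \sum_i A k i * Fi i y.
have hf' k : holo (f' k) by apply: holoD => //; apply: holo_sum => i; exact: holoZ.
exists f'; split=> //.
  move=> k y My; rewrite /f' addrAC subrr add0r (le_trans (cn_sum _))//.
  apply: (@le_trans _ _ (\sum_i e / (S + 1) * MF i)).
    by apply: ler_sum => i _; rewrite cnM ler_pM ?cn_ge0// MFP.
  rewrite -mulr_sumr -/S -mulrA ler_piMr ?(ltW e0)// mulrC ler_pdivrMr//; lra.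
have dF i v w : vn (v - z) <= p -> 'd (Fi i \o cinv c : V -> C^o) v w = w ord0 i.
  move=> vz; have [y cy vy] : (cmap c @` cdom c) v by apply: rP; lra.
  have nE : {near v, (fun u : V => u ord0 i : C^o) =1 Fi i \o cinv c}.
    rewrite -vy; have := cimg_nbhs cy; apply: filterS => u [y' cy' <-].
    by rewrite /Fi /= cmapK// cF.
  have Di : differentiable (id : V -> V) v by exact: ex_diff.
  have [Did dE] := @diff_coord R V n id v i Di.
  have [_ ->] := near_eq_diff nE Did; rewrite dE.
  by congr (_ ord0 i); rewrite diff_val.
have df' k v w : vn (v - z) <= p -> 'd (f' k \o cinv c : V -> C^o) v w =
    'd (f k \o cinv c : V -> C^o) v w + \sum_i A k i * w ord0 i.
  move=> vz; have v8 : vn (v - z) < 8 * p by lra.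
  have [d1 d2] := diff_combination (index_enum 'I_n) (A k) w (fun i => hol _ (hFi i) v v8).
  rewrite (eq_bigr _ (fun i _ => congr1 (fun t => A k i * t) (dF i v w vz))) in d2.
  rewrite -d2.
  have D := diffD (hol _ (hf k) v v8) d1.
  exact: (congr1 (fun h : V -> C^o => h w) D).
(* The Cauchy estimate on a p-ball turns this error into at most [eta / 2] for the differential at
   unit vectors, less than the lower bound [eta]. *)
exists (eta * p / 8); first by rewrite divr_gt0// mulr_gt0.
move=> j hj jf y [cy /= yz]; exists c; split=> // w w0.
have w0' : 0 < vn w by rewrite vn_gt0.
pose u := ((vn w)^-1)%:C%C *: w.
have u1 : vn u = 1.
  by rewrite vnZ cn_real ger0_norm ?invr_ge0 ?vn_ge0// mulVf// gt_eqF.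
have [k kP] := AP (cmap c y, u) (conj (ltW yz) u1).
exists k; apply/eqP => dw.
have du : 'd (j k \o cinv c : V -> C^o) (cmap c y) u = 0 by rewrite linearZ/= dw scaler0.
have hD : holV ((fun y => f' k y - j k y) \o cinv c : V -> C^o) (cmap c y) p.
  apply: (holV_sub (hol _ (holoB (hf' k) (hj k)))); lra.
have DM (v : V) : vn (v - cmap c y) < p -> cn (((fun y => f' k y - j k y) \o cinv c) v) <= eta * p / 8.
  move=> vy; rewrite /= cnC; apply: jf; exists v => //=.
  have := vnD (v - cmap c y) (cmap c y - z); rewrite addrA subrK; clear -vy yz; lra.
have y8 : vn (cmap c y - z : V) < 8 * p by clear -yz p0; lra.
have D := congr1 (fun h : V -> C^o => h u) (diffB (hol _ (hf' k) _ y8) (hol _ (hj k) _ y8)).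
have gen (a b b' t : C) (s : R) : a = b - b' -> cn a <= s -> b' = 0 -> b = t -> cn t <= s.
  by move=> -> H b0 <-; rewrite b0 subr0 in H.
have := gen _ _ _ _ _ D (holV_diff_bound p0 hD DM u) du (df' k _ u (ltW yz)).
move: kP => /= kP kP'; have := le_trans kP kP'; rewrite u1 mulr1.
have -> : 4 * (eta * p / 8) / p = eta / 2 by field; exact: lt0r_neq0.
lra.
Qed.

End GenericProperties.

(** * The limit map *)

Section Construction.
Variables (R : realType) (n : nat) (X : complex_manifold R n) (m : nat).
Local Notation C := R[i].
Local Notation holo := (@holo R n X).
Local Notation T := (bool -> 'I_m -> X -> C).
Hypothesis X_stein : stein X.
Hypothesis nm : ((n * 2).*2 < m)%N.
Variables (M : nat -> set X) (Q : nat -> seq X) (O : nat -> X -> set X).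
Variables (bl : nat -> X -> bool) (d : nat -> X -> bool -> 'I_m -> C).
Variables (B dl : nat -> R) (K : nat -> set X) (P : nat -> set ('I_m -> X -> C)).
Hypothesis cM : forall k, compact (M k).
Hypothesis hullM : forall k, holomorphic_hull (M k) `<=` (M k.+1)^°.
Hypothesis coverM : forall x, exists k, M k x.
Hypothesis uQ : forall l, uniq (Q l).
Hypothesis cO : forall l q, q \in Q l -> compact (O l q) /\ nbhs q (O l q).
Hypothesis dO : forall l p q x, p \in Q l -> q \in Q l -> O l p x -> O l q x -> p = q.
Hypothesis OM : forall l q x, q \in Q l -> O l q x ->
  M l.+1.*2 x /\ ~ holomorphic_hull (M l.*2.+1) x.
Hypothesis dl0 : forall l, 0 < dl l.
Hypothesis KP : forall l, generic (K l) (P l).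
Hypothesis KM : forall l, K l `<=` M l.+1.*2.

(** The shell of block [b] runs from index [l.*2.+1 + b] to [l.+1.*2 + b]; over all [l] the shells
    of [false] and [true] alternate and leave no gap. *)
Definition stage_goal l (j : T) := [/\
  forall b k q, q \in Q l -> cn (j b k q - d l q b k) <= dl l,
  forall (b : bool) x, (M (l.+1.*2 + b) `\` (M (l.*2.+1 + b))^°) x ->
    (forall q, q \in Q l -> ~ O l q x) -> exists k, B l <= cn (j b k x),
  forall q x, q \in Q l -> O l q x -> (exists b k, B l <= cn (j b k x)) \/
    forall k, cn (j (bl l q) k x - d l q (bl l q) k) <= 1 &
  P l (j false)].

Lemma sub_hull (A : set X) : compact A -> A `<=` holomorphic_hull A.
Proof.
move=> cA x Ax f hf; have [S S0 SP] := holo_bounded hf cA.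
apply: sup_upper_bound; last by exists x.
by split; [exists (cn (f x)), x|exists S => _ [z Kz <-]; exact: SP].
Qed.

Lemma M_int k x : M k x -> (M k.+1)^° x.
Proof. by move=> Mx; apply: hullM; exact: sub_hull. Qed.

Lemma M_le i k : (i <= k)%N -> M i `<=` M k.
Proof.
elim: k => [|k ih]; first by rewrite leqn0 => /eqP ->.
rewrite leq_eqVlt => /predU1P[->//|/ih H] x /H Mx; exact: interior_subset (M_int Mx).
Qed.

Lemma hull_mono (A A' : set X) : compact A' -> A `<=` A' ->
  holomorphic_hull A `<=` holomorphic_hull A'.
Proof.
move=> cA' AA x Hx f hf.
have [S S0 SP] := holo_bounded hf cA'.
have [[y Ay]|N] := pselect (exists y, A y); last first.
  have E : [set ComplexField.Normc.normc (f y) | y in A] = set0.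
    by apply/seteqP; split=> // t [y Ay _]; apply: N; exists y.
  have := Hx f hf; rewrite E sup0 => /le_trans; apply.
  have [[y Ay]|N'] := pselect (exists y, A' y).
    by apply: le_trans (cn_ge0 (f y)) _; apply: sup_upper_bound;
      [split; [exists (cn (f y)), y|exists S => _ [z Kz <-]; exact: SP]|exists y].
  rewrite (_ : [set _ | _ in A'] = set0) ?sup0//.
  by apply/seteqP; split=> // t [y Ay _]; apply: N'; exists y.
apply: (le_trans (Hx f hf)); apply: ge_sup; first by exists (cn (f y)), y.
move=> _ [z Az <-]; apply: sup_upper_bound; last by exists z => //; exact: AA.
by split; [exists (cn (f y)), y => //; exact: AA|exists S => _ [w Kw <-]; exact: SP].
Qed.

(** [stage], followed by a generic perturbation of the block [false] alone. The number [dt] is what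
    later stages may still change without spoiling the goal. *)
Lemma stage_step l (f : T) (e : R) : (forall b k, holo (f b k)) -> 0 < e ->
  exists f' : T, [/\ forall b k, holo (f' b k),
    forall (b : bool) k x, M (l.*2 + b) x -> cn (f' b k x - f b k x) <= e &
    exists2 dt : R, 0 < dt & forall j : T, (forall b k, holo (j b k)) ->
      (forall (b : bool) k x, M (l.+1.*2 + b) x -> cn (j b k x - f' b k x) <= dt) -> stage_goal l j].
Proof.
move=> hf e0; have e20 : 0 < e / 2 by rewrite divr_gt0.
pose Mb (b : bool) := M (l.*2 + b).
pose Sb (b : bool) := M (l.+1.*2 + b) `\` (M (l.*2.+1 + b))^°.
have cS b : compact (Sb b) by apply: compact_diff => //; exact: open_interior.
have SM b x : Sb b x -> ~ holomorphic_hull (Mb b) x.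
  by move=> [_ N] H; apply: N; rewrite addSn; exact: hullM.
have OM' b q x : q \in Q l -> O l q x -> ~ holomorphic_hull (Mb b) x.
  move=> qQ /(OM qQ)[_ N] H; apply: N; apply: hull_mono H => //.
  by apply: M_le; rewrite -addn1 leq_add2l; case: b.
(* The surplus in [B l + 1], and the bound 1/2 in [stage] where the goal asks for 1, absorb the
   perturbation and all later changes, together at most [eta]. *)
have [f1 [hf1 f1M f1Q f1S f1O]] := @stage R n X X_stein m Mb Sb (Q l) (O l) (bl l)
  (fun b k q => d l q b k) f (e / 2) (B l + 1) nm e20 (fun b => @cM _) cS SM OM' (@uQ l)
  (@cO l) (@dO l) hf.
pose eta := Num.min (dl l) (1 / 2).
have eta0 : 0 < eta by rewrite lt_min dl0; lra.
have eta1 : eta <= dl l by rewrite ge_min lexx.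
have eta2 : eta <= 1 / 2 by rewrite ge_min lexx orbT.
pose e' := Num.min (e / 2) (eta / 2).
have e'0 : 0 < e' by rewrite lt_min e20 divr_gt0.
have e'1 : e' <= e / 2 by rewrite ge_min lexx.
have e'2 : e' <= eta / 2 by rewrite ge_min lexx orbT.
have [_ gen] := KP l.
have [f2 [hf2 f2M [dt dt0 dtP]]] := gen (f1 false) (M l.+1.*2) e' (hf1 false) (@cM _) e'0.
pose f' b := if b then f1 true else f2.
have f'1 (b : bool) k x : M (l.+1.*2 + b) x -> cn (f' b k x - f1 b k x) <= e'.
  case: b => /= [_|]; first by rewrite subrr cn0 ltW.
  by rewrite addn0; exact: f2M.
exists f'; split.
- by case=> k; [exact: hf1|exact: hf2].
- move=> b k x Mx; have -> : f' b k x - f b k x = (f' b k x - f1 b k x) + (f1 b k x - f b k x).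
    by rewrite addrA subrK.
  have := cnD (f' b k x - f1 b k x) (f1 b k x - f b k x); have := f1M b k x Mx.
  have Mx' : M (l.+1.*2 + b) x by apply: M_le Mx; rewrite leq_add2r leq_double.
  by have := f'1 b k x Mx'; lra.
exists (Num.min dt (eta / 2)); first by rewrite lt_min dt0 divr_gt0.
move=> j hj jf'.
have j1 (b : bool) k x : M (l.+1.*2 + b) x -> cn (j b k x - f1 b k x) <= eta.
  move=> Mx; have -> : j b k x - f1 b k x = (j b k x - f' b k x) + (f' b k x - f1 b k x).
    by rewrite addrA subrK.
  have := cnD (j b k x - f' b k x) (f' b k x - f1 b k x); have := f'1 b k x Mx.
  by have := jf' b k x Mx; rewrite le_min => /andP[_]; lra.
have M2 (b : bool) x : M l.+1.*2 x -> M (l.+1.*2 + b) x by apply: M_le; exact: leq_addr.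
have large (b : bool) k x : M (l.+1.*2 + b) x -> B l + 1 <= cn (f1 b k x) -> B l <= cn (j b k x).
  by move=> /(j1 b k) jf ?; have := cnBr (f1 b k x) (j b k x); rewrite cnC; lra.
have OMx (b : bool) q x : q \in Q l -> O l q x -> M (l.+1.*2 + b) x.
  by move=> qQ Ox; apply: M2; have [] := OM qQ Ox.
split.
- move=> b k q qQ; rewrite -(f1Q b k q qQ); apply: le_trans eta1; apply: j1.
  by apply: (OMx _ q) => //; have [_] := cO qQ; exact: nbhs_singleton.
- by move=> b x Sx /(f1S b x Sx)[k kP]; exists k; apply: large kP; have [] := Sx.
- move=> q x qQ Ox; have [[b [k kP]]|H] := f1O q x qQ Ox.
    by left; exists b, k; apply: large kP; exact: OMx Ox.
  right=> k; have -> : j (bl l q) k x - d l q (bl l q) k = (j (bl l q) k x - f1 (bl l q) k x) +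
    (f1 (bl l q) k x - d l q (bl l q) k) by rewrite addrA subrK.
  have := cnD (j (bl l q) k x - f1 (bl l q) k x) (f1 (bl l q) k x - d l q (bl l q) k).
  by have := H k; have := j1 (bl l q) k x (OMx _ _ _ qQ Ox); lra.
- apply: dtP => // k x Kx; have := jf' false k x; rewrite addn0 => /(_ (KM Kx)).
  by rewrite le_min => /andP[].
Qed.

(** The tolerances at least halve, so the changes after step [l] add up to at most [2 * E l], an
    amount that [NX] has made harmless for the preceding stage. *)
Lemma construction : exists j : T, (forall b k, holo (j b k)) /\ forall l, stage_goal l j.
Proof.
pose St := {s : T * R | (forall b k, holo (s.1 b k)) /\ 0 < s.2 }.
have NX (l : nat) (s : St) : exists s' : St, 
    (forall (b : bool) k x, M (l.*2 + b) x -> cn ((sval s').1 b k x - (sval s).1 b k x) <= (sval s).2) /\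
    (sval s').2 <= (sval s).2 / 2 /\
    forall j : T, (forall b k, holo (j b k)) ->
      (forall (b : bool) k x, M (l.+1.*2 + b) x -> cn (j b k x - (sval s').1 b k x) <= 2 * (sval s').2) ->
      stage_goal l j.
  case: s => -[f e] /= [hf e0].
  have [f' [hf' f'M [dt dt0 dtP]]] := stage_step l hf e0.
  have e'0 : 0 < Num.min e dt / 2 by rewrite divr_gt0// lt_min e0.
  exists (exist _ (f', Num.min e dt / 2) (conj hf' e'0)); split=> //=; split.
    by rewrite ler_pM2r ?invr_gt0// ge_min lexx.
  move=> j hj jM; apply: dtP => // b k x Mx; apply: (le_trans (jM b k x Mx)).
  by rewrite mulrC divfK// ge_min lexx orbT.
pose nx l s := projT1 (cid (NX l s)).
pose s0 : St := exist _ ((fun _ _ _ => 0), 1) (conj (fun _ _ => @holo_cst R n X 0) ltr01).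
pose S := fix S l := if l is l'.+1 then nx l' (S l') else s0.
pose F l := (sval (S l)).1; pose E l := (sval (S l)).2.
have E0 l : 0 < E l by rewrite /E; case: (S l) => ? [].
have hF l b k : holo (F l b k) by rewrite /F; case: (S l) => ? [].
have step l := projT2 (cid (NX l (S l))).
have F1 l (b : bool) k x : M (l.*2 + b) x -> cn (F l.+1 b k x - F l b k x) <= E l.
  by have [H _] := step l; exact: H.
have E1 l : E l.+1 <= E l / 2 by have [_ [H _]] := step l.
have Fgoal l (j : T) : (forall b k, holo (j b k)) ->
   (forall (b : bool) k x, M (l.+1.*2 + b) x -> cn (j b k x - F l.+1 b k x) <= 2 * E l.+1) -> stage_goal l j.
  by have [_ [_ H]] := step l; exact: H.
have tel l i (b : bool) k x : M (l.*2 + b) x -> cn (F (l + i)%N b k x - F l b k x) <= 2 * (E l - E (l + i)%N).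
  move=> Mx; elim: i => [|i ih]; first by rewrite addn0 !subrr cn0 mulr0.
  rewrite addnS; set p := (l + i)%N in ih *.
  have Mp : M (p.*2 + b) x by apply: M_le Mx; rewrite leq_add2r leq_double leq_addr.
  have -> : F p.+1 b k x - F l b k x = (F p.+1 b k x - F p b k x) + (F p b k x - F l b k x).
    by rewrite addrA subrK.
  have := cnD (F p.+1 b k x - F p b k x) (F p b k x - F l b k x).
  by have := F1 p b k x Mp; have := E1 p; lra.
have Epow l i : E (l + i)%N <= E l / 2 ^+ i.
  elim: i => [|i ih]; first by rewrite addn0 expr0 divr1.
  rewrite addnS exprS invfM mulrA mulrAC; apply: (le_trans (E1 _)).
  by rewrite ler_pM2r ?invr_gt0.
have Edec l i : E (l + i)%N <= E l.
  apply: (le_trans (Epow l i)); rewrite ler_piMr ?(ltW (E0 l))// invf_le1 ?exprn_gt0//.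
  by rewrite exprn_ege1// ler1n.
have L b k x : exists z : C, forall e : R, 0 < e ->
    exists i0, forall i, (i0 <= i)%N -> cn (F i b k x - z) <= e.
  have [i0 Mi0] := coverM x.
  have Mx i : M ((i0 + i).*2 + b) x by apply: M_le Mi0; rewrite -addnn; lia.
  have [i p ip|z zP] := @cauchy_limit R (fun i => F (i0 + i)%N b k x) (2 * E i0).
    have := tel (i0 + i)%N (p - i)%N b k x (Mx i); rewrite -addnA subnKC// => /le_trans; apply.
    by have := Epow i0 i; have := E0 (i0 + p)%N; rewrite -mulrA; lra.
  exists z => e e0.
  have b0 : 0 < 4 * (2 * E i0) by rewrite !mulr_gt0.
  have [k0 k0P] := @small_power R (1 / 2) (e / (4 * (2 * E i0))) ltac:(lra) ltac:(lra) (divr_gt0 e0 b0).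
  exists (i0 + k0)%N => i ik; have -> : i = (i0 + (i - i0))%N by lia.
  apply: (le_trans (zP (i - i0)%N)).
  have := k0P (i - i0)%N ltac:(lia); rewrite expr_div_n expr1n ler_pdivlMr//.
  by rewrite mul1r mulrC.
pose j b k x := projT1 (cid (L b k x)).
have jP b k x : forall e : R, 0 < e -> exists i0, forall i, (i0 <= i)%N -> cn (F i b k x - j b k x) <= e :=
  projT2 (cid (L b k x)).
have jF l (b : bool) k x : M (l.*2 + b) x -> cn (j b k x - F l b k x) <= 2 * E l.
  move=> Mx; apply/ler_addgt0Pr => e e0; have [i0 /(_ (l + i0)%N (leq_addl _ _))] := jP b k x e e0.
  have := tel l i0 b k x Mx; have := E0 (l + i0)%N.
  have := cnD (j b k x - F (l + i0)%N b k x) (F (l + i0)%N b k x - F l b k x).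
  by rewrite addrA subrK cnC; lra.
exists j; have hj b k : holo (j b k).
  apply: (@holo_limit _ _ _ (fun i => F i b k)) => [i|x|x e e0]; [exact: hF| |exact: jP].
  have [i0 Mi0] := coverM x; pose p := i0.+1.
  exists (M (p.*2 + b)).
    have : (M i0.+1)^° x by exact: M_int.
    by apply: filterS; apply: M_le; rewrite /p -addnn; lia.
  have W i := holo_bounded (hF i b k) (@cM (p.*2 + b)).
  pose w i := projT1 (cid2 (W i)).
  have w0 i : 0 <= w i by rewrite /w; case: cid2.
  have wP i y : M (p.*2 + b) y -> cn (F i b k y) <= w i by rewrite /w; case: cid2 => /= ? ?; exact.
  exists (\sum_(i < p.+1) w i + 2 * E p) => i y My.
  have ws i' : (i' < p.+1)%N -> w i' <= \sum_(i < p.+1) w i.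
    move=> ip; rewrite (bigD1 (Ordinal ip))//= lerDl; exact: sumr_ge0.
  have [ip|ip] := ltnP i p.+1.
    by have := ws i ip; have := wP i y My; have := E0 p; lra.
  have := tel p (i - p)%N b k y My; rewrite subnKC ?(ltnW ip)//.
  have := cnD (F i b k y - F p b k y) (F p b k y); rewrite subrK.
  by have := ws p (ltnSn p); have := wP p y My; have := E0 i; lra.
split; first exact: hj.
by move=> l; apply: (Fgoal l j hj) => b k x Mx; exact: jF.
Qed.

End Construction.

(** * Automorphisms of the affine space avoiding nets *)

Section RosayRudin.
Variable R : realType.
Local Notation C := R[i].

Lemma cn_prod (I : Type) (s : seq I) (F : I -> C) : cn (\prod_(i <- s) F i) = \prod_(i <- s) cn (F i).
Proof.
elim: s => [|i s ih]; last by rewrite !big_cons cnM ih.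
by rewrite !big_nil cn1.
Qed.

Lemma cn_sign (b : nat) : cn ((-1) ^+ b : C) = 1.
Proof. by rewrite cnX cnN cn1 expr1n. Qed.

Lemma det_bound N (b : R) : 0 <= b -> exists2 B : R, 0 <= B & forall A : 'M[C]_N,
  (forall i k, cn (A i k) <= b) -> cn (\det A) <= B.
Proof.
move=> b0; exists (\sum_(s : 'S_N) \prod_(i < N) b).
  by apply: sumr_ge0 => s _; apply: prodr_ge0.
move=> A Ab; rewrite /determinant (le_trans (cn_sum _))//; apply: ler_sum => s _.
by rewrite cnM cn_sign mul1r cn_prod; apply: ler_prod => i _; rewrite cn_ge0 Ab.
Qed.

(** [\det A *: v] equals [v *m A *m \adj A], and the entries of the adjugate are bounded. *)
Lemma det_expansion N (b : R) : 0 <= b -> exists2 B : R, 0 < B & forall (A : 'M[C]_N) (e : R) (v : Cspace R N),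
  (forall i k, cn (A i k) <= b) -> e <= cn (\det A) -> e * vn v <= B * vn (v *m A : Cspace R N).
Proof.
move=> b0; have [B B0 BP] := @det_bound N.-1 b b0.
exists (N%:R * B + 1); first by have := mulr_ge0 (ler0n R N) B0; lra.
move=> A e v Ab eA; apply: (@le_trans _ _ (cn (\det A) * vn v)).
  by rewrite ler_wpM2r ?vn_ge0.
rewrite -vnZ; apply: (@le_trans _ _ (N%:R * B * vn (v *m A : Cspace R N))); last first.
  by rewrite ler_wpM2r ?vn_ge0//; lra.
apply: vn_rV_le; first by rewrite !mulr_ge0 ?vn_ge0.
move=> i; have -> : \det A *: v = v *m A *m \adj A by rewrite -mulmxA mul_mx_adj mul_mx_scalar.
rewrite mxE (le_trans (cn_sum _))//.
apply: (@le_trans _ _ (\sum_(k < N) vn (v *m A : Cspace R N) * B)).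
  apply: ler_sum => k _; rewrite cnM ler_pM ?cn_ge0//; first exact: cn_coord.
  by rewrite mxE /cofactor cnM cn_sign mul1r; apply: BP => i' k'; rewrite !mxE.
by rewrite sumr_const card_ord -[_ *+ N]mulr_natl mulrCA mulrC.
Qed.

Lemma differentiable_prod N (I : Type) (s : seq I) (g : I -> Cspace R N -> C^o) z :
  (forall i, differentiable (g i) z) -> differentiable (fun v => \prod_(i <- s) g i v : C^o) z.
Proof.
move=> dg; elim: s => [|i s ih].
  by under eq_fun do rewrite big_nil; exact: differentiable_cst.
under eq_fun do rewrite big_cons; exact: differentiableM.
Qed.

(** [propagation_ball] along a chain of [L] balls with centres at most [r / 4] apart. That [d] is
    chosen before [f] makes the net constant independent of the automorphism. *)
Lemma propagation_segment N (r k M e : R) L : 0 < r -> 0 < k -> k <= r / 2 -> 0 < e ->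
  exists2 d : R, 0 < d & forall (f : Cspace R N -> C^o) (a : R) x y,
    (forall u, vn u <= a -> holV f u r /\ forall w, vn (w - u) < r -> cn (f w) <= M) ->
    vn x <= a -> vn y <= a -> vn (y - x) <= L%:R * (r / 4) ->
    (forall w, vn (w - x) <= k -> cn (f w) <= d) -> cn (f y) <= e.
Proof.
move=> r0; elim: L k => [|L ih] k k0 kr e0.
  exists e => // f a x y _ _ _; rewrite mul0r => xy; apply; exact: le_trans xy (ltW k0).
have r40 : 0 < r / 4 by rewrite divr_gt0.
have [d' d'0 d'P] := ih (r / 4) r40 ltac:(lra) e0.
have [d d0 dP] := @propagation_ball R (Cspace R N) r k M d' k0 kr d'0.
exists d => // f a x y fa xa ya xy fd.
have L0 : (0 : R) < L.+1%:R by rewrite ltr0n.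
pose s : R := L.+1%:R^-1; have s0 : 0 < s by rewrite invr_gt0.
have s1 : s <= 1 by rewrite invf_le1// ler1n.
pose x' := x + s%:C%C *: (y - x).
have xx' : vn (x' - x) <= r / 4.
  rewrite /x' addrAC subrr add0r vnZ cn_real gtr0_norm//.
  by rewrite /s mulrC ler_pdivrMr// mulrC.
have x'y : vn (y - x') <= L%:R * (r / 4).
  have -> : y - x' = (1 - s)%:C%C *: (y - x).
    by rewrite /x' opprD addrA rmorphB rmorph1 scalerBl scale1r.
  rewrite vnZ cn_real ger0_norm ?subr_ge0//.
  have -> : L%:R * (r / 4) = (1 - s) * (L.+1%:R * (r / 4)).
    rewrite /s; move: L0; rewrite -(natr1 L); move: (L%:R : R) => t t0.
    by field; exact: lt0r_neq0.
  by apply: ler_wpM2l => //; rewrite subr_ge0.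
have x'a : vn x' <= a.
  have -> : x' = (1 - s)%:C%C *: x + s%:C%C *: y.
    rewrite /x' scalerBr rmorphB rmorph1 scalerBl scale1r -[RHS]addrA.
    by congr (_ + _); exact: addrC.
  rewrite (le_trans (vnD _ _))// !vnZ !cn_real ger0_norm ?subr_ge0// gtr0_norm//.
  have -> : a = (1 - s) * a + s * a by ring.
  by apply: lerD; [apply: ler_wpM2l => //; rewrite subr_ge0|apply: ler_wpM2l => //; exact: ltW].
have [h1 h2] := fa x xa.
apply: (d'P f a x' y fa x'a ya x'y) => w wx'.
apply: (dP f x h1 h2 fd); have := vnD (w - x') (x' - x); rewrite addrA subrK; clear -wx' xx'; lra.
Qed.

Section Jacobian.
Variables (N : nat) (F : Cspace R N -> Cspace R N).
Hypothesis dF : forall z, differentiable F z.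
Local Notation V := (Cspace R N).

(** The transposed Jacobian matrix: vectors are rows, so the differential is [v *m jac z]. *)
Definition jac (z : V) : 'M[C]_N :=
  \matrix_(i, k) 'd (fun v => F v ord0 k : C^o) z (delta_mx ord0 i).

Lemma coord_holV k z r : holV (fun v => F v ord0 k : C^o) z r.
Proof. by move=> w _; have [] := @diff_coord R V N F w k (dF w). Qed.

Lemma jacE k z (v : V) : 'd (fun v => F v ord0 k : C^o) z v = (v *m jac z) ord0 k.
Proof.
rewrite [in LHS](row_sum_delta v) linear_sum mxE; apply: eq_bigr => i _.
by rewrite mxE; exact: linearZ.
Qed.

Lemma differentiable_det z : differentiable (fun v => \det (jac v) : C^o) z.
Proof.
have E : (fun v => \det (jac v) : C^o) = (fun v => \sum_(s : 'S_N) (-1) ^+ s *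
    \prod_i 'd (fun u => F u ord0 (s i) : C^o) v (delta_mx ord0 i) : C^o).
  by apply/funext => v; apply: eq_bigr => s _; congr (_ * _); apply: eq_bigr => i _; rewrite mxE.
rewrite E; apply: (@diff_combination R N _ _ _ _ z 0 _).1 => s.
apply: differentiable_prod => i.
exact: (@holV_diff _ _ _ _ 1 (delta_mx ord0 i) ltr01 (@coord_holV (s i) z 1)).
Qed.

Lemma delta_le1 i : vn (delta_mx ord0 i : V) <= 1.
Proof.
apply: vn_rV_le => // k; rewrite mxE; case: (_ && _); last by rewrite cn0.
by rewrite cn1.
Qed.

Lemma jac_bound z (r M : R) : 0 < r -> (forall w, vn (w - z) < r -> vn (F w) <= M) ->
  forall i k, cn (jac z i k) <= 4 * M / r.
Proof.
move=> r0 FM i k; rewrite mxE.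
have := holV_diff_bound r0 (@coord_holV k z r) (fun w wz => le_trans (cn_coord _ _) (FM w wz)) (delta_mx ord0 i).
move/le_trans; apply; rewrite ler_piMr ?delta_le1// divr_ge0 ?(ltW r0)// mulr_ge0//.
by apply: le_trans (vn_ge0 _) (FM z _); rewrite subrr vn0.
Qed.

Lemma taylor_vec z (r M : R) v : 0 < r -> (forall w, vn (w - z) < r -> vn (F w) <= M) ->
  vn v <= r / 4 -> vn (F (z + v) - F z - v *m jac z) <= 64 * M / r ^+ 2 * vn v ^+ 2.
Proof.
move=> r0 FM vr; have M0 : 0 <= M.
  by apply: le_trans (vn_ge0 _) (FM z _); rewrite subrr vn0.
apply: vn_rV_le; first by rewrite mulr_ge0 ?sqr_ge0// divr_ge0 ?sqr_ge0// mulr_ge0.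
move=> k; rewrite !mxE.
have := holV_taylor r0 (@coord_holV k z r) (fun w wz => le_trans (cn_coord _ _) (FM w wz)) vr.
by rewrite jacE !mxE.
Qed.

Lemma lipschitz_vec z (r M : R) v : 0 < r -> (forall w, vn (w - z) < r -> vn (F w) <= M) ->
  vn v <= r / 2 -> vn (F (z + v) - F z) <= 4 * M / r * vn v.
Proof.
move=> r0 FM vr; have M0 : 0 <= M.
  by apply: le_trans (vn_ge0 _) (FM z _); rewrite subrr vn0.
apply: vn_rV_le; first by rewrite mulr_ge0 ?vn_ge0// divr_ge0 ?(ltW r0)// mulr_ge0.
move=> k; rewrite !mxE.
by have := holV_lipschitz r0 (@coord_holV k z r) (fun w wz => le_trans (cn_coord _ _) (FM w wz)) vr.
Qed.

End Jacobian.

Lemma segment_ivt (V W : normedModType C) (H : V -> W) (x y : V) (q : W) (s : R) :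
  continuous H -> vn (H x - q) <= s -> s <= vn (H y - q) ->
  exists2 t : R, 0 <= t <= 1 & vn (H (x + t%:C%C *: (y - x)) - q) = s.
Proof.
move=> cH xs sy; pose g (t : R) := vn (H (x + t%:C%C *: (y - x)) - q).
have cg : continuous g.
  move=> t; apply/cvgrPdist_lt => e e0.
  have /continuous_vn/(_ e e0)[d d0 dP] := cH (x + t%:C%C *: (y - x)).
  have b0 : 0 < vn (y - x) + 1 by have := vn_ge0 (y - x); lra.
  apply/nbhs_ballP; exists (d / (vn (y - x) + 1)); first by rewrite /= divr_gt0.
  move=> t'; rewrite /ball/= ltr_pdivlMr// => tt.
  have : vn (x + t'%:C%C *: (y - x) - (x + t%:C%C *: (y - x))) < d.
    rewrite opprD addrACA subrr add0r -scalerBl -rmorphB vnZ cn_real distrC.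
    by apply: le_lt_trans tt; rewrite ler_wpM2l ?normr_ge0//; lra.
  move=> /dP; set a := H _; set b := H _ => ab.
  rewrite /g -/b -/a; apply: (le_lt_trans _ ab).
  have := vnD (b - a) (a - q); have := vnD (a - b) (b - q); rewrite !addrA !subrK [vn (b - a)]vnC.
  by rewrite ler_norml; lra.
have [||t] := @IVT R g 0 1 s ler01.
- exact: continuous_subspaceT.
- rewrite ge_min le_max /g scale0r addr0 scale1r [x + _]addrC subrK.
  by rewrite xs sy orbT.
by rewrite in_itv/=; exists t.
Qed.

(** If [F] exceeded [S + h] on the ball, it would reach the middle of the shell at some [zs]. Near
    [zs] there is a point [z'] where the Jacobian determinant is not small; there [F] is open with a
    quantitative radius, so its image catches a point of [D]. *)
Theorem rosay_rudin N (A eta M e0 h : R) : 0 < eta -> 0 < M -> 0 < e0 -> 0 < h ->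
  exists2 c : R, 0 < c & forall (F Fi : Cspace R N -> Cspace R N),
    (forall z, differentiable F z) -> continuous Fi -> cancel F Fi -> cancel Fi F ->
    forall (a S : R) z0 (D : set (Cspace R N)), vn z0 <= a -> a <= A ->
    e0 <= cn (\det (jac F z0)) -> (forall z, vn z < a + eta -> vn (F z) <= M) ->
    vn (F z0) <= S ->
    (forall w, S <= vn w <= S + h -> exists2 p, D p & vn (p - w) < c) ->
    (forall z, vn z < a + eta -> ~ D (F z)) ->
    forall z, vn z <= a -> vn (F z) <= S + h.
Proof.
move=> eta0 M0 e00 h0.
pose r := eta / 2; have r0 : 0 < r by rewrite divr_gt0.
pose b := 4 * M / r; have b0 : 0 <= b by rewrite ltW// divr_gt0// mulr_gt0.
have [DB DB0 DBP] := @det_bound N b b0.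
have [B B0 BP] := @det_expansion N b b0.
have [L LP] := @nat_above R (2 * A / (r / 4)).
(* By the second bound [F] stays within [h / 4] of [F zs] on the k-ball, as [4 * M / eta] is a
   Lipschitz constant. *)
pose k := Num.min (eta / 8) (h * eta / (16 * M)).
have k0 : 0 < k by rewrite lt_min !divr_gt0// mulr_gt0.
have k1 : k <= eta / 8 by rewrite ge_min lexx.
have k2 : k <= h * eta / (16 * M) by rewrite ge_min lexx orbT.
have [dd dd0 ddP] := @propagation_segment N r k DB (e0 / 2) L r0 k0
  ltac:(rewrite /r; lra) (divr_gt0 e00 (ltr0Sn R 1)).
pose c1 := dd / B; have c10 : 0 < c1 by rewrite divr_gt0.
pose K := 64 * M / r ^+ 2; have K0 : 0 < K by rewrite divr_gt0 ?exprn_gt0// mulr_gt0.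
(* On the sphere of radius [rho] the quadratic Taylor error [K * rho ^+ 2] takes at most half of the
   linear growth [c1 * rho]. *)
pose rho := Num.min (eta / 8) (c1 / (2 * K)).
have rho0 : 0 < rho by rewrite lt_min !divr_gt0// mulr_gt0.
have rho1 : rho <= eta / 8 by rewrite ge_min lexx.
have rho2 : rho <= c1 / (2 * K) by rewrite ge_min lexx orbT.
exists (c1 * rho / 2); first by rewrite divr_gt0// mulr_gt0.
move=> F Fi dF cFi FK FiK a S z0 D z0a aA dz0 FM Fz0 Dd FD z1 z1a.
rewrite leNgt; apply/negP => Fz1.
have cF : continuous F by move=> z; exact: differentiable_continuous.
have [||t /andP[t0 t1]] := @segment_ivt _ _ F z0 z1 0 (S + h / 2) cF; rewrite ?subr0; [lra|lra|].
set zs := z0 + _ => Fzs.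
have zsa : vn zs <= a.
  have -> : zs = (1 - t)%:C%C *: z0 + t%:C%C *: z1.
    rewrite /zs scalerBr rmorphB rmorph1 scalerBl scale1r -[RHS]addrA.
    by congr (_ + _); exact: addrC.
  rewrite (le_trans (vnD _ _))// !vnZ !cn_real ger0_norm ?subr_ge0// ger0_norm//.
  have -> : a = (1 - t) * a + t * a by ring.
  by apply: lerD; apply: ler_wpM2l => //; rewrite subr_ge0.
have sub (u w : Cspace R N) (s s' : R) : vn u <= s -> vn (w - u) < s' -> vn w < s + s'.
  by move=> us wu; have := vnD (w - u) u; rewrite subrK; clear -us wu; lra.
have jb u : vn u < a + r -> forall i l, cn (jac F u i l) <= b.
  move=> ua; apply: (jac_bound dF r0) => w wu; apply: FM.
  have := sub u w (vn u) r (lexx _) wu; rewrite /r in ua *; clear -ua; lra.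
(* Otherwise the determinant is at most [dd] on the k-ball around [zs], and this smallness
   propagates to [z0]. *)
have [z' z'zs dz'] : exists2 z', vn (z' - zs) <= k & dd < cn (\det (jac F z')).
  apply: contrapT => N1; move: dz0; apply/negP; rewrite -ltNge.
  apply: (@le_lt_trans _ _ (e0 / 2)); last by lra.
  apply: (ddP (fun z => \det (jac F z)) a zs z0) => //.
  - move=> u ua; split; first by move=> w _; exact: differentiable_det.
    by move=> w wu; apply: DBP; apply: jb; exact: sub ua wu.
  - have : 2 * A <= L%:R * (r / 4) by rewrite -ler_pdivrMr// divr_gt0.
    by have := vnB z0 zs; clear -z0a zsa aA; lra.
  - by move=> w wz; rewrite leNgt; apply/negP => dw; apply: N1; exists w.
have z'a : vn z' <= a + eta / 8 by have := vnD (z' - zs) zs; rewrite subrK; clear -z'zs zsa k1; lra.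
have FM' w : vn (w - z') < r -> vn (F w) <= M.
  by move=> wz; apply: FM; have := sub _ _ _ _ z'a wz; rewrite /r; clear -eta0; lra.
have low v : vn v = rho -> c1 * rho / 2 <= vn (F (z' + v) - F z').
  move=> vr; have vr4 : vn v <= r / 4 by rewrite vr /r; clear -rho1; lra.
  have T := taylor_vec dF r0 FM' vr4; rewrite vr -/K in T.
  have J : c1 * rho <= vn (v *m jac F z' : Cspace R N).
    have := BP (jac F z') dd v (jb z' _) (ltW dz'); rewrite vr => H.
    rewrite /c1 mulrAC ler_pdivrMr// mulrC [leRHS]mulrC mulrC; apply: H.
    by apply: le_lt_trans z'a _; rewrite /r; clear -eta0; lra.
  have Kr : K * rho ^+ 2 <= c1 * rho / 2.
    have : K * rho <= c1 / 2.
      have := ler_wpM2l (ltW K0) rho2.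
      by have -> : K * (c1 / (2 * K)) = c1 / 2 by field; exact: lt0r_neq0.
    by move=> /(ler_wpM2r (ltW rho0)); rewrite expr2 mulrA; clear; lra.
  have := vnB (F (z' + v) - F z') (F (z' + v) - F z' - v *m jac F z').
  rewrite opprB addrC subrK; clear -J Kr T; lra.
have Fz'zs : vn (F z' - F zs) <= h / 4.
  have e2 : vn (z' - zs) <= eta / 2 by clear -k1 eta0 z'zs; lra.
  have := @lipschitz_vec N F dF zs eta M (z' - zs) eta0 _ e2.
  rewrite [zs + _]addrC subrK => H; apply: (le_trans (H _)).
    by move=> w wz; apply: FM; exact: sub wz.
  have : 4 * M / eta * vn (z' - zs) <= 4 * M / eta * (h * eta / (16 * M)).
    by apply: ler_wpM2l; [rewrite ltW// divr_gt0// mulr_gt0|exact: le_trans k2].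
  move=> /le_trans; apply; rewrite le_eqVlt; apply/orP; left; apply/eqP.
  by field; rewrite !lt0r_neq0.
have [p Dp pz'] : exists2 p, D p & vn (p - F z') < c1 * rho / 2.
  apply: Dd; have := vnD (F z' - F zs) (F zs); have := vnD (F zs - F z') (F z').
  by rewrite !subrK [vn (F zs - _)]vnC Fzs; clear -Fz'zs h0; lra.
(* If not, [Fi] maps a point of the segment from [F z'] to [p] onto the rho-sphere around [z']; by
   [low] that point is farther from [F z'] than [p] is. *)
have : vn (Fi p - z') < rho.
  rewrite ltNge; apply/negP => big.
  have [||s /andP[s0 s1]] := @segment_ivt _ _ Fi (F z') p z' rho cFi; [by rewrite FK subrr vn0 ltW|exact: big|].
  set w := F z' + _ => wrho.
  have := low _ wrho; rewrite [z' + _]addrC subrK FiK /w [F z' + _]addrC addrK vnZ cn_real ger0_norm//.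
  apply/negP; rewrite -ltNge; apply: le_lt_trans pz'.
  by rewrite ler_piMl ?vn_ge0.
move=> /(sub _ _ _ _ z'a) zp; apply: (FD (Fi p)); last by rewrite FiK.
by clear -zp rho1 eta0; lra.
Qed.

End RosayRudin.

(** * Descent through the nets *)

Section Descent.
Variable R : realType.
Local Notation C := R[i].

Lemma vn_continuous (V : normedModType C) : continuous (fun w : V => vn w).
Proof.
move=> w A /nbhs_ballP[e /= e0 eA]; apply/(@nbhsV_P R V).
exists e => // u uw; apply: eA; rewrite /ball/=; apply: (le_lt_trans _ uw).
have := vnD (u - w) w; have := vnD (w - u) u; rewrite !subrK [vn (w - u)]vnC ler_norml; lra.
Qed.

Lemma annulus_net N (s t c : R) : 0 < c -> exists D : seq (Cspace R N),
  (forall p, p \in D -> s <= vn p <= t) /\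
  forall w : Cspace R N, s <= vn w <= t -> exists2 p, p \in D & vn (p - w) < c.
Proof.
move=> c0; pose L := [set w : Cspace R N | s <= vn w <= t].
have cv := @vn_continuous (Cspace R N).
have cL : compact L.
  apply: (subclosed_compact _ (@compact_vball R N 0 t)) => [|w /= /andP[_]]; last by rewrite subr0.
  have -> : L = (fun w : Cspace R N => vn w) @^-1` `[s, t].
    by apply/seteqP; split=> w /=; rewrite in_itv.
  by apply: closed_comp => [w _|]; [exact: cv|exact: interval_closed].
have [p _|D [DL DP]] := compact_finite_cover (f := fun p => [set w : Cspace R N | vn (p - w) < c]) cL.
  by apply/(@nbhsV_P R (Cspace R N)); exists c => // w; rewrite vnC.
by exists D; split=> // w Lw; exact: DP.
Qed.

Lemma bounded_vball N (F : Cspace R N -> Cspace R N) (a : R) : continuous F ->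
  exists B : R, forall z, vn z <= a -> vn (F z) <= B.
Proof.
move=> cF; have [z _|D [_ DP]] := compact_finite_cover
    (f := fun p => [set w : Cspace R N | vn (F w - F p) < 1]) (@compact_vball R N 0 a).
  have /continuous_vn/(_ 1 ltr01)[d d0 dP] := cF z.
  by apply/(@nbhsV_P R (Cspace R N)); exists d.
exists (\sum_(p <- D) vn (F p) + 1) => z za.
have [|p pD /= zp] := DP z; first by rewrite /= subr0.
have : vn (F p) <= \sum_(p <- D) vn (F p).
  rewrite (big_rem p pD)/= lerDl; apply: sumr_ge0 => *; exact: vn_ge0.
by have := vnD (F z - F p) (F p); rewrite subrK; lra.
Qed.

(** Half of the constant of [rosay_rudin] pays for the fineness of the net, the other half for the
    perturbation [dl s] of its points. *)
Theorem descent_nets N : exists (D : nat -> seq (Cspace R N)) (dl : nat -> R),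
  [/\ forall s, 0 < dl s,
    forall s p, p \in D s -> 8 * s%:R + 4 <= vn p <= 8 * s%:R + 5 &
    forall (F Fi : Cspace R N -> Cspace R N) z0 s0,
      (forall z, differentiable F z) -> continuous Fi -> cancel F Fi -> cancel Fi F ->
      vn z0 <= 8 * s0%:R + 1 -> vn (F z0) <= 8 * s0%:R + 4 ->
      (s0%:R + 1)^-1 <= cn (\det (jac F z0)) ->
      (forall s p, (s0 <= s)%N -> p \in D s -> exists2 q, vn (q - p) <= dl s & 8 * s%:R + 3 <= vn (Fi q)) ->
      forall z, vn z <= 8 * s0%:R + 1 -> vn (F z) <= 8 * s0%:R + 5].
Proof.
have sp (s : nat) : (0 : R) < s%:R + 1 by rewrite ltr_wpDl.
have p2 i : (0 : R) < 2 ^+ i by rewrite exprn_gt0.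
(* The bound [8 s + 13] is the conclusion [8 (s + 1) + 5] of the level above. The lower bound
   [(s + 1)^-1] for the determinant becomes weaker with [s], so one base point serves all levels
   from [s0] on. *)
have CC s := @rosay_rudin R N (8 * s%:R + 2) (2 ^+ s.+2)^-1 (8 * s%:R + 13) (s%:R + 1)^-1 1
  ltac:(by rewrite invr_gt0) ltac:(have := sp s; lra) ltac:(by rewrite invr_gt0) ltr01.
pose c s := projT1 (cid2 (CC s)).
have c0 s : 0 < c s by rewrite /c; case: cid2.
have NN s := @annulus_net N (8 * s%:R + 4) (8 * s%:R + 5) (c s / 2) ltac:(by rewrite divr_gt0).
pose D s := projT1 (cid (NN s)).
have DP s : (forall p, p \in D s -> 8 * s%:R + 4 <= vn p <= 8 * s%:R + 5) /\
  forall w : Cspace R N, 8 * s%:R + 4 <= vn w <= 8 * s%:R + 5 -> exists2 p, p \in D s & vn (p - w) < c s / 2.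
  exact: projT2 (cid (NN s)).
exists D, (fun s => c s / 2); split.
- by move=> s; rewrite divr_gt0.
- by move=> s; have [] := DP s.
move=> F Fi z0 s0 dF cFi FK FiK z0a Fz0 dz0 esc.
have cF : continuous F by move=> z; exact: differentiable_continuous.
have [B BP] := bounded_vball (8 * s0%:R + 2) cF.
have [T TB] := nat_above B.
(* The radii start at [8 s0 + 1] and stay below [8 s0 + 2]; the gap from [b i] to [b i.+1]
   accommodates the margin [eta] of level [s0 + i]. *)
pose b i : R := 8 * s0%:R + 2 - (2 ^+ i)^-1.
have binc i : b i + (2 ^+ (s0 + i).+2)^-1 <= b i.+1.
  rewrite /b exprS invfM.
  have : ((2 : R) ^+ (s0 + i).+2)^-1 <= (2 ^+ i.+1)^-1.
    by rewrite lef_pV2 ?posrE// ler_eXn2l ?ltr1n//; lia.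
  by rewrite [2 ^+ i.+1]exprS invfM; lra.
have b0 i : 8 * s0%:R + 1 <= b i <= 8 * s0%:R + 2.
  have : ((2 : R) ^+ i)^-1 <= 1 by rewrite invf_le1// exprn_ege1// ler1n.
  have : (0 : R) < (2 ^+ i)^-1 by rewrite invr_gt0.
  by rewrite /b; lra.
(* Induction downward in the level. At [i = T.+1] the claim holds because [F] is bounded by [T] on
   the largest ball. *)
suff H k : forall i, (i + k = T.+1)%N -> forall z, vn z <= b i -> vn (F z) <= 8 * (s0 + i)%:R + 5.
  by move=> z za; have := H T.+1 0%N erefl z; rewrite addn0; apply; have := b0 0%N; lra.
elim: k => [|k ih] i ik z zb.
  have /BP : vn z <= 8 * s0%:R + 2 by have := b0 i; lra.
  rewrite addn0 in ik; rewrite ik natrD -natr1; have := ler0n R s0; have := ler0n R T; lra.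
have Hi := ih i.+1 ltac:(lia).
have s01 : (s0%:R : R) <= (s0 + i)%:R by rewrite ler_nat leq_addr.
set s := (s0 + i)%N in s01 *.
have esc' p := esc s p (leq_addr _ _); have [_ net] := DP s.
move: esc' net; rewrite /c; case: (cid2 (CC s)) => x x0 xP /= esc' net.
have bi := b0 i; have bs : b i <= 8 * s%:R + 2 by lra.
have -> : 8 * s%:R + 5 = 8 * s%:R + 4 + 1 :> R by lra.
apply: (xP F Fi dF cFi FK FiK (b i) (8 * s%:R + 4) z0 [set q | 8 * s%:R + 3 <= vn (Fi q)]) => //.
- by lra.
- by apply: le_trans dz0; rewrite lef_pV2 ?posrE//; lra.
- move=> u ub; have ub' : vn u <= b i.+1 by have := binc i; rewrite -/s; clear -ub; lra.
  have := Hi u ub'.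
  by rewrite addnS -natr1 -/s; lra.
- by lra.
- move=> w wS; have [|p pD pw] := net w; first lra.
  have [q qp qF] := esc' p pD; exists q => //.
  by have := vnD (q - p) (p - w); rewrite addrA subrK; lra.
move=> u ub /=; rewrite FK => us.
have : (2 ^+ s.+2 : R)^-1 <= 1 by rewrite invf_le1// exprn_ege1// ler1n.
by lra.
Qed.

End Descent.

(** * Neighbourhoods and group actions on compact sets *)

Section Geometry.
Variables (R : realType) (n : nat) (X : complex_manifold R n).
Local Notation C := R[i].

Lemma outside_nbhd (A : set X) x : compact A -> ~ A x ->
  exists O, [/\ compact O, nbhs x O & forall y, O y -> ~ A y].
Proof.
move=> cA Ax; apply: (@X_locally_compact R n X).
apply: open_nbhs_nbhs; split=> //; apply: closed_openC.
by apply: compact_closed => //; exact: X_hausdorff.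
Qed.

Lemma separating_nbhd (x y : X) : x <> y ->
  exists O, [/\ compact O, nbhs x O & nbhs y (~` O)].
Proof.
move=> xy; have [| O [cO xO OO]] := @outside_nbhd [set y] x (@compact_set1 _ y); first exact: xy.
exists O; split=> //; apply: open_nbhs_nbhs; split; last by move=> /OO; apply.
by apply: closed_openC; apply: compact_closed => //; exact: X_hausdorff.
Qed.

Lemma compact_nbhd (A : set X) : compact A -> exists2 A', compact A' & A `<=` A'^°.
Proof.
move=> cA; have F (x : X) : exists2 O, compact O & nbhs x O.
  by have [ O []] := @X_locally_compact R n X x setT filterT; exists O.
pose f x := projT1 (cid2 (F x)).
pose f' x := (f x)^°.
have [x _|s [_ sP]] := compact_finite_cover (f := f') cA.
  by rewrite /f' /f; case: cid2 => /= O _; exact: nbhs_interior.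
exists [set x | exists2 y, y \in s /\ xpredT y & f y x].
  by apply: compact_bigunion => y _; rewrite /f; case: cid2.
move=> x /sP[y ys yx]; apply: filterS yx => z fz; by exists y.
Qed.

Lemma nbhs_seq (T : topologicalType) (I : eqType) (x : T) (s : seq I) (f : I -> set T) :
  (forall y, y \in s -> nbhs x (f y)) -> nbhs x [set z | forall y, y \in s -> f y z].
Proof.
elim: s => [|y s ih] H; first by apply: filterS filterT => z _ y.
have N : nbhs x (f y `&` [set z | forall y, y \in s -> f y z]).
  by apply: filterI; [exact: (H y (mem_head _ _))|apply: ih => z zs; apply: H; rewrite inE zs orbT].
by apply: filterS N => z [fy fs] w; rewrite inE => /predU1P[->|/fs].
Qed.

Section Action.
Variables (G : topologicalType) (act : G -> X -> X).
Hypothesis act_cont : continuous (fun p : G * X => act p.1 p.2).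
Hypothesis act_inj : forall g, injective (act g).

Lemma act_compact (KG : set G) (A : set X) : compact KG -> compact A ->
  compact [set act p.1 p.2 | p in KG `*` A].
Proof.
move=> cK cA; apply: continuous_compact; last exact: compact_setX.
exact: continuous_subspaceT.
Qed.

Lemma act_contl x : continuous (act^~ x).
Proof.
move=> g; apply: (@continuous_comp _ _ _ (fun g => (g, x)) (fun p : G * X => act p.1 p.2)).
  by apply: cvg_pair; [exact: cvg_id|exact: cvg_cst].
exact: act_cont.
Qed.

(* If [g p] belonged to the initial segment of [F] ending at [p] for every [p],
   then the injective map [g] would fix all of [F]. *)
Lemma moved_points_choice (K : set G) (A : set X) : compact K -> compact A ->
  (forall g, K g -> exists2 x, ~ A x & act g x <> x) ->
  exists (F : seq X) (O : X -> set X), [/\ uniq F,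
    forall p, p \in F -> [/\ compact (O p), nbhs p (O p) & forall y, O p y -> ~ A y],
    forall p q x, p \in F -> q \in F -> O p x -> O q x -> p = q &
    forall g, K g -> exists2 p, p \in F &
      forall q, q \in F -> (index q F <= index p F)%N -> ~ O q (act g p)].
Proof.
move=> cK cA mv.
have [[x0 _]|N] := pselect (exists x : X, True); last first.
  exists [::], (fun=> set0); split=> // g /mv[x _]; by exfalso; apply: N; exists x.
pose xg g := if pselect (K g) is left Kg then projT1 (cid2 (mv g Kg)) else x0.
have xgP g : K g -> ~ A (xg g) /\ act g (xg g) <> xg g.
  by move=> Kg; rewrite /xg; case: pselect => // Kg'; case: cid2.
have [g Kg|s [sK sP]] := compact_finite_cover (f := fun g => [set h | act h (xg g) <> xg g]) cK.
  apply: (@act_contl (xg g) g (~` [set xg g])).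
  apply: open_nbhs_nbhs; split; last by have [] := xgP g Kg.
  by apply: closed_openC; apply: compact_closed; [exact: X_hausdorff|exact: compact_set1].
pose F := undup [seq xg g | g <- s].
have FA p : p \in F -> ~ A p.
  by rewrite mem_undup => /mapP[g /sK /xgP[] + _ ->].
have FK g : K g -> exists2 p, p \in F & forall q, q \in F -> (index q F <= index p F)%N -> act g p <> q.
  move=> Kg; apply: contrapT => N.
  have fix_all : forall k p, p \in F -> (index p F < k)%N -> act g p = p.
    elim=> // k ih p pF pk; apply: contrapT => gp; apply: N; exists p => // q qF qp gpq.
    move: qp; rewrite leq_eqVlt => /predU1P[qp|qp].
      by apply: gp; rewrite gpq -(nth_index x0 qF) qp nth_index.
    have := ih q qF (leq_trans qp pk); rewrite -gpq => /act_inj gpp.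
    exact: gp.
  have [h hs] := sP g Kg; apply.
  have hF : xg h \in F by rewrite mem_undup map_f.
  exact: (fix_all _ _ hF (ltnSn _)).
pose pg g := if pselect (K g) is left Kg then projT1 (cid2 (FK g Kg)) else x0.
have pgP g : K g -> pg g \in F /\ forall q, q \in F -> (index q F <= index (pg g) F)%N -> act g (pg g) <> q.
  by move=> Kg; rewrite /pg; case: pselect => // Kg'; case: cid2.
have Sep (x y : X) : exists O, x <> y -> [/\ compact O, nbhs x O & nbhs y (~` O)].
  have [->|/separating_nbhd[ O OP]] := pselect (x = y); first by exists set0.
  by exists O.
pose S x y := projT1 (cid (Sep x y)).
have SP x y : x <> y -> [/\ compact (S x y), nbhs x (S x y) & nbhs y (~` S x y)] :=
  projT2 (cid (Sep x y)).
(* For [h] in [U g] the image of [pg g] avoids a fixed neighbourhood of each [q] up to [pg g].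
   Finitely many [g] therefore serve all of [K], and the sets [O q] can be chosen afterwards. *)
pose U g := [set h | forall q, q \in [seq q <- F | (index q F <= index (pg g) F)%N] ->
   (~` S q (act g (pg g))) (act h (pg g))].
have [g Kg|t [tK tP]] := compact_finite_cover (f := U) cK.
  apply: nbhs_seq => q; rewrite mem_filter => /andP[qi qF].
  have [_ /(_ q qF qi) /nesym /SP[_ _ H]] := pgP g Kg.
  exact: (act_contl H).
have OE p : exists O, p \in F -> [/\ compact O, nbhs p O, forall y, O y -> ~ A y,
    forall g y, g \in t -> (index p F <= index (pg g) F)%N -> O y -> S p (act g (pg g)) y &
    forall q y, q \in F -> q <> p -> O y -> S p q y /\ ~ S q p y].
  have [pF|pF] := boolP (p \in F); last by exists set0.
  have [ O1 [cO1 nO1 O1A]] := outside_nbhd cA (FA p pF).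
  have n2 : nbhs p [set y | forall g, g \in [seq g <- t | (index p F <= index (pg g) F)%N] ->
      S p (act g (pg g)) y].
    apply: nbhs_seq => g; rewrite mem_filter => /andP[gi gt].
    by have [_ /(_ p pF gi) /nesym /SP[_ + _]] := pgP g (tK g gt).
  have n3 : nbhs p [set y | forall q, q \in [seq q <- F | q != p] -> S p q y /\ (~` S q p) y].
    apply: nbhs_seq => q; rewrite mem_filter => /andP[/eqP qp qF].
    have [_ h1 _] := SP p q (nesym qp); have [_ _ h2] := SP q p qp; exact: filterI.
  have [ O2 [cO2 nO2 O2P]] := X_locally_compact (filterI nO1 (filterI n2 n3)).
  exists O2 => _; split=> //.
  - by move=> y /O2P[/O1A].
  - move=> g y gt gi /O2P[_ [+ _]]; apply; by rewrite mem_filter gi.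
  - by move=> q y qF /eqP qp /O2P[_ [_ /(_ q)]]; rewrite mem_filter qp => /(_ qF)[].
pose O p := projT1 (cid (OE p)).
have OP p : p \in F -> [/\ compact (O p), nbhs p (O p), forall y, O p y -> ~ A y,
    forall g y, g \in t -> (index p F <= index (pg g) F)%N -> O p y -> S p (act g (pg g)) y &
    forall q y, q \in F -> q <> p -> O p y -> S p q y /\ ~ S q p y] := projT2 (cid (OE p)).
exists F, O; split; first exact: undup_uniq.
- by move=> p /OP[].
- move=> p q x pF qF Op Oq; apply: contrapT => pq.
  have [_ _ _ _ /(_ q x qF (nesym pq) Op)[_ H]] := OP p pF.
  by have [_ _ _ _ /(_ p x pF pq Oq)[]] := OP q qF.
- move=> g /tP[h ht Uh]; have [hF _] := pgP h (tK h ht).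
  exists (pg h) => // q qF qi Oq.
  have := Uh q; rewrite mem_filter qi => /(_ qF); apply.
  by have [_ _ _ H _] := OP q qF; exact: H.
Qed.

End Action.

End Geometry.

(** * Positions of the prescribed points *)

Section StageGeometry.
Variables (R : realType) (n : nat) (X : complex_manifold R n) (N : nat).
Variables (G : topologicalType) (act : G -> X -> X) (KG : set G) (H : set X).
Local Notation V := (Cspace R N).
Hypothesis act_cont : continuous (fun p : G * X => act p.1 p.2).
Hypothesis act_inj : forall g, injective (act g).
Hypothesis cKG : compact KG.
Hypothesis KG1 : exists2 g, KG g & forall x, act g x = x.
Hypothesis KGV : forall g, KG g -> exists2 g', KG g' & forall x, act g' (act g x) = x.
Hypothesis cH : compact H.
Hypothesis noncompact : forall A : set X, compact A -> exists x, ~ A x.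

Definition separated (Q : seq X) (O : X -> set X) := [/\ uniq Q,
  forall q, q \in Q -> compact (O q) /\ nbhs q (O q),
  forall q x, q \in Q -> O q x -> ~ H x &
  forall p q x, p \in Q -> q \in Q -> O p x -> O q x -> p = q].

(** Each new point [e] is taken off the compact set [KG] times the union of [H] and all earlier
    neighbourhoods. As [KG] is closed under inverses, its orbit avoids that union; and [Oe] avoids
    the images of the earlier points. Points added later therefore cannot catch the orbit of [e]
    either. *)
Lemma extend_points (W : seq V) (Q0 : seq X) (O0 : X -> set X) (d0 : X -> V) :
  separated Q0 O0 -> exists (Q : seq X) (O : X -> set X) (d : X -> V),
  [/\ separated Q O, forall q, q \in Q0 -> [/\ q \in Q, O q = O0 q & d q = d0 q],
    forall q, q \in Q -> q \notin Q0 -> d q \in W /\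
      forall g p, KG g -> p \in Q0 -> ~ O q (act g p) &
    forall w, w \in W -> exists2 e, e \in Q & d e = w /\
      forall g, KG g -> ~ H (act g e) /\ forall q, q \in Q -> O q (act g e) -> q = e].
Proof.
elim: W Q0 O0 d0 => [|w W ih] Q0 O0 d0 s0.
  by exists Q0, O0, d0; split=> // q qQ; rewrite qQ.
have [uQ cO OH dO] := s0.
pose A := H `|` [set x | exists2 q, q \in Q0 /\ xpredT q & O0 q x].
have cA : compact A.
  by apply: compactU => //; apply: compact_bigunion => q /cO[].
pose B := [set act p.1 p.2 | p in KG `*` A].
have cB : compact B by exact: act_compact.
have AB x : A x -> B x.
  by move=> Ax; have [g Kg gx] := KG1; exists (g, x) => //=; rewrite gx.
have gB g x : KG g -> A (act g x) -> B x.
  by move=> Kg Ax; have [g' Kg' gx] := KGV Kg; exists (g', act g x) => //=; rewrite gx.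
have QA q : q \in Q0 -> A q.
  by move=> qQ; right; exists q => //; have [_ /nbhs_singleton] := cO q qQ.
have [e eB] := noncompact cB; have [Oe [cOe nOe OeB]] := outside_nbhd cB eB.
have eQ : e \notin Q0 by apply/negP => /QA/AB.
pose O1 y := if y == e then Oe else O0 y.
pose d1 y := if y == e then w else d0 y.
have O1Q q : q \in Q0 -> O1 q = O0 q /\ d1 q = d0 q.
  by move=> qQ; rewrite /O1 /d1; case: eqP => // qe; rewrite -qe qQ in eQ.
have O1e : O1 e = Oe by rewrite /O1 eqxx.
have d1e : d1 e = w by rewrite /d1 eqxx.
have OeO q x : q \in Q0 -> Oe x -> ~ O1 q x.
  move=> qQ /OeB Bx; have [-> _] := O1Q q qQ => Ox; apply: Bx; apply: AB; right.
  by exists q.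
have [|Q [ O [d [sQ old new tgt]]]] := ih (e :: Q0) O1 d1.
  split; first by rewrite /= eQ.
  - move=> q; rewrite inE => /predU1P[->|qQ]; first by rewrite O1e.
    by have [-> _] := O1Q q qQ; exact: cO.
  - move=> q x; rewrite inE => /predU1P[->|qQ].
      by rewrite O1e => /OeB Bx Hx; apply: Bx; apply: AB; left.
    by have [-> _] := O1Q q qQ; exact: OH.
  - move=> p q x; rewrite !inE => /predU1P[->|pQ] /predU1P[->|qQ] //.
    + by rewrite O1e => /(OeO q x qQ).
    + by rewrite O1e => + /(OeO p x pQ).
    + by have [-> _] := O1Q q qQ; have [-> _] := O1Q p pQ; exact: dO.
have [eQ' Oee de] := old e (mem_head _ _).
exists Q, O, d; split=> //.
- move=> q qQ; have [qQ' -> ->] := old q ltac:(by rewrite inE qQ orbT).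
  by have [-> ->] := O1Q q qQ.
- move=> q qQ qN; have [qe|qe] := eqVneq q e.
    rewrite qe de d1e mem_head; split=> // g p Kg pQ; rewrite Oee O1e => /OeB; apply.
    by exists (g, p) => //; split=> //=; exact: QA.
  have [|dW Oq] := new q qQ; first by rewrite inE negb_or qe.
  split; first by rewrite inE dW orbT.
  by move=> g p Kg pQ; apply: Oq => //; rewrite inE pQ orbT.
- move=> v; rewrite inE => /predU1P[->|/tgt//]; exists e => //; split; first by rewrite de.
  move=> g Kg; split; first by move=> He; apply: eB; apply: (gB g e Kg); left.
  move=> q qQ Oq; have [qe//|qe] := eqVneq q e.
  have [qQ0|qQ0] := boolP (q \in Q0).
    have [_ OE _] := old q ltac:(by rewrite inE qQ0 orbT).
    exfalso; apply: eB; apply: (gB g e Kg); right; exists q => //.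
    by move: Oq; rewrite OE; have [-> _] := O1Q q qQ0.
  have [|_ Nq] := new q qQ; first by rewrite inE negb_or qe.
  by exfalso; exact: (Nq g e Kg (mem_head _ _)).
Qed.

(** The moved points receive norms that increase in steps of 8 along the list [F]. As [act g p]
    meets no neighbourhood of [p] or of an earlier point, the moved point can be near only to points
    with norm at least 8 larger. The nets of all levels in question are then added by
    [extend_points]. *)
Lemma stage_geometry (K : set G) (s : nat) (D : nat -> seq V) (u : V) :
  vn u = 1 -> compact K -> K `<=` KG ->
  (forall g (A : set X), K g -> compact A -> exists2 x, ~ A x & act g x <> x) ->
  (forall i w, w \in D i -> 8 * i%:R + 4 <= vn w) ->
  exists (k : nat) (Q : seq X) (O : X -> set X) (d : X -> V), [/\ separated Q O,
    forall q, q \in Q -> 8 * s%:R <= vn (d q),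
    forall g, K g -> exists2 p, p \in Q & exists2 i, (s <= i <= s + k)%N &
      [/\ vn (d p) = 8 * i%:R, ~ H (act g p) &
        forall q, q \in Q -> O q (act g p) -> 8 * i%:R + 8 <= vn (d q)] &
    forall i w, (s <= i <= s + k)%N -> w \in D i -> exists2 e, e \in Q & d e = w /\
      forall g, KG g -> ~ H (act g e) /\ forall q, q \in Q -> O q (act g e) -> q = e].
Proof.
move=> u1 cK KKG mv Db.
pose B := [set act p.1 p.2 | p in KG `*` H].
have cB : compact B by exact: act_compact.
have HB x : H x -> B x.
  by move=> Hx; have [g Kg gx] := KG1; exists (g, x) => //=; rewrite gx.
have gB g x : KG g -> H (act g x) -> B x.
  by move=> Kg Hx; have [g' Kg' gx] := KGV Kg; exists (g', act g x) => //=; rewrite gx.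
have [F [ O0 [uF FP dF Fmv]]] := moved_points_choice act_cont act_inj cK cB (fun g Kg => mv g B Kg cB).
pose d0 y : V := ((8 * (s + index y F)%:R : R)%:C%C : R[i]) *: u.
have d0E y : vn (d0 y) = 8 * (s + index y F)%:R.
  by rewrite vnZ u1 mulr1 cn_real ger0_norm.
pose W := flatten [seq D i | i <- iota s (size F).+1].
have WP w : w \in W <-> exists2 i, (s <= i <= s + size F)%N & w \in D i.
  split.
    by move=> /flattenP[_ /mapP[i + ->] wD]; rewrite mem_iota addnS ltnS => ?; exists i.
  by move=> [i si wD]; apply/flattenP; exists (D i) => //; apply: map_f; rewrite mem_iota addnS ltnS.
have [|Q [ O [d [sQ old new tgt]]]] := @extend_points W F O0 d0.
  split=> //.
  - by move=> q /FP[].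
  - by move=> q x /FP[_ _ H1] /H1 NB /HB.
exists (size F), Q, O, d; split=> //.
- move=> q qQ; have [qF|qF] := boolP (q \in F).
    by have [_ _ ->] := old q qF; rewrite d0E natrD; have := ler0n R (index q F); lra.
  have [/WP[i /andP[si _] /Db ge] _] := new q qQ qF.
  by rewrite -(ler_nat R) in si; lra.
- move=> g Kg; have [p pF pP] := Fmv g Kg; have [pQ _ dp] := old p pF.
  exists p => //; exists (s + index p F)%N.
    by rewrite leq_addr leq_add2l ltnW// index_mem.
  split; first by rewrite dp d0E.
    by move=> Hp; have [_ _ NA] := FP p pF; apply: (NA p);
      [have [_ /nbhs_singleton] := FP p pF|exact: (gB g p (KKG g Kg))].
  move=> q qQ Oq; have [qF|qF] := boolP (q \in F).
    have [_ OE ->] := old q qF; rewrite OE in Oq.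
    have : ~~ (index q F <= index p F)%N by apply/negP => /(pP q qF); apply.
    by rewrite -ltnNge -(ler_nat R) d0E !natrD -natr1; lra.
  have [_ Nq] := new q qQ qF; by exfalso; exact: (Nq g p (KKG g Kg) pF).
- by move=> i w si wD; apply: tgt; apply/WP; exists i.
Qed.

End StageGeometry.

(** * Assembly *)

Section JacobianInverse.
Variable R : realType.
Local Notation C := R[i].

Lemma vn_attained N (w : Cspace R N) : (0 < N)%N -> exists i, vn w <= cn (w ord0 i).
Proof.
move=> N0; apply: contrapT => /forallNP H.
have w0 : 0 < vn w.
  apply: le_lt_trans (cn_ge0 (w ord0 (Ordinal N0))) _.
  by rewrite ltNge; apply/negP; exact: H.
have : vn w <= \big[Order.max/0]_i cn (w ord0 i).
  apply: vn_rV_le; last by move=> i; exact: le_bigmax.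
  exact: bigmax_ge_id.
rewrite leNgt => /negP; apply; apply: bigmax_lt => // i _.
by rewrite ltNge; apply/negP; exact: H.
Qed.

Lemma det_jac_neq0 N (F Fi : Cspace R N -> Cspace R N) z :
  (forall z, differentiable F z) -> (forall z, differentiable Fi z) -> cancel F Fi ->
  \det (jac F z) != 0.
Proof.
move=> dF dFi FK; apply/negP => /det0P[v v0 vJ].
have dv : 'd F z v = 0.
  apply/rowP => k; have [_ <-] := @diff_coord R _ _ F z k (dF z).
  by rewrite jacE// vJ.
have nE : {near z, Fi \o F =1 id} by apply: filterE => y /=; rewrite FK.
have [_ E] := near_eq_diff nE (differentiable_comp (dF z) (dFi (F z))).
have : 'd id z v = 0.
  transitivity ('d (Fi \o F) z v); first exact: (congr1 (fun h => h v) E).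
  transitivity ('d Fi (F z) ('d F z v)).
    exact: (congr1 (fun h => h v) (diff_comp (dF z) (dFi (F z)))).
  exact: (eq_trans (congr1 ('d Fi (F z)) dv) (linear0 ('d Fi (F z)))).
by rewrite diff_val /= => vE; rewrite vE eqxx in v0.
Qed.

End JacobianInverse.

Record stage_data (X V : Type) := StageData {
  st_M : set X; st_next : set X; st_k : nat; st_Q : seq X; st_O : X -> set X; st_d : X -> V }.

Section Assembly.
Variables (R : realType) (n : nat) (X : complex_manifold R n) (m : nat).
Local Notation C := R[i].
Local Notation V := (Cspace R (m + m)).
Local Notation holo := (@holo R n X).
Variables (G : topologicalType) (act : G -> X -> X) (KG K : nat -> set G).
Variables (E TK : nat -> set X) (TP : nat -> set ('I_m -> X -> C)).
Hypothesis X_stein : stein X.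
Hypothesis nm : ((n * 2).*2 < m)%N.
Hypothesis act_cont : continuous (fun p : G * X => act p.1 p.2).
Hypothesis act_inj : forall g, injective (act g).
Hypothesis cKG : forall l, compact (KG l).
Hypothesis KG1 : forall l, exists2 g, KG l g & forall x, act g x = x.
Hypothesis KGV : forall l g, KG l g -> exists2 g', KG l g' & forall x, act g' (act g x) = x.
Hypothesis cK : forall l, compact (K l).
Hypothesis KKG : forall l, K l `<=` KG l.
Hypothesis moved : forall l g (A : set X), K l g -> compact A -> exists2 x, ~ A x & act g x <> x.
Hypothesis noncompact : forall A : set X, compact A -> exists x, ~ A x.
Hypothesis cE : forall l, compact (E l).
Hypothesis coverE : forall x, exists l, E l x.
Hypothesis TKP : forall l, generic (TK l) (TP l).

Definition stage_ok (D : nat -> seq V) l (A : set X) s (sd : stage_data X V) :=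
  let H := holomorphic_hull (st_M sd) in
  [/\ [/\ compact (st_M sd), holomorphic_hull A `<=` (st_M sd)^° & E l `<=` st_M sd],
    [/\ compact (st_next sd), H `<=` (st_next sd)^°, TK l `<=` st_next sd &
      forall q, q \in st_Q sd -> st_O sd q `<=` st_next sd],
    separated H (st_Q sd) (st_O sd) /\ (forall q, q \in st_Q sd -> 8 * s%:R <= vn (st_d sd q)),
    forall g, K l g -> exists2 p, p \in st_Q sd & exists2 i, (s <= i <= s + st_k sd)%N &
      [/\ vn (st_d sd p) = 8 * i%:R, ~ H (act g p) &
        forall q, q \in st_Q sd -> st_O sd q (act g p) -> 8 * i%:R + 8 <= vn (st_d sd q)] &
    forall i w, (s <= i <= s + st_k sd)%N -> w \in D i -> exists2 e, e \in st_Q sd & st_d sd e = w /\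
      forall g, KG l g -> ~ H (act g e) /\ forall q, q \in st_Q sd -> st_O sd q (act g e) -> q = e].

(** [M] is a compact neighbourhood of the hull of the previous set and of [E l]; the next set
    encloses the hull of [M], the test set [TK l] and all [O q]. *)
Lemma stage_exists D l A s : (forall i w, w \in D i -> 8 * i%:R + 4 <= vn w) -> compact A ->
  exists sd, stage_ok D l A s sd.
Proof.
move=> Db cA; have [hc _ _] := X_stein.
have [M cM MP] := compact_nbhd (compactU (hc A cA) (@cE l)).
pose H := holomorphic_hull M; have cH : compact H by exact: hc.
have m0 : (0 < m)%N by apply: leq_ltn_trans nm.
have i0 : 'I_(m + m) by exists 0%N; rewrite addn_gt0 m0.
have u1 : vn (delta_mx ord0 i0 : V) = 1.
  apply/eqP; rewrite eq_le delta_le1/=.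
  have := cn_coord (delta_mx ord0 i0 : V) i0; rewrite mxE !eqxx.
  by rewrite cn1.
have [k [Q [ O [d [sQ dQ pts esc]]]]] := stage_geometry act_cont act_inj (@cKG l) (KG1 l) (@KGV l)
  cH noncompact s u1 (@cK l) (@KKG l) (@moved l) Db.
have [_ cO _ _] := sQ.
have cU : compact [set x | exists2 q, q \in Q /\ xpredT q & O q x].
  by apply: compact_bigunion => q /cO[].
have [A' cA' A'P] := compact_nbhd (compactU (compactU cH (TKP l).1) cU).
exists (StageData M A' k Q O d); split=> //=; split=> //.
- by move=> x Hx; apply: MP; left.
- by move=> x Ex; apply: interior_subset; apply: MP; right.
- by move=> x Hx; apply: A'P; left; left.
- by move=> x Tx; apply: interior_subset; apply: A'P; left; right.
- by move=> q qQ x Ox; apply: interior_subset; apply: A'P; right; exists q.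
Qed.

(** Stage [l] occupies the levels from [s l] to [s l + st_k (sd l)]; the successor in [s l.+1] makes
    the ranges of consecutive stages adjacent. *)
Lemma stages_exist D : (forall i w, w \in D i -> 8 * i%:R + 4 <= vn w) ->
  exists (A : nat -> set X) (s : nat -> nat) (sd : nat -> stage_data X V),
    forall l, [/\ compact (A l), stage_ok D l (A l) (s l) (sd l), A l.+1 = st_next (sd l) &
      s l.+1 = (s l + (st_k (sd l)).+1)%N].
Proof.
move=> Db; pose St := {A : set X | compact A}.
have NX (l : nat) (S : St * nat) : exists sd, stage_ok D l (sval S.1) S.2 sd.
  by apply: stage_exists => //; case: S => -[].
pose nx l S := projT1 (cid (NX l S)).
have nxP l S : stage_ok D l (sval S.1) S.2 (nx l S) := projT2 (cid (NX l S)).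
have cn l S : compact (st_next (nx l S)) by have [_ []] := nxP l S.
pose F := fix F l : St * nat := if l is l'.+1 then
   (exist _ (st_next (nx l' (F l'))) (cn l' (F l')), ((F l').2 + (st_k (nx l' (F l'))).+1)%N)
   else (exist _ set0 compact0, 0%N).
exists (fun l => sval (F l).1), (fun l => (F l).2), (fun l => nx l (F l)) => l.
by split=> //; case: (F l).1.
Qed.

Definition block (b : bool) (k : 'I_m) : 'I_(m + m) := if b then rshift m k else lshift m k.

Lemma blockP i : exists b k, i = block b k.
Proof.
by case: (split_ordP i) => k ->; [exists false, k|exists true, k].
Qed.

Theorem assembly : exists j : X -> V, [/\ holomorphic j,
  forall A : set V, compact A -> compact (j @^-1` A),
  forall l, TP l (fun k x => j x ord0 (block false k)) &
  forall (F Fi : V -> V) g g' l0, (forall z, differentiable F z) -> (forall z, differentiable Fi z) ->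
    cancel F Fi -> cancel Fi F -> (forall x, act g (act g' x) = x) ->
    (forall l, (l0 <= l)%N -> K l g /\ KG l g') ->
    (forall x, F (j x) = j (act g x)) -> False].
Proof.
have [D [dl [dl0 Dan descent]]] := descent_nets R (m + m).
have Db i w : w \in D i -> 8 * i%:R + 4 <= vn w by move=> /Dan /andP[].
have [A [s [sd sP]]] := stages_exist Db.
pose Q l := st_Q (sd l); pose O l := st_O (sd l); pose d l := st_d (sd l).
(* Even indices are the sets between stages, odd ones the sets whose hull the points of a stage
   avoid. *)
pose M k := if odd k then st_M (sd k./2) else A k./2.
have Me l : M l.*2 = A l by rewrite /M odd_double doubleK.
have Mo l : M l.*2.+1 = st_M (sd l) by rewrite /M /= odd_double uphalf_double.
have cA l : compact (A l) by have [] := sP l.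
have cM k : compact (M k).
  by rewrite /M; case: ifP => _ //; have [_ [[]]] := sP k./2.
have hullM k : holomorphic_hull (M k) `<=` (M k.+1)^°.
  rewrite -[k]odd_double_half; case: (odd k); rewrite ?add0n ?add1n.
    by rewrite -doubleS Mo Me; have [_ [_ [_ H _ _] _ _ _] -> _] := sP k./2.
  by rewrite Mo Me; have [_ [[_ H _]]] := sP k./2.
have coverM x : exists k, M k x.
  have [l Ex] := coverE x; exists l.*2.+1; rewrite Mo.
  by have [_ [[_ _ H] _ _ _ _] _ _] := sP l; exact: H.
have sep l : separated (holomorphic_hull (M l.*2.+1)) (Q l) (O l).
  by rewrite Mo; have [_ [_ _ [H _] _ _] _ _] := sP l.
have dlow l q : q \in Q l -> 8 * (s l)%:R <= vn (d l q).
  by have [_ [_ _ [_ H] _ _] _ _] := sP l; exact: H.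
have sS l : s l.+1 = (s l + (st_k (sd l)).+1)%N by have [_ _ _] := sP l.
have smono l l' : (l <= l')%N -> (s l <= s l')%N.
  elim: l' => [|l' ih]; first by rewrite leqn0 => /eqP ->.
  rewrite leq_eqVlt => /predU1P[->//|/ih H]; apply: (leq_trans H).
  by rewrite sS leq_addr.
have sge l : (l <= s l)%N by elim: l => // l ih; rewrite sS addnS ltnS (leq_trans ih)// leq_addr.
(* The error at stage [l] has to be admissible for every level up to its last one; the default 1 of
   the minimum also bounds it by 1. *)
pose dl' l := \big[Order.min/1]_(i < (s l.+1).+1) dl i.
have dl'0 l : 0 < dl' l by apply: lt_bigmin.
have dl'1 l : dl' l <= 1 by exact: bigmin_le_id.
have dl'P l i : (i <= s l + st_k (sd l))%N -> dl' l <= dl i.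
  move=> il; have il' : (i < (s l.+1).+1)%N by rewrite sS addnS ltnS (leq_trans il).
  by rewrite /dl' (bigminD1 (Ordinal il'))//= ge_min lexx.
pose bl l q := `[< exists k, vn (d l q) <= cn (d l q ord0 (block true k)) >].
have m0 : (0 < m)%N by apply: leq_ltn_trans nm.
have blP l q : exists k, vn (d l q) <= cn (d l q ord0 (block (bl l q) k)).
  rewrite /bl; case: asboolP => // N.
  have [|i] := @vn_attained R _ (d l q); first by rewrite addn_gt0 m0.
  by have [[] [k ->]] := blockP i => H; [exfalso; apply: N; exists k|exists k].
have OM l q x : q \in Q l -> O l q x -> M l.+1.*2 x /\ ~ holomorphic_hull (M l.*2.+1) x.
  move=> qQ Ox; have [_ _ OH _] := sep l; split; last exact: OH qQ Ox.
  rewrite Me; have [_ [_ [_ _ _ OA] _ _ _] -> _] := sP l; exact: OA qQ x Ox.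
have KM l : TK l `<=` M l.+1.*2.
  by rewrite Me; have [_ [_ [_ _ H _] _ _ _] -> _] := sP l.
have uQ l : uniq (Q l) by have [] := sep l.
have cO l q : q \in Q l -> compact (O l q) /\ nbhs q (O l q) by have [_ H _ _] := sep l; exact: H.
have dO l p q x : p \in Q l -> q \in Q l -> O l p x -> O l q x -> p = q.
  by have [_ _ _ H] := sep l; exact: H.
have [f [hf fP]] := @construction R n X m X_stein nm M Q O bl (fun l q b k => d l q ord0 (block b k))
  (fun l => 8 * (s l.+1)%:R) dl' TK TP cM hullM coverM uQ cO dO OM dl'0 TKP KM.
pose j x : V := row_mx (\row_k f false k x) (\row_k f true k x).
have jE b k x : j x ord0 (block b k) = f b k x.
  by case: b; rewrite /block ?row_mxEl ?row_mxEr mxE.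
have jle b k x : cn (f b k x) <= vn (j x) by rewrite -jE cn_coord.
have hj : holomorphic j.
  move=> c Ac v cv.
  have hi i : differentiable (fun v => j (cinv c v) ord0 i : C^o) v.
    have [b [k ->]] := blockP i; under eq_fun do rewrite jE; exact: (hf b k c Ac v cv).
  have -> : j \o cinv c = \sum_(i < m + m) (fun v => j (cinv c v) ord0 i *: (delta_mx ord0 i : V)).
    by apply/funext => w; rewrite fct_sumE /= [LHS]row_sum_delta.
  by apply: differentiable_sum => i; exact: differentiableZl.
have cj : continuous j.
  move=> x A0 /(@nbhsV_P R V)[e e0 eA]; have e20 : 0 < e / 2 by rewrite divr_gt0.
  have : nbhs x [set y | forall i : 'I_(m + m), cn (j y ord0 i - j x ord0 i) < e / 2].
    apply: filter_forall => i; have [b [k ->]] := blockP i; rewrite jE.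
    have := @open_cn_lt _ _ X (fun y => f b k y - f b k x) (e / 2) (holoB (hf b k) (@holo_cst R n X _)).
    move=> o; have H : nbhs x [set y | cn (f b k y - f b k x) < e / 2].
      by apply: open_nbhs_nbhs; split=> //=; rewrite subrr cn0.
    by apply: filterS H => y /=; rewrite jE.
  apply: filterS => y H; apply: eA; apply: (@le_lt_trans _ _ (e / 2)); last by lra.
  by apply: vn_rV_le => [|i]; [exact: ltW|rewrite !mxE; have := H i; rewrite !mxE => /ltW].
(* The parity of the first index [k] with [M k x] tells which block is responsible for [x]. Inside
   some [O l' q], where that block may be held, [j x] is either large or close in its largest
   coordinate to the value at [q]. *)
have LB l x : ~ M l.*2.+1 x -> exists2 l', (l <= l')%N & 8 * (s l'.+1)%:R <= vn (j x) \/
    exists2 q, q \in Q l' & O l' q x /\ vn (d l' q) - 1 <= vn (j x).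
  move=> Nx; have exM : exists k, `[< M k x >] by have [k Mk] := coverM x; exists k; apply/asboolP.
  case: (ex_minnP exM) => k /asboolP Mk kmin.
  have lk : (l.*2.+1 < k)%N.
    by rewrite ltnNge; apply/negP => kl; exact: (Nx (M_le cM hullM kl Mk)).
  pose b := odd k; pose l' := (k./2).-1.
  have kE : k = (l'.+1.*2 + b)%N.
    rewrite /l' prednK; first by rewrite addnC odd_double_half.
    by rewrite half_gt0; lia.
  have ll' : (l <= l')%N.
    by have := leq_b1 b; move: lk kE; clear; move: l' (nat_of_bool b) => l' c; rewrite -!muln2; lia.
  exists l' => //.
  have Mk' : M (l'.+1.*2 + b)%N x by rewrite -kE.
  have Nk' : ~ M (l'.*2.+1 + b)%N x.
    move=> Mx; have := kmin _ (asboolT Mx); rewrite kE doubleS; clear; lia.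
  have Sx : (M (l'.+1.*2 + b) `\` (M (l'.*2.+1 + b))^°) x.
    by split; [exact: Mk'|move=> /interior_subset /Nk'].
  have [_ fS fO _] := fP l'.
  have [[q qQ Oq]|N] := pselect (exists2 q, q \in Q l' & O l' q x).
    have [[b' [k' le]]|H] := fO q x qQ Oq; first by left; exact: le_trans le (jle _ _ _).
    right; exists q => //; split=> //.
    have [k' k'P] := blP l' q; have := H k'; have := jle (bl l' q) k' x.
    have := cnBr (d l' q ord0 (block (bl l' q) k')) (f (bl l' q) k' x).
    by rewrite cnC; move: k'P; lra.
  left; have [q qQ Oq|k' le] := fS b x Sx; first by apply: N; exists q.
  exact: le_trans le (jle _ _ _).
have hullS l : M l.*2.+1 `<=` holomorphic_hull (M l.*2.+1) by exact: sub_hull (cM _).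
exists j; split=> //.
- move=> A0 cA0.
  have [p _|t [_ tP]] := compact_finite_cover (f := fun p => [set w : V | vn (w - p) < 1]) cA0.
    by apply/(@nbhsV_P R V); exists 1.
  pose B := \sum_(p <- t) vn p + 1.
  have BP w : A0 w -> vn w <= B.
    move=> /tP[p pt wp]; have : vn p <= \sum_(p <- t) vn p.
      by rewrite (big_rem p pt)/= lerDl; apply: sumr_ge0 => *; exact: vn_ge0.
    by have := vnD (w - p) p; rewrite subrK /B; move: wp => /=; lra.
  have [l lB] := nat_above (B + 2).
  apply: (subclosed_compact _ (cM l.*2.+1)) => [|x Ax].
    apply: closed_comp => [x _|]; first exact: cj.
    by apply: compact_closed => //; exact: norm_hausdorff.
  apply: contrapT => /LB[l' ll']; have := BP _ Ax.
  have h1 : l%:R <= (s l')%:R :> R by rewrite ler_nat (leq_trans ll')// sge.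
  have h2 : (s l')%:R <= (s l'.+1)%:R :> R by rewrite ler_nat smono.
  by move=> jB [|[q qQ [_]]]; [|have := dlow l' q qQ]; have := ler0n R l; lra.
- by move=> l; have [_ _ _] := fP l; rewrite (_ : f false = fun k x => j x ord0 (block false k))//;
    apply/funext => k; apply/funext => x; rewrite jE.
move=> F Fi g g' l0 dF dFi FK FiK gK gl Fj.
have [x0 _] := noncompact (@compact0 X).
have det0 : 0 < cn (\det (jac F (j x0))) by rewrite cn_gt0; exact: det_jac_neq0 dFi FK.
(* From stage [t] on every level satisfies the hypotheses of [descent] with base point [j x0]: it
   exceeds both norms and the inverse of the determinant. *)
have [t tP] := nat_above (l0%:R + vn (j x0) + vn (F (j x0)) + (cn (\det (jac F (j x0))))^-1).
have i0 : 0 < (cn (\det (jac F (j x0))))^-1 by rewrite invr_gt0.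
have t1 := vn_ge0 (j x0); have t2 := vn_ge0 (F (j x0)); have t3 := ler0n R l0.
have l0t : (l0 <= t)%N by rewrite -(ler_nat R); lra.
have [Kg _] := gl t l0t.
have [_ [_ _ _ pts _] _ _] := sP t.
have [p pQ [i /andP[si si'] [dp Hp Op]]] := pts g Kg.
have ti : (t%:R : R) <= i%:R by rewrite ler_nat (leq_trans (sge t)).
have near q l k : q \in Q l -> (k <= s l + st_k (sd l))%N -> vn (j q - d l q) <= dl' l.
  move=> qQ _; apply: vn_rV_le => [|i']; first exact: ltW.
  have [b [k' ->]] := blockP i'; have [H _ _ _] := fP l.
  by have := H b k' q qQ; rewrite -jE !mxE.
have jp : vn (j p) <= 8 * i%:R + 1.
  have := near p t _ pQ (leqnn _); have := dl'1 t; have := vnD (j p - d t p) (d t p).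
  by rewrite subrK /d dp; lra.
(* Each case of [LB] (large value, neighbourhood of the same stage, neighbourhood of a later stage)
   gives at least [8 i + 7]. *)
have gp : 8 * i%:R + 5 < vn (j (act g p)).
  have [|l' tl'] := LB t (act g p); first by move=> /hullS; rewrite Mo.
  have si1 : i%:R + 1 <= (s t.+1)%:R :> R.
    by rewrite natr1 ler_nat sS addnS ltnS.
  move=> [big|[q qQ [Oq dq]]].
    have : (s t.+1)%:R <= (s l'.+1)%:R :> R by rewrite ler_nat smono.
    by lra.
  move: tl'; rewrite leq_eqVlt => /predU1P[tl'|tl'].
    by rewrite -tl' in qQ Oq dq; have := Op q qQ Oq; rewrite -/(d t q); lra.
  have : (s t.+1)%:R <= (s l')%:R :> R by rewrite ler_nat smono.
  by have := dlow l' q qQ; lra.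
have : vn (F (j p)) <= 8 * i%:R + 5; last by rewrite Fj leNgt gp.
apply: (descent F Fi (j x0) i dF (fun z => differentiable_continuous (dFi z)) FK FiK) => [|||sg w isg wD|].
- by lra.
- by lra.
- by rewrite -[leRHS]invrK lef_pV2 ?posrE//; lra.
(* The stage that realises the net of level [sg]. It does not precede [t], so [g'] belongs to
   [KG l]. *)
- have [l [tl sl sl']] : exists l, [/\ (t <= l)%N, (s l <= sg)%N & (sg < s l.+1)%N].
    have ex : exists l, (sg < s l.+1)%N by exists sg; exact: sge.
    case: (ex_minnP ex) => l sgl lmin; have [tl|lt] := leqP t l.
      exists l; split=> //; case: l sgl lmin tl => [|l] sgl lmin tl.
        have t0 : t = 0%N by move: tl; rewrite leqn0 => /eqP.
        by rewrite t0 in si; exact: leq_trans si isg.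
      by rewrite leqNgt; apply/negP => /lmin; rewrite ltnn.
    by have := leq_trans (leq_trans (smono _ _ lt) si) isg; rewrite leqNgt sgl.
  have [_ [_ _ _ _ esc] _ _] := sP l.
  have sl'' : (s l <= sg <= s l + st_k (sd l))%N by rewrite sl; move: sl'; rewrite sS addnS ltnS.
  have [e eQ [de He]] := esc sg w sl'' wD.
  exists (j e).
    have := near e l _ eQ (leqnn _); rewrite /d de => /le_trans; apply.
    by apply: dl'P; case/andP: sl''.
  have [_ Kg'] := gl l (leq_trans l0t tl).
  (* As [F] extends [g], its inverse extends [g']; the image of [j e] is thus a point of [j X],
     which [He] and [LB] place far out. *)
  have -> : Fi (j e) = j (act g' e) by rewrite -{1}(gK e) -Fj FK.
  have [Hg Og] := He g' Kg'.
  have [|l' ll'] := LB l (act g' e); first by move=> /hullS; rewrite Mo.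
  have sg1 : sg%:R + 1 <= (s l.+1)%:R :> R by rewrite natr1 ler_nat.
  move=> [big|[q qQ [Oq dq]]].
    have : (s l.+1)%:R <= (s l'.+1)%:R :> R by rewrite ler_nat smono.
    by lra.
  move: ll'; rewrite leq_eqVlt => /predU1P[ll'|ll'].
    rewrite -ll' in qQ Oq dq; have qe := Og q qQ Oq; move: dq; rewrite qe /d de.
    by have := Db _ _ wD; lra.
  have : (s l.+1)%:R <= (s l')%:R :> R by rewrite ler_nat smono.
  by have := dlow l' q qQ; lra.
- exact: jp.
Qed.

End Assembly.

(** * Automorphisms move points near infinity *)

Section MovedPoints.
Variables (R : realType) (n : nat) (X : complex_manifold R n).
Hypothesis X_stein : stein X.
Local Notation C := R[i].
Local Notation V := (Cspace R n).
Local Notation holo := (@holo R n X).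

Lemma holo_comp (f : X -> C) (h : X -> X) : holo f -> holomorphic_self_map h -> holo (f \o h).
Proof.
move=> hf [ch hh] c Ac _ [x cx <-].
have [c1 A1 c1x] := @atlas_cover R n X (h x).
have nE : {near cmap c x, (f \o cinv c1) \o (cmap c1 \o h \o cinv c) =1 (f \o h) \o cinv c}.
  have H : nbhs x [set y | cdom c1 (h y)] by apply: ch; exact: cdom_nbhs.
  apply: filterS (near_chart cx H) => v hv /=; by rewrite cmapK.
apply: (@near_eq_differentiable C V C^o _ _ _ nE); apply: differentiable_comp.
  by apply: hh => //; exists x.
by apply: hf => //; exists (h x); rewrite //= cmapK.
Qed.

Lemma locally_constant_max (f : X -> C) x : holo f ->
  (\forall y \near x, cn (f y) <= cn (f x)) -> \forall y \near x, f y = f x.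
Proof.
move=> hf mx; have [c Ac cx] := @atlas_cover R n X x.
have /(@nbhsV_P R V)[s s0 sP] := near_chart cx mx.
have [r r0 rP] := chart_ball cx.
pose t := Num.min r s; have t0 : 0 < t by rewrite lt_min r0.
have hv : holV (f \o cinv c : V -> C^o) (cmap c x) t.
  by move=> w; rewrite lt_min => /andP[wr _]; apply: hf => //; exact: rP.
have H := holV_strong_maximum t0 hv.
have t80 : 0 < t / 8 by rewrite divr_gt0.
have N : nbhs x (cmap c @^-1` [set v : V | vn (v - cmap c x) < t / 8]).
  by apply: (cmap_continuous cx); apply/(@nbhsV_P R V); exists (t / 8).
apply: filterS2 (cdom_nbhs cx) N => y cy /= /ltW yt.
have := H _ _ yt; rewrite [cmap c x + _]addrC subrK /= !cmapK//; apply.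
by move=> w; rewrite lt_min => /andP[_ ws]; exact: sP.
Qed.

Lemma level_open (Z : set X) (f : X -> C) x : holo f -> open Z -> Z x ->
  (forall y, Z y -> cn (f y) <= cn (f x)) -> open (Z `&` [set y | f y = f x]).
Proof.
move=> hf oZ Zx mx; rewrite openE => y [Zy fy].
have nZ : nbhs y Z by exact: open_nbhs_nbhs.
have N : \forall z \near y, f z = f y.
  by apply: locally_constant_max => //; apply: filterS nZ => z Zz; rewrite fy; exact: mx.
by apply: filterS2 nZ N => z Zz fz; split=> //=; rewrite fz.
Qed.

Lemma level_closed (f : X -> C) (a : C) : holo f -> closed [set y | f y = a].
Proof.
move=> hf; rewrite (_ : [set y | _] = ~` [set y | 0 < cn (f y - a)]).
  apply: open_closedC; apply: (@open_cn_gt _ _ X (fun y => f y - a)).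
  by apply: holoB => //; exact: (@holo_cst R n X).
apply/seteqP; split=> y /=; first by move=> ->; rewrite subrr cn0 ltxx.
by move=> /negP; rewrite cn_gt0 negbK subr_eq0 => /eqP.
Qed.

(** The level set of [f i] through a point of maximal modulus is again compact and open, so the
    functions can be treated one after the other. *)
Lemma constant_on_clopen (I : eqType) (s : seq I) (f : I -> X -> C) (Z : set X) x :
  (forall i, holo (f i)) -> compact Z -> open Z -> Z x ->
  exists Z' y, [/\ open Z', Z' `<=` Z, Z' y & forall i, i \in s -> forall z, Z' z -> f i z = f i y].
Proof.
move=> hf; elim: s Z x => [|i s ih] Z x cZ oZ Zx; first by exists Z, x; split.
have [y /set_mem Zy yM] := compact_EVT_max (ex_intro _ x Zx) cZ
  (continuous_subspaceT (holo_cn_continuous (hf i))).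
pose Z1 := Z `&` [set z | f i z = f i y].
have cZ1 : compact Z1 by apply: compact_closedI => //; exact: level_closed.
have oZ1 : open Z1 by apply: level_open => // z Zz; apply: yM; exact: mem_set.
have [Z' [y' [oZ' Z'Z Zy' H]]] := ih Z1 y cZ1 oZ1 (conj Zy erefl).
exists Z', y'; split=> //; first by move=> z /Z'Z[].
move=> k; rewrite inE => /predU1P[->|/H//] z Zz.
by have [_ ->] := Z'Z z Zz; have [_ ->] := Z'Z y' Zy'.
Qed.

(* The maximum principle produces a smaller compact open set on which finitely many
   global coordinate systems are constant. *)
Lemma no_compact_open (Z : set X) x : (0 < n)%N -> compact Z -> open Z -> ~ Z x.
Proof.
move=> n0 cZ oZ Zx; have [_ _ SC] := X_stein.
pose F y := projT1 (cid (SC y)).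
have FP y : exists c : chart C X n, [/\ holomorphic (F y), good_chart c, cdom c y &
  forall z, cdom c z -> cmap c z = F y z] := projT2 (cid (SC y)).
pose ch y := projT1 (cid (FP y)).
have chP y : [/\ holomorphic (F y), good_chart (ch y), cdom (ch y) y &
  forall z, cdom (ch y) z -> cmap (ch y) z = F y z] := projT2 (cid (FP y)).
have [y _|s [_ sP]] := compact_finite_cover (f := fun y => cdom (ch y)) cZ.
  by have [_ _ H _] := chP y; exact: cdom_nbhs.
pose f (p : X * 'I_n) (z : X) : C := F p.1 z ord0 p.2.
have hf p : holo (f p).
  move=> c1 A1 v cv; have [hF _ _ _] := chP p.1.
  exact: (@diff_coord R V n (F p.1 \o cinv c1) v p.2 (hF c1 A1 v cv)).1.
have [Z' [y [oZ' Z'Z Zy Hc]]] := @constant_on_clopen _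
  [seq (p, i) | p <- s, i <- enum 'I_n] f Z x hf cZ oZ Zx.
have [p ps cy] := sP y (Z'Z y Zy); have [_ _ _ cF] := chP p.
have one z : Z' z -> cdom (ch p) z -> cmap (ch p) z = cmap (ch p) y.
  move=> Zz cz; rewrite !cF//; apply/rowP => i.
  apply: (Hc (p, i)) => //; apply/allpairsP; exists (p, i); split=> //=.
  exact: mem_enum.
have : nbhs (cmap (ch p) y) ((cmap (ch p) @` cdom (ch p)) `&` (cinv (ch p) @^-1` Z')).
  apply: filterI; first exact: cimg_nbhs.
  by apply: (near_chart cy); exact: open_nbhs_nbhs.
move=> /(@nbhsV_P R V)[d d0 dP].
pose v : V := cmap (ch p) y + ((d / 2)%:C%C : C) *: delta_mx ord0 (Ordinal n0).
have vd : vn (v - cmap (ch p) y) < d.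
  rewrite /v addrAC subrr add0r vnZ cn_real gtr0_norm ?divr_gt0//.
  have := delta_le1 R (Ordinal n0); have d20 : 0 < d / 2 by rewrite divr_gt0.
  by move=> /(ler_wpM2l (ltW d20)); rewrite mulr1; lra.
have [vI Zv] := dP v vd; have [cv cvK] := cinv_img vI.
have := one _ Zv cv; rewrite cvK /v => /eqP; rewrite addrC -subr_eq0 addrK.
apply/negP; rewrite -vn_gt0 vnZ cn_real gtr0_norm ?divr_gt0// mulr_gt0 ?divr_gt0//.
rewrite vn_gt0; apply/negP => /eqP /matrixP /(_ ord0 (Ordinal n0)).
by rewrite !mxE !eqxx => /eqP; rewrite oner_eq0.
Qed.

(** If [h] fixed all points off [A], then [f \o h - f] would vanish off [A], and the level set
    through its maximum would be a nonempty compact open set. *)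
Lemma moves_points (h : X -> X) (A : set X) : (0 < n)%N -> holomorphic_self_map h ->
  h <> id -> compact A -> exists2 x, ~ A x & h x <> x.
Proof.
move=> n0 hh hid cA; apply: contrapT => N.
have fixA x : ~ A x -> h x = x.
  by move=> Ax; apply: contrapT => hx; apply: N; exists x.
have [x1 hx1] : exists x, h x <> x.
  by apply: contrapT => /forallNP H; apply: hid; apply/funext => x; exact: contrapT (H x).
have Ax1 : A x1 by apply: contrapT => /fixA.
have [f [hf f1 f0]] := separate X_stein hx1.
pose u x := f (h x) - f x.
have hu : holo u by apply: holoB => //; exact: holo_comp.
have u1 : u x1 = 1 by rewrite /u f1 f0 subr0.
have uA x : ~ A x -> u x = 0 by move=> /fixA hx; rewrite /u hx subrr.
have [y /set_mem Ay yM] := compact_EVT_max (ex_intro _ x1 Ax1) cA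
  (continuous_subspaceT (holo_cn_continuous hu)).
have yM' x : cn (u x) <= cn (u y).
  have [Ax|/uA ->] := pselect (A x); first by apply: yM; exact: mem_set.
  by rewrite cn0 cn_ge0.
have uy : 0 < cn (u y).
  by apply: lt_le_trans (yM' x1); rewrite cn_gt0 u1 oner_eq0.
have ZA : [set x | u x = u y] `<=` A.
  by move=> x /= ux; apply: contrapT => /uA u0; move: uy; rewrite -ux u0 cn0 ltxx.
apply: (@no_compact_open [set x | u x = u y] y n0) => //.
  apply: (subclosed_compact _ cA ZA); exact: level_closed.
by rewrite -[X in open X]setTI; apply: level_open => //; exact: openT.
Qed.

Lemma noncompact_space (x0 : X) : (0 < n)%N -> forall A : set X, compact A -> exists x, ~ A x.
Proof.
move=> n0 A cA; apply: contrapT => /forallNP N.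
have AT : A = setT by apply/seteqP; split=> // x _; exact: contrapT (N x).
by apply: (@no_compact_open A x0 n0) => //; rewrite AT//; exact: openT.
Qed.

End MovedPoints.

(** * The automorphism group *)

Section CountableCovers.

Lemma countable_base (T : topologicalType) : @second_countable T ->
  exists b : nat -> set T, forall x A, nbhs x A -> exists2 i, b i x & b i `<=` A.
Proof.
move=> [B /countable_injP[e einj] [_ BP]].
pose b i : set T := if pselect (exists2 U, B U & e U = i) is left H then projT1 (cid2 H) else set0.
exists b => x A /(BP x) [U [BU Ux] UA].
have bE : b (e U) = U.
  rewrite /b; case: pselect => [H|N]; last by exfalso; apply: N; exists U.
  by case: cid2 => W BW eW /=; apply: einj; rewrite ?inE.
by exists (e U); rewrite bE.
Qed.

(** The Lindelof property in terms of sets only, so that it also covers the complement of the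
    diagonal. [None] stands for basic sets contained in no [f y]. *)
Lemma countable_subcover (T : Type) (D : set T) (f : T -> set T) (b : nat -> set T) :
  (forall x, D x -> exists2 i, b i x & exists2 y, D y & b i `<=` f y) ->
  exists s : nat -> option T, (forall i y, s i = Some y -> D y) /\
    forall x, D x -> exists i y, s i = Some y /\ f y x.
Proof.
move=> H; pose s i := if pselect (exists2 y, D y & b i `<=` f y) is left H then Some (projT1 (cid2 H)) else None.
exists s; split.
  by move=> i y; rewrite /s; case: pselect => // K [<-]; case: cid2.
move=> x /H[i bx yP]; exists i; rewrite /s; case: pselect => // K.
by exists (projT1 (cid2 K)); split=> //; case: cid2 => /= y _; apply.
Qed.

(** Applied to [X], to the group, and to the group without its identity; hence the restriction to a
    subset [D]. *)
Lemma compact_exhaustion (T : topologicalType) (D : set T) : @second_countable T ->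
  (forall x, D x -> exists L, [/\ compact L, nbhs x L & L `<=` D]) ->
  exists E : nat -> set T, [/\ forall i, compact (E i), forall i, E i `<=` D,
    forall i k, (i <= k)%N -> E i `<=` E k & forall x, D x -> exists i, E i x].
Proof.
move=> /countable_base[b bP] H.
pose f x := if pselect (D x) is left Dx then projT1 (cid (H x Dx)) else set0.
have fP x : D x -> [/\ compact (f x), nbhs x (f x) & f x `<=` D].
  by move=> Dx; rewrite /f; case: pselect => // Dx'; case: cid.
have [x Dx|s [sD sP]] := @countable_subcover T D f b.
  by have [_ /bP[i bx bf] _] := fP x Dx; exists i => //; exists x.
pose F i := if s i is Some y then f y else set0.
have cF i : compact (F i).
  by rewrite /F; case E : (s i) => [y|]; [have [] := fP y (sD i y E)|exact: compact0].
have FD i : F i `<=` D.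
  by rewrite /F; case E : (s i) => [y|]; [have [] := fP y (sD i y E)|move=> x].
exists (fun k => [set x | exists2 i, (i <= k)%N & F i x]); split.
- elim=> [|k ih].
    rewrite (_ : [set x | _] = F 0%N) //; apply/seteqP; split=> x; last by exists 0%N.
    by move=> [l]; rewrite leqn0 => /eqP ->.
  rewrite (_ : [set x | _] = [set x | exists2 i, (i <= k)%N & F i x] `|` F k.+1).
    exact: compactU.
  apply/seteqP; split=> x.
    by move=> [ i]; rewrite leq_eqVlt => /predU1P[ki Fx|ik Fx]; [right; rewrite -ki|left; exists i].
  by move=> [[i ik Fx]|Fx]; [exists i => //; exact: leqW|exists k.+1].
- by move=> k x [i _ /FD].
- by move=> i k ik x [l li Fx]; exists l => //; exact: leq_trans ik.
- by move=> x /sP[i [y [sy fx]]]; exists i, i => //; rewrite /F sy.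
Qed.

End CountableCovers.

Section RealManifold.
Variables (R : realType) (d : nat).

Lemma compact_real_ball (z : 'rV[R]_d) (r : R) : compact [set v : 'rV[R]_d | `|v - z| <= r].
Proof.
apply: bounded_closed_compact.
  exists (`|z| + r); split; first exact: num_real.
  move=> M Mr v /= vz; apply: le_trans (ltW Mr).
  by have := ler_normD (v - z) z; rewrite subrK; lra.
apply: (@closed_comp _ _ (fun v : 'rV[R]_d => `|v - z|) [set t | t <= r]); last exact: closed_le.
move=> v _; apply: (@continuous_comp _ _ _ (fun v : 'rV[R]_d => v - z) (fun u : 'rV[R]_d => `|u|) v).
  by apply: (@continuousB _ _ _ id (cst z) v); [exact: cvg_id|apply: cst_continuous].
exact: norm_continuous.
Qed.

Lemma real_chart_compact_nbhd (T : topologicalType) (c : chart R T d) x (U : set T) :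
  cdom c x -> nbhs x U -> exists L, [/\ compact L, nbhs x L & L `<=` U].
Proof.
move=> cx xU.
have N : nbhs (cmap c x) ((cmap c @` cdom c) `&` (cinv c @^-1` U)).
  apply: filterI; first exact: cimg_nbhs.
  by apply: (cinv_continuous cx); rewrite cmapK.
have /nbhs_ballP[r /= r0 rP] := N.
have r20 : 0 < r / 2 by rewrite divr_gt0.
have sub (v : 'rV[R]_d) : `|v - cmap c x| <= r / 2 -> (cmap c @` cdom c) v /\ U (cinv c v).
  by move=> vx; apply: rP; rewrite -ball_normE/= distrC; apply: le_lt_trans vx _; lra.
exists (cinv c @` [set v | `|v - cmap c x| <= r / 2]); split.
- apply: continuous_compact; last exact: compact_real_ball.
  by apply: continuous_in_subspaceT => v /set_mem /= /sub[cv _]; exact: cinv_cont.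
- have H : nbhs x (cmap c @^-1` [set v | `|v - cmap c x| <= r / 2]).
    apply: (cmap_continuous cx); apply/nbhs_ballP; exists (r / 2) => // v.
    by rewrite -ball_normE/= distrC => /ltW.
  apply: filterS2 (cdom_nbhs cx) H => y cy yr; by exists (cmap c y); rewrite ?cmapK.
- by move=> _ [v /sub[_ Uv] <-].
Qed.

End RealManifold.

Section AutGroup.
Variables (R : realType) (n : nat) (X : complex_manifold R n).
Local Notation G := (Aut X).

Lemma autP (g : G) : automorphism X (aut_fun g).
Proof. exact: set_valP. Qed.

Lemma aut_inj (g : G) : injective (aut_fun g).
Proof. by have [_ [h [_ gK _]]] := autP g; exact: can_inj gK. Qed.

Lemma aut_eq (g h : G) : aut_fun g = aut_fun h -> g = h.
Proof. exact: val_inj. Qed.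

Lemma aut_nbhs (g : G) (K : set X) (O : set X) : compact K -> open O ->
  aut_fun g @` K `<=` O -> nbhs g [set h : G | aut_fun h @` K `<=` O].
Proof.
move=> cK oO gK.
have := @initial_continuous _ _ (set_val : automorphism X -> {compact-open, X -> X}) g.
move=> /(_ [set h : {compact-open, X -> X} | h @` K `<=` O]); apply.
by apply: open_nbhs_nbhs; split; [exact: compact_open_open|].
Qed.

(** A neighbourhood in the compact-open topology controls maps on compact sets only, so [x] needs a
    compact neighbourhood that [g] maps into the given open set. *)
Lemma aut_eval_continuous : continuous (fun p : G * X => aut_fun p.1 p.2).
Proof.
move=> [g x] U /=; rewrite nbhsE => -[ O1 [oO Ox] OU].
have [[cg _] _] := autP g.
have xO : nbhs x (aut_fun g @^-1` O1) by apply: cg; exact: open_nbhs_nbhs.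
have [L [cL xL LU]] := X_locally_compact xO.
exists ([set h : G | aut_fun h @` L `<=` O1], L) => /=.
  split=> //=; apply: aut_nbhs => // _ [y Ly <-]; exact: LU.
by move=> [h y] /= [hL Ly]; apply: OU; apply: hL; exists y.
Qed.

(** The neutral element comes abstractly from the group structure; as an injective idempotent map it
    is the identity. *)
Lemma aut_one mul_one inv : is_group (@aut_mul R n X) mul_one inv -> aut_fun mul_one = id.
Proof.
move=> [_ one1 _ _ _]; apply/funext => x; apply: (@aut_inj mul_one).
exact: (congr1 (fun g => aut_fun g x) (one1 mul_one)).
Qed.

End AutGroup.

(** * Dimension zero *)

Section ZeroDimensional.
Variables (R : realType) (X : complex_manifold R 0).
Local Notation C := R[i].

Lemma discrete0 (x : X) : nbhs x [set x].
Proof.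
have [c Ac cx] := @atlas_cover R 0 X x.
apply: filterS (cdom_nbhs cx) => y cy /=.
by rewrite -(cmapK cx) -(cmapK cy); congr (cinv c _); apply/rowP => -[].
Qed.

Lemma continuous0 (f : X -> X) : continuous f.
Proof. by move=> x A /nbhs_singleton Afx; apply: filterS (discrete0 x) => y ->. Qed.

Lemma differentiable0 (W : normedModType C) (f : Cspace R 0 -> W) z : differentiable f z.
Proof.
have [] := @fderiv_differentiable R (Cspace R 0) W f z (\0 : {linear Cspace R 0 -> W}) => //.
  by move=> x; exact: cst_continuous.
move=> e e0; exists 1 => // v _; have -> : v = 0 by apply/rowP => -[].
by rewrite addr0 subrr /= subr0 !vn0 mulr0.
Qed.

Lemma self_map0 (f : X -> X) : holomorphic_self_map f.
Proof. by split=> [|c c' _ _ v _]; [exact: continuous0|exact: differentiable0]. Qed.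

Lemma compact_finite0 (A : set X) : compact A -> exists s : seq X, forall x, A x -> x \in s.
Proof.
move=> cA; have [x _|s [_ sP]] := compact_finite_cover (f := fun x => [set x]) cA.
  exact: discrete0.
by exists s => x /sP[y ys ->].
Qed.

(** A neighbourhood [K] of the identity contains all permutations that fix some finite set [s]. If
    [K] is compact, the orbit of a point [p] off [s] is finite, yet the transposition of [p] with
    any point off [s] lies in [K]. *)
Lemma not_locally_compact0 (one : Aut X) (K : set (Aut X)) : ~ finite_set [set: X] ->
  aut_fun one = id -> compact K -> ~ nbhs one K.
Proof.
move=> Xinf one1 cK nK.
have pick (s : seq X) : exists x, x \notin s.
  apply: contrapT => /forallNP N; apply: Xinf; apply/finite_seqP; exists s.
  by apply/seteqP; split=> // x _ /=; have /negP := N x; rewrite negbK.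
have [s sP] : exists s : seq X, forall g : Aut X, (forall x, x \in s -> aut_fun g x = x) -> K g.
  have [_ [[B Bop <-] B1 BK]] := nK.
  (* Generated by the sets of maps that fix a finite set pointwise; it converges to the identity
     because compact sets are finite here. *)
  pose F := filter_from [set: seq X] (fun s => [set f : {compact-open, X -> X} | forall x, x \in s -> f x = x]).
  have FF : Filter F.
    apply: filter_from_filter; first by exists [::].
    move=> s t _ _; exists (s ++ t) => // f H; split=> x xs; apply: H; by rewrite mem_cat xs ?orbT.
  have Fid : F --> (set_val one : {compact-open, X -> X}).
    apply/compact_open_cvgP => A O cA oO AO; have [s sA] := compact_finite0 cA.
    exists s => // f fs _ [y Ay <-]; rewrite fs ?sA//; apply: AO; exists y => //.
    by rewrite -[LHS]/(aut_fun one y) one1.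
  have [|s _ sB] := Fid B; first by apply: open_nbhs_nbhs.
  by exists s => g gs; apply: BK; exact: sB.
have [p ps] := pick s.
have cp : compact [set aut_fun g p | g in K].
  apply: continuous_compact cK; apply: continuous_subspaceT.
  exact: (act_contl (@aut_eval_continuous R 0 X)).
have [t tP] := compact_finite0 cp; have [q] := pick (p :: s ++ t).
rewrite inE mem_cat !negb_or => /andP[qp /andP[qs qt]].
pose tau (x : X) := if x == p then q else if x == q then p else x.
have tauK : cancel tau tau.
  move=> x; rewrite /tau; have [->|xp] := eqVneq x p; first by rewrite (negbTE qp) eqxx.
  by have [->|xq] := eqVneq x q; rewrite ?eqxx// (negbTE xp) (negbTE xq).
have tauA : automorphism X tau.
  by split; [exact: self_map0|exists tau; split=> //; exact: self_map0].
pose g : Aut X := exist _ tau (mem_set tauA).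
have Kg : K g.
  apply: sP => x xs; rewrite -[LHS]/(tau x) /tau.
  have [xp|_] := eqVneq x p; first by rewrite -xp xs in ps.
  by have [xq|//] := eqVneq x q; rewrite -xq xs in qs.
have : q \in t by apply: tP; exists g => //; rewrite -[LHS]/(tau p) /tau eqxx.
by rewrite (negbTE qt).
Qed.

End ZeroDimensional.

(** * Positive dimension *)

Section PositiveDimension.
Variables (R : realType) (n : nat) (X : complex_manifold R n).
Local Notation C := R[i].
Hypothesis X_stein : stein X.
Hypothesis n0 : (0 < n)%N.
Hypothesis X_nonempty : exists x : X, True.

Lemma generic_trivial m : generic (set0 : set X) (setT : set ('I_m -> X -> C)).
Proof.
split=> [|f M e hf cM e0]; first exact: compact0.
exists f; split=> //; last by exists 1.
by move=> k x _; rewrite subrr cn0 ltW.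
Qed.

(** Second countability reduces injectivity and immersivity to countably many local conditions. Even
    indices carry separation, odd ones immersivity, and a trivial condition fills the empty
    places. *)
Lemma generic_family m : ((n * 2).*2 < m)%N ->
  exists (TK : nat -> set X) (TP : nat -> set ('I_m -> X -> C)),
    (forall l, generic (TK l) (TP l)) /\ forall j, (forall l, TP l j) ->
      (forall x y, x <> y -> exists k, j k x <> j k y) /\ forall x, immersive_at j x.
Proof.
move=> nm; have [_ /countable_base[b bP] _ _] := @atlasP R n X.
have S (p : X * X) : exists S : set X * set X * set X, p.1 <> p.2 ->
   [/\ nbhs p.1 S.1.1, nbhs p.2 S.1.2 & generic S.2 (fun j : 'I_m -> X -> C =>
      forall x y, S.1.1 x -> S.1.2 y -> exists k, j k x <> j k y)].
  have [|/(generic_separate X_stein nm)[U [W [K H]]]] := pselect (p.1 = p.2).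
    by exists (set0, set0, set0).
  by exists (U, W, K).
pose s p := projT1 (cid (S p)).
have sP p : p.1 <> p.2 -> [/\ nbhs p.1 (s p).1.1, nbhs p.2 (s p).1.2 &
    generic (s p).2 (fun j : 'I_m -> X -> C =>
      forall x y, (s p).1.1 x -> (s p).1.2 y -> exists k, j k x <> j k y)] := projT2 (cid (S p)).
pose b2 k : set (X * X) := if unpickle k is Some (i, l) then b i `*` b l else set0.
have [p Dp|t [tD tP]] := @countable_subcover _ [set p : X * X | p.1 <> p.2]
    (fun p => (s p).1.1 `*` (s p).1.2) b2.
  have [/bP[i bi bis] /bP[l bl bls] _] := sP p Dp.
  exists (pickle (i, l)); first by rewrite /b2 pickleK.
  by exists p => //; rewrite /b2 pickleK => q [/bis ? /bls ?].
have I (x : X) : exists I : set X * set X, nbhs x I.1 /\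
    generic I.2 (fun j : 'I_m -> X -> C => forall y, I.1 y -> immersive_at j y).
  by have [U [K [nU gK]]] := generic_immersive X_stein nm x; exists (U, K).
pose r x := projT1 (cid (I x)).
have rP x : nbhs x (r x).1 /\ generic (r x).2 (fun j : 'I_m -> X -> C =>
    forall y, (r x).1 y -> immersive_at j y) := projT2 (cid (I x)).
have [x _|u [_ uP]] := @countable_subcover _ setT (fun x => (r x).1) b.
  by have [/bP[i bi bir] _] := rP x; exists i => //; exists x.
pose TK l := if odd l then (if u l./2 is Some x then (r x).2 else set0)
  else (if t l./2 is Some p then (s p).2 else set0).
pose TP l : set ('I_m -> X -> C) := if odd l
  then (if u l./2 is Some x then fun j => forall y, (r x).1 y -> immersive_at j y else setT)
  else (if t l./2 is Some p then fun j =>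
    forall x y, (s p).1.1 x -> (s p).1.2 y -> exists k, j k x <> j k y else setT).
exists TK, TP; split.
  move=> l; rewrite /TK /TP; case: ifP => _.
    by case: (u _) => [x|]; [have [] := rP x|exact: generic_trivial].
  by case E : (t _) => [p|]; [have [] := sP p (tD _ _ E)|exact: generic_trivial].
move=> j jP; split.
  move=> x y xy; have [i [p [tp [/= sx sy]]]] := tP (x, y) xy.
  by have := jP i.*2; rewrite /TP odd_double doubleK tp; exact.
move=> x; have [i [y [uy rx]]] := uP x Logic.I.
by have := jP i.*2.+1; rewrite /TP /= odd_double /= uphalf_double uy; exact.
Qed.

Theorem rigid_embedding : is_lie_group R (@aut_mul R n X) ->
  exists (N : nat) (j : X -> Cspace R N), embedding j /\
    forall g : Aut X, aut_fun g <> id -> ~ exists Phi : Cspace R N -> Cspace R N,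
      CN_automorphism Phi /\ Phi \o j = j \o aut_fun g.
Proof.
move=> [one [inv [d [B [grp [hG scG covG _] [cinv _] _ _]]]]].
have [mulA one1 mul1 mulV mulVr] := grp.
have oneE := aut_one grp.
have [hX scX _ _] := @atlasP R n X.
pose G := Aut X.
have lcG (g : G) U : nbhs g U -> exists L, [/\ compact L, nbhs g L & L `<=` U].
  by have [c _ cg] := covG g; exact: real_chart_compact_nbhd cg.
have [L [cL _ Lmono LG]] := @compact_exhaustion G setT scG (fun g _ => lcG g setT filterT).
have [L' [cL' L'D L'mono L'G]] : exists E : nat -> set G, [/\ forall i, compact (E i),
    forall i, E i `<=` [set g | g <> one], forall i k, (i <= k)%N -> E i `<=` E k &
    forall g, g <> one -> exists i, E i g].
  apply: (@compact_exhaustion G [set g | g <> one] scG) => g /= g1; apply: lcG.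
  apply: open_nbhs_nbhs; split=> //; rewrite (_ : [set h | _] = ~` [set one]) //.
  by apply: closed_openC; apply: compact_closed => //; exact: compact_set1.
have [E [cE _ _ EX]] := @compact_exhaustion X setT scX
  (fun x _ => @X_locally_compact R n X x setT filterT).
(* Closed under inverses and containing the identity, as the choice of points far out requires. *)
pose KG l := L l `|` [set inv g | g in L l] `|` [set one].
(* Both exhaustions increase, so every [g <> one] lies in [K l] for all large [l] and is detected at
   arbitrarily high levels. *)
pose K l := L' l `&` L l.
pose act (g : G) x := aut_fun g x.
have invE g x : act g (act (inv g) x) = x /\ act (inv g) (act g x) = x.
  split.
    by have := congr1 (fun h : G => aut_fun h x) (mulVr g); rewrite /= oneE.
  by have := congr1 (fun h : G => aut_fun h x) (mulV g); rewrite /= oneE.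
have cKG l : compact (KG l).
  apply: compactU; last exact: compact_set1; apply: compactU => //.
  by apply: continuous_compact => //; exact: continuous_subspaceT.
have KG1 l : exists2 g, KG l g & forall x, act g x = x.
  by exists one => [|x]; [right|rewrite /act oneE].
have KGV l g : KG l g -> exists2 g', KG l g' & forall x, act g' (act g x) = x.
  move=> [[Lg|[h Lh <-]]|->].
  - by exists (inv g) => [|x]; [left; right; exists g|have [] := invE g x].
  - by exists h => [|x]; [left; left|have [] := invE h x].
  - by exists one => [|x]; [right|rewrite /act oneE].
have cK l : compact (K l) by apply: compact_closedI => //; exact: compact_closed.
have KKG l : K l `<=` KG l by move=> g [_ Lg]; left; left.
have moved l g (A : set X) : K l g -> compact A -> exists2 x, ~ A x & act g x <> x.
  move=> [/L'D g1 _] cA; have [hg _] := autP g.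
  by apply: moves_points => //; rewrite -oneE => /aut_eq.
have [x0 _] := X_nonempty.
pose m := (n * 2).*2.+1.
have [TK [TP [TKP TPj]]] := @generic_family m (ltnSn _).
have [j [hj proper_j jT ext]] := @assembly R n X m G act KG K E TK TP X_stein (ltnSn _)
  (@aut_eval_continuous R n X) (@aut_inj R n X) cKG KG1 KGV cK KKG moved
  (noncompact_space X_stein x0 n0) cE (fun x => EX x Logic.I) TKP.
have [jsep jimm] := TPj _ jT.
exists (m + m)%N, j; split.
  split=> //.
  - move=> x y jxy; apply: contrapT => /jsep[k]; apply.
    by rewrite jxy.
  - apply: immersive_of_coords => // x; have [c [gc cx H]] := jimm x.
    by exists c; split=> // w /H[k]; exists (block false k).
move=> g gid [Phi [[dPhi [Psi [dPsi PhiK PsiK]]] Phij]].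
have g1 : g <> one by move=> gE; apply: gid; rewrite gE.
have [i1 L'g] := L'G g g1; have [i2 Lg] := LG g Logic.I.
apply: (ext Phi Psi g (inv g) (maxn i1 i2)) => //.
- by move=> z; exact: dPhi.
- by move=> z; exact: dPsi.
- by move=> x; have [] := invE g x.
- move=> l; rewrite geq_max => /andP[l1 l2]; split.
    by split; [exact: L'mono l1 g L'g|exact: Lmono l2 g Lg].
  by left; right; exists g => //; exact: Lmono l2 g Lg.
- by move=> x; exact: (congr1 (fun f => f x) Phij).
Qed.

End PositiveDimension.

Theorem corollary1 (R : realType) (n : nat) (X : complex_manifold R n)
    (X_stein : stein X)
    (X_infinite : ~ finite_set [set: X])
    (AutX_lie : is_lie_group R (@aut_mul R n X)) :
  exists (N : nat) (j : X -> Cspace R N),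
    embedding j /\
    forall g : Aut X, aut_fun g <> id ->
      ~ exists Phi : Cspace R N -> Cspace R N,
          CN_automorphism Phi /\ Phi \o j = j \o aut_fun g.
Proof.
have nonempty : exists x : X, True.
  apply: contrapT => N; apply: X_infinite; rewrite (_ : [set: X] = set0).
    exact: finite_set0.
  by apply/seteqP; split=> // x _; apply: N; exists x.
case: n X X_stein X_infinite AutX_lie nonempty => [|n] X X_stein X_infinite AutX_lie nonempty.
  exfalso; have [one [inv [d [B [grp [_ _ cov _] _ _ _]]]]] := AutX_lie.
  have [c _ c1] := cov one.
  have [L [cL nL _]] := real_chart_compact_nbhd c1 (@filterT _ (nbhs one) _).
  exact: (not_locally_compact0 X_infinite (aut_one grp) cL nL).
exact: rigid_embedding.
Qed.
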